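(* Let $p,r\in(0,\infty)$ and $q,s\in(0,\infty]$. (i) If $p<1$ or $p\neq r$, there are no doubling weights $u$ on $\mathbb R$ such that $H:L^{p,q}(u)\to L^{r,s}(u)$ is bounded. (ii) If $q\le1$ and $u$ is a weight on $\mathbb R$, the boundedness $H:L^{1,q}(u)\to L^{1,\infty}(u)$ holds if and only if $u\in A_1$. (iii) If $q>1$, the boundedness $H:L^{1,q}(u)\to L^{1,\infty}(u)$ does not hold for any weight $u$ on $\mathbb R$.
   Context: A weight on $\mathbb R$ is a positive locally integrable function $u$; $u(E)=\int_E u(x)\,dx$. A weight $u$ is doubling if there is $C>0$ with $u(2I)\le Cu(I)$ for all bounded intervals $I$, where $2I$ is the interval with the same center as $I$ and twice its length. $f^*_u$ is the decreasing rearrangement of $f$ with respect to the measure $u(x)\,dx$. $L^{p,q}(u)$ is the Lorentz space of measurable $f$ on $\mathbb R$ with $\|f\|_{L^{p,q}(u)}=\left(\int_0^\infty (f^*_u(t))^q\,t^{q/p-1}\,dt\right)^{1/q}<\infty$ if $0<q<\infty$, and $\|f\|_{L^{p,\infty}(u)}=\sup_{t>0}t^{1/p}f^*_u(t)<\infty$ if $q=\infty$. The Hilbert transform is $Hf(x)=\frac1\pi\lim_{\varepsilon\to0^+}\int_{|x-y|>\varepsilon}\frac{f(y)}{x-y}\,dy$, whenever this limit exists almost everywhere. $H:X\to Y$ is bounded means that $H$ is well defined on $X$ and there is $C>0$ with $\|Hf\|_Y\le C\|f\|_X$ for all $f\in X$. $u\in A_1$ means $Mu(x)\le Cu(x)$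 for a.e. $x\in\mathbb R$ and some constant $C$, where $Mf(x)=\sup_{x\in I}\frac1{|I|}\int_I|f(y)|\,dy$ (supremum over intervals $I$ containing $x$). *)

(* Defs.v *)
From HB Require Import structures.
From mathcomp Require Import all_boot all_order all_algebra.
From mathcomp Require Import all_classical all_reals all_analysis.

Set Implicit Arguments.
Unset Strict Implicit.
Unset Printing Implicit Defensive.

Import Order.TTheory GRing.Theory Num.Theory.
Import numFieldNormedType.Exports.

Local Open Scope classical_set_scope.
Local Open Scope ring_scope.
Local Open Scope ereal_scope.

(* "Measurable" means Borel measurable: every Lebesgue measurable function is
   a.e. equal to a Borel one, and all the notions below are invariant under
   modification on a null set. *)

Section Weights.
Context {R : realType}.
Implicit Types u f : R -> R.
Local Notation mu := (@lebesgue_measure R).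

(* Weights are only considered up to null sets, hence positivity a.e. *)
Definition weight u : Prop :=
  locally_integrable [set: R] u /\ {ae mu, forall x, (0 < u x)%R}.

Definition wmeas u (E : set R) : \bar R := \int[mu]_(x in E) (u x)%:E.

(* The bounded interval with endpoints a and b; each of the booleans says which
   side of its endpoint the bound lies on: bitv true false a b is [a, b] and
   bitv false true a b is ]a, b[ *)
Definition bitv (l r : bool) (a b : R) : set R :=
  [set` Interval (BSide l a) (BSide r b)].

Definition dilate2 (l r : bool) (a b : R) : set R :=
  let c := ((a + b) / 2)%R in bitv l r (c - (b - a))%R (c + (b - a))%R.

Definition doubling u : Prop :=
  exists2 C : R, (0 < C)%R &
    forall (l r : bool) (a b : R), (a < b)%R ->
      wmeas u (dilate2 l r a b) <= C%:E * wmeas u (bitv l r a b).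

(* The uncentered maximal operator; the library's HL_maximal is the centered
   one. *)
Definition maximal f (x : R) : \bar R :=
  ereal_sup [set z | exists (l r : bool) (a b : R),
    [/\ (a < b)%R, bitv l r a b x & z = iavg f (bitv l r a b)]].

Definition A1 u : Prop :=
  exists C : R, {ae mu, forall x, maximal u x <= C%:E * (u x)%:E}.

End Weights.

Section Lorentz.
Context {R : realType}.
Implicit Types u f : R -> R.
Local Notation mu := (@lebesgue_measure R).

(* The infimum of the empty set is +oo. *)
Definition rearrangement u f (t : R) : \bar R :=
  ereal_inf [set s%:E | s in
    [set s : R | (0 <= s)%R /\ wmeas u [set x | (s < `|f x|)%R] <= t%:E]].

(* Only meant for 0 < p and 0 < q, so the second branch is the case q = +oo. *)
Definition lorentz_norm u (p : R) (q : \bar R) f : \bar R :=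
  if q is q'%:E then
    (\int[mu]_(t in `]0%R, +oo[)
       (rearrangement u f t `^ q' * (t `^ (q' / p - 1))%:E)) `^ q'^-1
  else
    ereal_sup [set (t `^ p^-1)%:E * rearrangement u f t | t in `]0%R, +oo[].

Definition lorentz u (p : R) (q : \bar R) : set (R -> R) :=
  [set f | measurable_fun [set: R] f /\ lorentz_norm u p q f < +oo].

End Lorentz.

Section Hilbert.
Context {R : realType}.
Implicit Types u f : R -> R.
Local Notation mu := (@lebesgue_measure R).

Definition hilbert_trunc f (x e : R) : R :=
  (\int[mu]_(y in [set y | e < `|x - y|]) (f y / (x - y)))%R.

(* The truncated integrals must be genuine Lebesgue integrals, since \int
   returns a default value on non-integrable functions. *)
Definition hilbert_exists f (x : R) : Prop :=
  (forall e : R, (0 < e)%R ->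
     mu.-integrable [set y | (e < `|x - y|)%R]
       (fun y => (f y / (x - y))%:E)) /\
  cvg (hilbert_trunc f x e @[e --> (0 : R)^'+]).

Definition hilbert f (x : R) : R :=
  if `[< hilbert_exists f x >] then
    (pi^-1 * lim (hilbert_trunc f x e @[e --> (0 : R)^'+]))%R
  else 0%R.

(* H : L^{p,q}(u) -> L^{r,s}(u) is bounded *)
Definition hilbert_bounded u (p : R) (q : \bar R) (r : R) (s : \bar R) : Prop :=
  (forall f, lorentz u p q f -> {ae mu, forall x, hilbert_exists f x}) /\
  exists2 C : R, (0 < C)%R &
    forall f, lorentz u p q f ->
      lorentz_norm u r s (hilbert f) <= C%:E * lorentz_norm u p q f.

End Hilbert.

(* Main.v *)
Require Import Defs.
From HB Require Import structures.
From mathcomp Require Import all_boot all_order all_algebra.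
From mathcomp Require Import all_classical all_reals all_analysis.
From mathcomp Require Import measurable_realfun real_interval.
From mathcomp Require Import ring lra.

Set Implicit Arguments.
Unset Strict Implicit.
Unset Printing Implicit Defensive.

Import Order.TTheory GRing.Theory Num.Theory.
Import numFieldNormedType.Exports.

Local Open Scope classical_set_scope.
Local Open Scope ring_scope.
Local Open Scope ereal_scope.

(** The negative statements come from testing on one-sided bumps. If [f >= 0] lives on an interval
    and [J] is an interval beside it, with mutual distances at most [D], then the kernel keeps its
    sign and [|Hf|] is at least [(pi D)^-1] times the integral of [f] on [J]. Boundedness then
    controls a power of the mass of [J] ([bump_test], and [interval_test] for indicators). For a
    doubling weight, adjacent intervals of equal length yield [u(I)^(1/r) <= K u(I)^(1/p)] for every
    [I], while [u(I)] takes arbitrarily small and arbitrarily large values, so [p = r]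
    ([no_off_diagonal]). If [p = r < 1], cut an interval into [N] equal pieces and test on a piece
    with at most the average mass: the rest has at most [2 (C N)^p] times that mass, too little for
    large [N] ([no_diagonal]).

    For [p = r = 1] and target [L^{1,oo}], testing twice across an interval gives
    [|E| u(I) <= K |I| u(E)] for [E] inside [I], whence A1 ([hilbert_bounded_A1_mass]). When
    [q > 1], pick [x0] with [u(]x0 - h, x0 + h[) <= M h]: truncating [|x - x0|^-1] to [n] dyadic
    levels gives integral [2 n] but norm at most of order [n^th] with [th < 1], which contradicts
    [bump_test] ([no_hilbert_bounded_gt1]).

    For sufficiency with [q <= 1], [L^{1,q}(u)] embeds into [L^1(u)] ([lorentz_L1]), and there
    remains the weak type bound for the maximal truncated transform under A1. Without a weight it
    rests on Boole's identity: for positive masses, the set where [\sum_i c_i / (x - a_i) >= t] has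
    length [\sum_i c_i / t]. This handles discretized kernels, and a comparison of Cotlar's kind
    passes to all truncations ([hstar_weak]). A good-lambda inequality on the components of the
    level sets carries the bound over to A1 weights ([good_lambda], [weighted_weak_compact],
    [weighted_weak]). Principal values exist almost everywhere because step functions have
    stationary truncations, are dense in L1, and the maximal bound controls the error
    ([htrunc_cvg_compact], [hilbert_exists_ae]). *)

(** * Measures given by a density *)

Section density.
Context {R : realType}.
Local Notation mu := (@lebesgue_measure R).

(** The absolute value makes this a measure for every measurable [w], so one construction serves
    both for weights and for the mass of signed functions. *)
Definition density {w : R -> R} (mw : measurable_fun [set: R] w) (A : set R) :=
  \int[mu]_(x in A) `|w x|%:E.

Section measure_density.
Context {w : R -> R} (mw : measurable_fun [set: R] w).

Let density0 : density mw set0 = 0. Proof. exact: integral_set0. Qed.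

Let density_ge0 A : 0 <= density mw A. Proof. by apply: integral_ge0. Qed.

Let density_sigma_additive : semi_sigma_additive (density mw).
Proof.
apply: (@semi_sigma_additive_nng_induced _ _ R mu (fun x => `|w x|%:E)) => //.
by apply/measurable_EFinP; exact: measurableT_comp.
Qed.

HB.instance Definition _ := isMeasure.Build _ _ _ (density mw)
  density0 density_ge0 density_sigma_additive.

End measure_density.

Lemma measurable_norm_EFin {w : R -> R} (mw : measurable_fun [set: R] w)
  (A : set R) : measurable_fun A (fun x => `|w x|%:E).
Proof.
by apply: measurable_funTS; apply/measurable_EFinP; exact: measurableT_comp.
Qed.

End density.

(** * Sets covered by measurable sets of small measure *)

Section covers.
Context {disp : measure_display} {T : measurableType disp} {R : realType}.
(* [m] need not be an outer measure on non-measurable sets: smallness of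
   arbitrary sets is expressed through measurable supersets. *)
Definition covered (m : set T -> \bar R) (E : set T) (c : \bar R) :=
  exists A : set T, [/\ measurable A, E `<=` A & m A <= c].

Variable m : {measure set T -> \bar R}.

Lemma covered_measurable (E : set T) c : measurable E -> covered m E c -> m E <= c.
Proof.
move=> mE [A [mA EA]]; apply: le_trans.
by apply: le_measure => //; rewrite inE.
Qed.

Lemma measurable_covered (E : set T) c : measurable E -> m E <= c -> covered m E c.
Proof. by move=> mE Ec; exists E; split. Qed.

Lemma covered_sub (E F : set T) c d :
  E `<=` F -> c <= d -> covered m F c -> covered m E d.
Proof.
move=> EF cd [A [mA FA Ac]]; exists A; split => //.
  exact: subset_trans FA.
exact: le_trans cd.
Qed.

Lemma coveredU (E F : set T) c d :
  covered m E c -> covered m F d -> covered m (E `|` F) (c + d).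
Proof.
move=> [A [mA EA Ac]] [B [mB FB Bd]]; exists (A `|` B); split.
- exact: measurableU.
- exact: setUSS.
- by apply: (le_trans (measureU2 _ _ _)) => //; exact: leeD.
Qed.

(** A Fatou argument: [E] lies in the limit inferior of the measurable covers, an increasing union
    of intersections of measure at most [c]. It passes bounds to a limit without measurability of
    [E]. *)
Lemma covered_liminf (E : set T) (E_ : nat -> set T) c :
  (forall n, covered m (E_ n) c) ->
  (forall x, E x -> exists N, forall n, (N <= n)%N -> E_ n x) ->
  covered m E c.
Proof.
move=> cE_ EE_.
have [A A_] := choice cE_.
pose B N := \bigcap_(n in [set n | (N <= n)%N]) A n.
have mA n : measurable (A n) by have [] := A_ n.
have mB N : measurable (B N).
  by apply: bigcap_measurable => //; exists N => /=.
exists (\bigcup_N B N); split.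
- exact: bigcup_measurable.
- move=> x /EE_ [N Nx]; exists N => // n /= Nn.
  by have [_ + _] := A_ n; apply; exact: Nx.
- have ndB : nondecreasing_seq B.
    apply/nondecreasing_seqP => n; apply/subsetPset => x Bx k /= nk.
    by apply: Bx => /=; exact: ltnW.
  have := @nondecreasing_cvg_mu _ _ _ m B mB (bigcup_measurable (fun k _ => mB k)) ndB.
  move=> cB; rewrite -(cvg_lim _ cB)//.
  apply: lime_le; first by apply/cvg_ex; eexists; exact: cB.
  apply: nearW => n /=; have [_ _] := A_ n; apply: le_trans.
  by apply: le_measure; rewrite ?inE//; apply: bigcap_inf => /=.
Qed.

End covers.

(** * The A1 condition and the masses of intervals *)

Section A1_weights.
Context {R : realType}.
Local Notation mu := (@lebesgue_measure R).

Lemma lebesgue_aeS (P Q : R -> Prop) : (forall x, P x -> Q x) ->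
  {ae mu, forall x, P x} -> {ae mu, forall x, Q x}.
Proof. by move=> PQ [N [mN N0 NP]]; exists N; split => // x /= nQ; apply: NP => /PQ. Qed.

Lemma lebesgue_aeI (P Q : R -> Prop) :
  {ae mu, forall x, P x} -> {ae mu, forall x, Q x} ->
  {ae mu, forall x, P x /\ Q x}.
Proof.
move=> [N [mN N0 NP]] [M [mM M0 MQ]]; exists (N `|` M); split.
- exact: measurableU.
- exact: null_set_setU.
- move=> x /= /not_andP[nP|nQ]; [left; exact: NP|right; exact: MQ].
Qed.

Lemma ae_itv_exists (P : R -> Prop) (a b : R) :
  {ae mu, forall x, P x} -> (a < b)%R -> exists x, [/\ (a < x)%R, (x < b)%R & P x].
Proof.
move=> [N [mN N0 NP]] ab; apply: contrapT => noP.
have abN : `]a, b[ `<=` N.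
  move=> x /=; rewrite in_itv/= => /andP[ax xb]; apply: NP => Px.
  by apply: noP; exists x.
have : mu `]a, b[ <= mu N by apply: le_measure; rewrite ?inE.
by rewrite N0 lebesgue_measure_itv/= lte_fin ab -EFinD lee_fin subr_le0 leNgt ab.
Qed.

Lemma density_indic {A : set R} (mA : measurable A)
    (m1A : measurable_fun [set: R] (\1_A : R -> R)) (B : set R) :
  measurable B ->
  density m1A B = mu (A `&` B).
Proof.
move=> mB; rewrite /density.
transitivity (\int[mu]_(x in B) (\1_A x)%:E); last exact: integral_indic.
by apply: eq_integral => x _; rewrite ger0_norm.
Qed.

Context {w : R -> R} (mw : measurable_fun [set: R] w).

Lemma density_indicM {A : set R} (mA : measurable A)
    (m1A : measurable_fun [set: R] (\1_A \* w)%R) (B : set R) :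
  density m1A B = density mw (B `&` A).
Proof.
rewrite /density integral_mkcondr; apply: eq_integral => x _.
rewrite patchE/= indicE; case: ifPn => _; first by rewrite mul1r.
by rewrite mul0r normr0.
Qed.

(** The A1 condition over open intervals, with one null set for all intervals at once. *)
Definition A1_bound (C : R) := {ae mu, forall x, forall a b : R,
  (a < x)%R -> (x < b)%R -> density mw `]a, b[ <= (C * (b - a) * `|w x|)%:E}.

Context {C : R} (C0 : (0 <= C)%R) (wC : A1_bound C).

(** Multiply the A1 bound at [x] by [|f x|] and integrate over the interval. *)
Lemma A1_avg {f : R -> R} (mf : measurable_fun [set: R] f)
    (mfw : measurable_fun [set: R] (f \* w)%R) (a b : R) : (a < b)%R ->
  density mf `]a, b[ * density mw `]a, b[ <=
  (C * (b - a))%:E * density mfw `]a, b[.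
Proof.
move=> ab; rewrite {1 3}/density.
have Cab : (0 <= C * (b - a))%R by rewrite mulr_ge0// subr_ge0 ltW.
rewrite -ge0_integralZr//; last exact: measurable_norm_EFin.
rewrite -ge0_integralZl//; last exact: measurable_norm_EFin.
apply: ae_ge0_le_integral => //=.
- by move=> x _; rewrite mule_ge0// ?measure_ge0.
- by apply: emeasurable_funM => //; exact: measurable_norm_EFin.
- by move=> x _; rewrite mule_ge0.
- by apply: emeasurable_funM => //; exact: measurable_norm_EFin.
apply: lebesgue_aeS wC => x /= xC; rewrite in_itv/= => /andP[ax xb].
rewrite normrM [X in _ <= _ * X]EFinM muleCA.
rewrite lee_wpmul2l// -EFinM.
by exact: xC.
Qed.

(** [A1_avg] for the indicator of [E]: a set filling a fixed proportion of an interval carries a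
    fixed proportion of its weight. *)
Lemma A1_set (E : set R) (a b : R) : measurable E -> (a < b)%R -> E `<=` `]a, b[ ->
  mu E * density mw `]a, b[ <= (C * (b - a))%:E * density mw E.
Proof.
move=> mE ab Eab.
have m1E : measurable_fun [set: R] (\1_E : R -> R) by exact: measurable_indic.
have mEw : measurable_fun [set: R] (\1_E \* w)%R by exact: measurable_funM.
have := A1_avg m1E mEw ab.
by rewrite density_indic// (density_indicM mE) setIC (setIidr Eab).
Qed.

(** The right-hand side of the A1 bound is finite at any point of the interval where the bound
    holds. *)
Lemma A1_fin (a b : R) : density mw `]a, b[ < +oo.
Proof.
have [ab|ba] := ltP a b; last first.
  by rewrite set_itv_ge ?measure0// bnd_simp -leNgt.
have [x [ax xb +]] := ae_itv_exists wC ab.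
by move=> /(_ _ _ ax xb); move=> /le_lt_trans; apply; rewrite ltry.
Qed.

Lemma A1_fin_num (a b : R) : density mw `]a, b[ \is a fin_num.
Proof. by rewrite ge0_fin_numE ?A1_fin// measure_ge0. Qed.

Lemma A1_doubling (a b c d : R) :
  (a <= c)%R -> (c < d)%R -> (d <= b)%R ->
  (d - c)%:E * density mw `]a, b[ <= (C * (b - a))%:E * density mw `]c, d[.
Proof.
move=> ac cd db.
have ab : (a < b)%R by rewrite (le_lt_trans ac)// (lt_le_trans cd).
have := @A1_set `]c, d[ a b.
rewrite lebesgue_measure_itv/= lte_fin cd -EFinD; apply => //.
by apply: subset_itv; rewrite bnd_simp.
Qed.

Hypothesis w0 : {ae mu, forall x, (0 < `|w x|)%R}.

Lemma density_gt0 (a b : R) : (a < b)%R -> 0 < density mw `]a, b[.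
Proof.
move=> ab; rewrite lt_neqAle measure_ge0 andbT eq_sym; apply/negP => /eqP nu0.
have : ae_eq mu (`]a, b[%classic : set R) (EFin \o w) (cst 0).
  apply/ae_eq_integral_abs => //.
  by apply: measurable_funTS; exact/measurable_EFinP.
move=> h.
have := lebesgue_aeI h w0; move=> /= /ae_itv_exists /(_ ab)[x [ax xb [+]]].
rewrite /= in_itv/= ax xb => /(_ isT) [->].
by rewrite normr0 ltxx.
Qed.

(** The interval of radius [|x| + 1] about 0 contains both [x] and []-1, 1[], so the A1 bound at [x]
    sees the fixed positive mass of []-1, 1[]. The rate matches the decay of [1 / (x - y)] in
    [y]. *)
Lemma A1_lower : exists2 c : R, (0 < c)%R &
  {ae mu, forall x, (c <= (1 + `|x|) * `|w x|)%R}.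
Proof.
have nu1 : 0 < density mw `](-1)%R, 1%R[ by apply: density_gt0; lra.
have fin1 := A1_fin_num (-1)%R 1%R.
have C1 : (0 < C + 1)%R by rewrite ltr_wpDl.
exists (fine (density mw `](-1)%R, 1%R[) / (2 * (C + 1)))%R.
  by rewrite divr_gt0 ?mulr_gt0// fine_gt0// nu1 ltey_eq fin1.
apply: lebesgue_aeS wC => x /(_ (- (`|x| + 1)) (`|x| + 1))%R.
have xx : (`|x| < `|x| + 1)%R by rewrite ltrDl.
have := ltr_norml x (`|x| + 1); rewrite xx => /esym/andP[x1 x2].
move=> /(_ x1 x2) nuC.
rewrite ler_pdivrMr ?mulr_gt0// -lee_fin fineK//.
apply: (@le_trans _ _ (density mw `](- (`|x| + 1))%R, (`|x| + 1)%R[)).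
  apply: le_measure; rewrite ?inE//; apply: subset_itv; rewrite bnd_simp.
    by rewrite lerN2 lerDr.
  by rewrite lerDr.
apply: (le_trans nuC); rewrite lee_fin.
have xw : (0 <= (1 + `|x|) * `|w x|)%R by rewrite mulr_ge0// addr_ge0.
rewrite [leLHS](_ : _ = (C * (2 * ((1 + `|x|) * `|w x|)))%R); last by ring.
rewrite [leRHS](_ : _ = ((C + 1) * (2 * ((1 + `|x|) * `|w x|)))%R); last by ring.
by rewrite ler_wpM2r ?mulr_ge0// lerDl.
Qed.

End A1_weights.

(** * Weighted weak type bound for the maximal function *)

Section maximal.
Context {R : realType}.
Local Notation mu := (@lebesgue_measure R).
Context {w : R -> R} (mw : measurable_fun [set: R] w).
Context {C : R} (C0 : (0 <= C)%R) (wC : A1_bound mw C).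

Lemma A1_ball_doubling (x r : R) : (0 < r)%R ->
  density mw (ball x (6 * r)) <= (6 * C)%:E * density mw (ball x r).
Proof.
move=> r0; rewrite !ball_itv.
have := @A1_doubling _ _ mw _ C0 wC (x - 6 * r) (x + 6 * r) (x - r) (x + r).
move=> /(_ ltac:(lra) ltac:(lra) ltac:(lra)).
rewrite -(fineK (A1_fin_num wC (x - 6 * r) (x + 6 * r))).
rewrite -(fineK (A1_fin_num wC (x - r) (x + r))) -!EFinM !lee_fin => h.
by rewrite -(@ler_pM2l _ (2 * r))//; lra.
Qed.

Lemma A1_ball_avg {f : R -> R} (mf : measurable_fun [set: R] f)
    (mfw : measurable_fun [set: R] (f \* w)%R) (x r t : R) :
  (0 < r)%R -> (0 < t)%R -> (t * r)%:E < density mf (ball x r) ->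
  density mw (ball x r) <= (2 * C / t)%:E * density mfw (ball x r).
Proof.
rewrite !ball_itv => r0 t0 tr.
have := A1_avg C0 wC mf mfw (a := x - r) (b := x + r) ltac:(lra).
set nw := density mw _; set nf := density mf _; set nfw := density mfw _.
move=> h.
have nwfin : nw \is a fin_num := A1_fin_num wC _ _.
have : (t * r)%:E * nw <= (C * (2 * r))%:E * nfw.
  rewrite (_ : C * (2 * r) = C * (x + r - (x - r)))%R; last by ring.
  by apply: le_trans h; rewrite lee_wpmul2r ?measure_ge0// ltW.
move=> {}h; rewrite -(@lee_pmul2l _ (t * r)%:E)//; last by rewrite lte_fin mulr_gt0.
apply: (le_trans h).
by rewrite muleA -EFinM (_ : t * r * (2 * C / t) = C * (2 * r))%R//; field; lra.
Qed.

(** Vitali covering. On a selected ball [B], the weight of [6 B] is at most [6 C] times that of [B],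
    itself at most [2 C / t] times the integral of [|f w|] over [B]. The selected balls are
    disjoint, so these bounds add up. *)
Lemma maximal_weak {f : R -> R} (mf : measurable_fun [set: R] f)
    (mfw : measurable_fun [set: R] (f \* w)%R) (t : R) : (0 < t)%R ->
  density mf [set: R] < +oo ->
  covered (density mw)
    [set x | exists2 r, (0 < r)%R & (t * r)%:E < density mf (ball x r)]
    ((12 * C ^+ 2 / t)%:E * density mfw [set: R]).
Proof.
move=> t0 foo; set V := (X in covered _ X).
(* Points outside [V] receive the dummy radius 1; only centres in [V] are selected. *)
have /choice[r0 rV] : forall x, exists r, (0 < r)%R /\
    (V x -> (t * r)%:E < density mf (ball x r)).
  move=> x; have [[r r0 xr]|nVx] := pselect (V x); first by exists r.
  by exists 1%R.
pose B x := ball x (r0 x).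
have is_ballB x : is_ball (B x) by exact: is_ball_ball.
have radB x : (radius (B x))%:num = r0 x.
  by rewrite radius_ball_num// ltW//; have [] := rV x.
have radB0 x : (0 < (radius (B x))%:num)%R by rewrite radB; have [] := rV x.
have radBV x : V x -> ((radius (B x))%:num <= fine (density mf [set: R]) / t)%R.
  move=> Vx; rewrite radB ler_pdivlMr// mulrC -lee_fin fineK; last first.
    by rewrite ge0_fin_numE// measure_ge0.
  have [_ /(_ Vx)/ltW/le_trans] := rV x; apply.
  by apply: le_measure; rewrite ?inE//; exact: measurable_ball.
have [D [cD DV tD VD]] := vitali_lemma_infinite_cover is_ballB radB0 radBV.
have [g injg] := countable_injP D cD.
(* [pick n P] is [P x] for the selected centre [x] with code [n], and empty if there is none: the
   countable family becomes a sequence. *)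
pose pick n (P : R -> set R) : set R := \bigcup_(x in [set x | D x /\ g x = n]) P x.
have pickE P x : D x -> pick (g x) P = P x.
  move=> Dx; apply/seteqP; split => [y [z [Dz gz]]|y Py]; last by exists x.
  by have -> : z = x by apply: injg; rewrite ?inE.
have pickP P n : pick n P = set0 \/ exists2 x, D x & (g x = n /\ pick n P = P x).
  have [[x [Dx gx]]|nx] := pselect (exists x, D x /\ g x = n).
    by right; exists x => //; rewrite -gx; split => //; exact: pickE.
  by left; rewrite -subset0 => y [z Dz _]; apply: nx; exists z.
(* The covering lemma gives closed balls of five times the radius; open balls of six times the
   radius contain them. *)
pose B6 x := ball x (6 * r0 x)%R.
have mpick P : (forall x, measurable (P x)) -> forall n, measurable (pick n P).
  by move=> mP n; have [->//|[x _ [_ ->]]] := pickP P n.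
have mB n : measurable (pick n B) by apply: mpick => x; exact: measurable_ball.
have mB6 n : measurable (pick n B6) by apply: mpick => x; exact: measurable_ball.
exists (\bigcup_n pick n B6); split; first exact: bigcup_measurable.
- move=> x Vx.
  have /VD[y Dy] : cover V (closure \o B) x.
    by exists x => //; apply: subset_closure; apply: ballxx; have [] := rV x.
  move=> /= Bxy; exists (g y) => //; rewrite pickE//.
  move: Bxy; rewrite /B scale_ballE//; apply: closed_ball_subset.
    by rewrite mulr_gt0//; have [] := rV y.
  by rewrite ltr_pM2r; [lra|have [] := rV y].
- have tB : trivIset [set: nat] (fun n => pick n B).
    apply/trivIsetP => i j _ _ ij.
    have [->|[x Dx [gx ->]]] := pickP B i; first by rewrite set0I.
    have [->|[y Dy [gy ->]]] := pickP B j; first by rewrite setI0.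
    have xy : x != y by apply: contra_neq ij => xy; rewrite -gx -gy xy.
    move/trivIsetP : tD => /(_ _ _ Dx Dy xy) /=.
    rewrite -!subset0; apply: subset_trans.
    by apply: setISS; exact: subset_closure.
  apply: (@le_trans _ _ (\sum_(n <oo) density mw (pick n B6))).
    by apply: measure_sigma_subadditive => //; exact: bigcup_measurable.
  apply: (@le_trans _ _ (\sum_(n <oo)
      (12 * C ^+ 2 / t)%:E * density mfw (pick n B))).
    apply: lee_nneseries => // n _.
    have [h|[x Dx [<- _]]] := pickP B n.
      have [->|[x Dx [gx _]]] := pickP B6 n.
        by rewrite measure0 mule_ge0// lee_fin divr_ge0 ?mulr_ge0// ?exprn_ge0// ltW.
      exfalso; move: h; rewrite -gx pickE// => /seteqP[/(_ x) Bx0 _].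
      by apply: Bx0; apply: ballxx; have [] := rV x.
    rewrite !pickE//; have [rx /(_ (DV _ Dx)) hx] := rV x.
    apply: (le_trans (A1_ball_doubling _ rx)).
    have -> : ((12 * C ^+ 2 / t)%:E = (6 * C)%:E * (2 * C / t)%:E)%E.
      by rewrite -EFinM; congr EFin; ring.
    rewrite -muleA lee_wpmul2l ?lee_fin ?mulr_ge0//.
    exact: A1_ball_avg hx.
  rewrite nneseriesZl//; rewrite lee_wpmul2l//.
    by rewrite lee_fin divr_ge0 ?mulr_ge0// ?exprn_ge0// ltW.
  rewrite -measure_semi_bigcup//; last exact: bigcup_measurable.
  by apply: le_measure; rewrite ?inE//; exact: bigcup_measurable.
Qed.

End maximal.

(** * Boole's identity and a discrete weak type bound *)

Section boole.
Context {R : realType}.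
Local Open Scope ring_scope.

Section positive_masses.
Context {n : nat} {a : nat -> R} (ha : {homo a : i j / (i < j)%N >-> i < j}).
Context {c : nat -> R} (c0 : forall i, 0 < c i).
Context {t : R} (t0 : 0 < t).

(** Clearing denominators: away from the poles [t - \sum_i c i / (x - a i)] equals [p / P], so the
    level set can be read off from the roots of [p]. *)
Let P : {poly R} := \prod_(i < n.+1) ('X - (a i)%:P).
Let Q : {poly R} :=
  \sum_(i < n.+1) c i *: \prod_(j < n.+1 | j != i) ('X - (a j)%:P).
Let p := t *: P - Q.

Let size_P : size P = n.+2.
Proof.
rewrite size_prod_XsubC; congr _.+1.
by rewrite -[RHS](card_ord n.+1) cardT enumT /index_enum; case: index_enum_key.
Qed.

Let size_Pi (i : 'I_n.+1) :
  size (\prod_(j < n.+1 | j != i) ('X - (a j)%:P)) = n.+1.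
Proof.
rewrite -big_filter size_prod_XsubC; congr _.+1.
rewrite size_filter -sum1_count sum1_card -(@eq_card _ (predC1 i)).
  by rewrite cardC1 card_ord.
by move=> j; rewrite !inE.
Qed.

Let coef_Pi (i : 'I_n.+1) :
  (\prod_(j < n.+1 | j != i) ('X - (a j)%:P))`_n = 1.
Proof.
have := monic_prod_XsubC (index_enum 'I_n.+1) (fun j => j != i) (fun j => a j).
by move/monicP; rewrite lead_coefE size_Pi.
Qed.

Let size_Q : (size Q <= n.+1)%N.
Proof.
rewrite (leq_trans (size_sum _ _ _))//; apply/bigmax_leqP => i _.
by rewrite (leq_trans (size_scale_leq _ _))// size_Pi.
Qed.

Let lead_P : lead_coef P = 1.
Proof. exact/monicP/monic_prod_XsubC. Qed.

Let size_p : size p = n.+2.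
Proof.
rewrite size_polyDl size_scale ?gt_eqF ?size_P// size_polyN.
by rewrite ltnS.
Qed.

Let lead_p : lead_coef p = t.
Proof.
rewrite lead_coefDl; first by rewrite lead_coefZ lead_P mulr1.
by rewrite size_polyN size_scale ?gt_eqF ?size_P// ltnS.
Qed.

Let p_horner (x : R) : (forall i : 'I_n.+1, x != a i) ->
  p.[x] = (t - \sum_(i < n.+1) c i / (x - a i)) * \prod_(i < n.+1) (x - a i).
Proof.
move=> xa; rewrite /p hornerD hornerN hornerZ mulrBl; congr (_ - _).
  by rewrite horner_prod; under eq_bigr do rewrite hornerXsubC.
rewrite horner_sum mulr_suml; apply: eq_bigr => i _.
rewrite hornerZ horner_prod [in RHS](bigD1 i)//= mulrA mulfVK ?subr_eq0//.
by under eq_bigr do rewrite hornerXsubC.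
Qed.

Let p_pole (i : 'I_n.+1) :
  p.[a i] = - (c i * \prod_(j < n.+1 | j != i) (a i - a j)).
Proof.
rewrite /p hornerD hornerN hornerZ horner_prod (bigD1 i)//= hornerXsubC subrr.
rewrite mul0r mulr0 add0r; congr (- _).
rewrite horner_sum (bigD1 i)//= [X in _ + X]big1 => [|j ji].
  rewrite addr0 hornerZ horner_prod.
  by under eq_bigr do rewrite hornerXsubC.
rewrite hornerZ horner_prod (bigD1 i) 1?eq_sym//=.
by rewrite hornerXsubC subrr mul0r mulr0.
Qed.

(* Between consecutive poles only the two factors involving both of them have
   opposite signs at the two ends. *)
Let p_sign (i : 'I_n.+1) (j : 'I_n.+1) : j = i.+1 :> nat -> p.[a i] * p.[a j] < 0.
Proof.
move=> ji; have ij : (i < j)%N by rewrite ji.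
have jni : j != i by rewrite -val_eqE/= gtn_eqF.
have inj : i != j by rewrite eq_sym.
rewrite !p_pole mulrNN (bigD1 j)//= [X in _ * (_ * X)](bigD1 i)//=.
set A := \prod_(_ | _) _; set B := \prod_(_ | _) _.
have -> : c i * ((a i - a j) * A) * (c j * ((a j - a i) * B)) =
    - (c i * c j * (a j - a i) ^+ 2 * (A * B)) by ring.
rewrite oppr_lt0 pmulr_rgt0; last first.
  by apply: mulr_gt0; [exact: mulr_gt0|rewrite exprn_gt0// subr_gt0 ha].
have -> : B = \prod_(k < n.+1 | (k != i) && (k != j)) (a j - a k).
  by apply: eq_bigl => k; rewrite andbC.
rewrite /A.
rewrite -big_split/=; apply: prodr_gt0 => k /andP[ki kj].
have [k_i|i_k] := ltnP k i.
  by rewrite mulr_gt0// subr_gt0 ha// (ltn_trans k_i).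
have ik : (i < k)%N by rewrite ltn_neqAle i_k andbT eq_sym.
have jk : (j < k)%N by rewrite ltn_neqAle eq_sym kj/= ji.
by rewrite -mulrNN !opprB mulr_gt0// subr_gt0 ha.
Qed.

Let sumc_ge0 : 0 <= \sum_(i < n.+1) c i.
Proof. by apply: sumr_ge0 => i _; exact: ltW. Qed.

(** At [a n + S + 1] every pole is at distance at least [S + 1], so the sum is at most
    [S t / (S + 1) < t]. *)
Let p_far : exists2 M : R, a n < M & 0 < p.[M].
Proof.
pose S := (\sum_(i < n.+1) c i) / t.
have S0 : 0 <= S by rewrite divr_ge0// ltW.
exists (a n + S + 1); first by rewrite -addrA ltrDl ltr_wpDl.
have MS (i : 'I_n.+1) : S + 1 <= a n + S + 1 - a i.
  have : a i <= a n.
    by have := ltn_ord i; rewrite ltnS leq_eqVlt => /predU1P[->//|/ha/ltW].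
  by lra.
have S10 : 0 < S + 1 by rewrite ltr_wpDl.
have M0 (i : 'I_n.+1) : 0 < a n + S + 1 - a i by exact: lt_le_trans (MS i).
rewrite p_horner => [|i]; last by rewrite -subr_eq0 gt_eqF.
rewrite mulr_gt0 ?prodr_gt0// subr_gt0.
rewrite (@le_lt_trans _ _ (\sum_(i < n.+1) c i / (S + 1)))//.
  apply: ler_sum => i _; rewrite ler_pM2l// lef_pV2 ?posrE//.
rewrite -mulr_suml ltr_pdivrMr// mulrDr mulr1 /S mulrCA mulfV ?gt_eqF// mulr1.
by rewrite ltrDl.
Qed.

(** The sign change between consecutive poles gives a root in each gap; at the last pole [p] is
    negative, and [p_far] supplies a positive value beyond it. *)
Let p_root (i : 'I_n.+1) : exists b, [/\ a i < b, root p b &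
  forall j : 'I_n.+1, (i < j)%N -> b < a j].
Proof.
have pa0 : p.[a i] != 0.
  rewrite p_pole oppr_eq0; apply: mulf_neq0; first by rewrite gt_eqF.
  apply/prodf_neq0 => j ji; rewrite subr_eq0; apply: contraTneq ji => aij.
  rewrite negbK -val_eqE/=; apply/eqP.
  by case: (ltngtP j i) => // /ha; rewrite aij ltxx.
have [ni|/eqP ni] := eqVneq (i : nat) n.
  have [M aM pM] := p_far.
  have pn : p.[a i] < 0.
    rewrite lt_neqAle pa0/= p_pole oppr_le0 mulr_ge0 ?ltW//.
    apply: prodr_gt0 => j ji; rewrite subr_gt0 ha// ltn_neqAle ji/= ni.
    by rewrite -ltnS.
  have aiM : a i <= M by rewrite ni ltW.
  have [|b /andP[ab bM] pb] := @poly_ivt R p (a i) M aiM.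
    by rewrite (ltW pn) (ltW pM).
  exists b; split => //.
    rewrite lt_neqAle ab andbT; apply: contra_neq pa0 => ->.
    exact/eqP.
  by move=> j; rewrite ni => nj; have := leq_trans nj (ltn_ord j); rewrite ltnn.
have i1n : (i.+1 < n.+1)%N.
  by rewrite ltnS ltn_neqAle; apply/andP; split; [exact/eqP|rewrite -ltnS].
pose j := Ordinal i1n.
have pij : p.[a i] * p.[a j] < 0 by exact: p_sign.
have aij : a i < a j by apply: ha.
have [b /andP[ab bj] pb] : exists2 b, a i <= b <= a j & root p b.
  have [pi|pi] := ltP p.[a i] 0.
    apply: poly_ivt; first exact: ltW.
    by rewrite ltW//= ltW//; move: pij; rewrite nmulr_rlt0.
  have {}pi : 0 < p.[a i] by rewrite lt_neqAle eq_sym pa0.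
  have [|b ab pb] := @poly_ivt R (- p) (a i) (a j) (ltW aij).
    rewrite !hornerN oppr_le0 oppr_ge0 (ltW pi)/= ltW//.
    by move: pij; rewrite pmulr_rlt0.
  by exists b => //; rewrite -rootN.
have pj0 : p.[a j] != 0 by apply: contraTneq pij => ->; rewrite mulr0 ltxx.
have bja : b < a j.
  by rewrite lt_neqAle bj andbT; apply: contra_neq pj0 => <-; exact/eqP.
exists b; split => //.
  by rewrite lt_neqAle ab andbT; apply: contra_neq pa0 => ->; exact/eqP.
move=> k ik; rewrite (lt_le_trans bja)//.
by move: ik; rewrite leq_eqVlt => /predU1P[<-//|/ha/ltW].
Qed.

(** Boole's identity. The [n + 1] roots [b i] exhaust the degree, so [p = t \prod_i (X - b i)], and
    comparing the coefficients of degree [n] gives the total length. Off the intervals each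
    [(x - b i) / (x - a i)] is positive, hence so is [p / P]. *)
Lemma boole : exists b : 'I_n.+1 -> R, [/\ forall i : 'I_n.+1, a i < b i,
  \sum_(i < n.+1) (b i - a i) = (\sum_(i < n.+1) c i) / t &
  forall x, (forall i : 'I_n.+1, ~~ (a i <= x <= b i)) ->
    \sum_(i < n.+1) c i / (x - a i) < t].
Proof.
have /choice[b bP] := p_root; exists b.
have ab (i : 'I_n.+1) : a i < b i by have [] := bP i.
have injb : injective b.
  move=> i j bij; apply/val_inj/eqP; rewrite eqn_leq; apply/andP; split;
    rewrite leqNgt; apply/negP => /=.
  - by move=> ji; have [_ _ /(_ _ ji)] := bP j; rewrite -bij ltNge (ltW (ab i)).
  - by move=> ij; have [_ _ /(_ _ ij)] := bP i; rewrite bij ltNge (ltW (ab j)).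
have pE : p = t *: \prod_(i < n.+1) ('X - (b i)%:P).
  have := @all_roots_prod_XsubC _ p (map b (enum 'I_n.+1)).
  rewrite size_map size_enum_ord size_p lead_p big_map big_enum; apply => //.
    by apply/allP => _ /mapP[i _ ->]; have [] := bP i.
  by rewrite uniq_rootsE map_inj_uniq ?enum_uniq.
split => //.
- have coefP (d : 'I_n.+1 -> R) :
      (\prod_(i < n.+1) ('X - (d i)%:P))`_n = - \sum_(i < n.+1) d i.
    have := @coefPn_prod_XsubC R (map d (enum 'I_n.+1)).
    rewrite size_map size_enum_ord [\prod_(_ <- _) _]big_map [\sum_(_ <- _) _]big_map !big_enum.
    by move=> /(_ isT).
  have h1 : p`_n = t * - \sum_(i < n.+1) b i by rewrite pE coefZ coefP.
  have h2 : p`_n = t * (- \sum_(i < n.+1) a i) - \sum_(i < n.+1) c i.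
    rewrite /p coefB coefZ /P (coefP (fun i => a i)); congr (_ - _).
    rewrite /Q coef_sum; apply: eq_bigr => i _.
    by rewrite coefZ coef_Pi mulr1.
  have h : t * - \sum_(i < n.+1) b i = t * (- \sum_(i < n.+1) a i) -
    \sum_(i < n.+1) c i by rewrite -h1.
  rewrite sumrB.
  apply: (mulfI (lt0r_neq0 t0)); rewrite [RHS]mulrC mulfVK ?gt_eqF//.
  by rewrite mulrBr; lra.
- move=> x xab.
  have xa (i : 'I_n.+1) : x != a i.
    by apply: contraNneq (xab i) => ->; rewrite lexx ltW.
  have ratio0 (i : 'I_n.+1) : 0 < (x - b i) * (x - a i).
    have := xab i; rewrite negb_and -!ltNge => /orP[xi|xi].
      by rewrite -mulrNN !opprB mulr_gt0// subr_gt0// (lt_trans xi).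
    by rewrite mulr_gt0// subr_gt0// (lt_trans _ xi).
  have := p_horner xa; rewrite pE hornerZ horner_prod.
  under eq_bigr do rewrite hornerXsubC.
  move=> h; rewrite -subr_gt0.
  have : 0 < (t - \sum_(i < n.+1) c i / (x - a i)) *
             (\prod_(i < n.+1) (x - a i)) ^+ 2.
    rewrite expr2 mulrA -h -mulrA mulr_gt0// -big_split/=.
    by apply: prodr_gt0 => i _; exact: ratio0.
  rewrite pmulr_lgt0// exprn_even_gt0//=; apply/prodf_neq0 => i _.
  by rewrite subr_eq0.
Qed.

End positive_masses.

Local Notation mu := (@lebesgue_measure R).

Lemma measurable_bigU (I : Type) (s : seq I) (F : I -> set R) :
  (forall i, measurable (F i)) -> measurable (\big[setU/set0]_(i <- s) F i).
Proof. by move=> mF; elim/big_ind : _ => //; exact: measurableU. Qed.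

Lemma measure_bigU_le (I : Type) (s : seq I) (F : I -> set R) :
  (forall i, measurable (F i)) ->
  (mu (\big[setU/set0]_(i <- s) F i) <= \sum_(i <- s) mu (F i))%E.
Proof.
move=> mF; elim: s => [|i s IH]; first by rewrite !big_nil measure0.
rewrite !big_cons; apply: (le_trans (measureU2 _ _ _)).
- exact: mF.
- exact: measurable_bigU.
- exact: leeD2l.
Qed.

Section grid.
Context (A0 h : R) (h0 : 0 < h).
Let a (i : nat) := A0 + i%:R * h.

Let boole_half (n : nat) (c : nat -> R) (t : R) (B0 : R) :
  (forall i, 0 < c i) -> 0 < t ->
  exists b : 'I_n.+1 -> R,
   [/\ \sum_(i < n.+1) (b i - (B0 + i%:R * h)) = (\sum_(i < n.+1) c i) / t,
     forall i : 'I_n.+1, B0 + i%:R * h <= b i &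
  forall x, (forall i : 'I_n.+1, ~~ (B0 + i%:R * h <= x <= b i)) ->
    \sum_(i < n.+1) c i / (x - (B0 + i%:R * h)) < t].
Proof.
move=> c0 t0.
have hB : {homo (fun i : nat => B0 + i%:R * h) : i j / (i < j)%N >-> i < j}.
  by move=> i j ij; rewrite ltrD2l ltr_pM2r// ltr_nat.
have [b [ab sb xb]] := boole hB c0 t0 (n := n).
by exists b; split => // i; exact: ltW.
Qed.

(** The lower bound on the sum is Boole's identity for the points reflected through 0, listed in
    reverse order; hence the factor 2. *)
Lemma boole_cover (n : nat) (c : nat -> R) (t : R) :
  (forall i, 0 < c i) -> 0 < t ->
  exists U : set R, [/\ measurable U,
    (mu U <= (2 * (\sum_(i < n.+1) c i) / t)%:E)%E &
    forall x, ~ U x -> `|\sum_(i < n.+1) c i / (x - a i)| < t].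
Proof.
move=> c0 t0.
have [b [sb ab xb]] := boole_half n A0 c0 t0.
have [b' [sb' ab' xb']] :=
  boole_half n (- (A0 + n%:R * h)) (fun i => c0 (n - i)%N) t0.
pose I1 (i : 'I_n.+1) : set R := `[a i, b i]%classic.
pose I2 (i : 'I_n.+1) : set R :=
  `[- b' i, - (- (A0 + n%:R * h) + i%:R * h)]%classic.
exists (\big[setU/set0]_(i < n.+1) I1 i `|` \big[setU/set0]_(i < n.+1) I2 i).
have mI1 i : measurable (I1 i) by exact: measurable_itv.
have mI2 i : measurable (I2 i) by exact: measurable_itv.
have m1 : measurable (\big[setU/set0]_(i < n.+1) I1 i).
  exact: measurable_bigU.
have m2 : measurable (\big[setU/set0]_(i < n.+1) I2 i).
  exact: measurable_bigU.
split; first exact: measurableU.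
- apply: (le_trans (measureU2 _ _ _)); [exact: m1|exact: m2|].
  have -> : 2 * (\sum_(i < n.+1) c i) / t =
    (\sum_(i < n.+1) c i) / t + (\sum_(i < n.+1) c i) / t by ring.
  rewrite EFinD; apply: leeD.
    apply: (le_trans (measure_bigU_le _ _)) => //.
    rewrite -sb -sumEFin; apply: lee_sum => i _.
    by rewrite lebesgue_measure_itv/= lte_fin; case: ifPn => // _; rewrite lee_fin subr_ge0.
  apply: (le_trans (measure_bigU_le _ _)) => //.
  have -> : (\sum_(i < n.+1) c i = \sum_(i < n.+1) c (n - i)%N).
    by rewrite (reindex_inj rev_ord_inj)/=; apply: eq_bigr => i _; rewrite subSS.
  rewrite -sb' -sumEFin; apply: lee_sum => i _.
  rewrite lebesgue_measure_itv/= lte_fin; case: ifPn => _; rewrite lee_fin.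
    by rewrite opprK addrC.
  by rewrite subr_ge0.
- move=> x /not_orP[x1 x2].
  rewrite ltr_norml; apply/andP; split.
    rewrite ltrNl.
    have -> : - (\sum_(i < n.+1) c i / (x - a i)) =
        \sum_(i < n.+1) c (n - i)%N / (- x - (- (A0 + n%:R * h) + i%:R * h)).
      rewrite -sumrN (reindex_inj rev_ord_inj)/=; apply: eq_bigr => i _.
      rewrite subSS -mulrN -invrN; congr (_ / _).
      rewrite /a natrB; last by rewrite -ltnS.
      by ring.
    apply: xb' => i; apply/negP => /andP[xi xi'].
    apply: x2; rewrite (bigD1 i)//=; left.
    by rewrite /I2/= in_itv/= lerNr xi/= lerNl xi'.
  apply: xb => i; apply/negP => xi.
  by apply: x1; rewrite (bigD1 i)//=; left; rewrite /I1/= in_itv.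
Qed.

(** Write [c = (|c| + e) - (|c| - c + e)], where the two positive families have sums at most [2 S]
    and [3 S]. Each is taken at level [t / 2], which gives [8 + 12 = 20]. *)
Lemma weak_discrete (n : nat) (c : nat -> R) (t : R) : 0 < t ->
  exists U : set R, [/\ measurable U,
    (mu U <= (20 * (\sum_(i < n.+1) `|c i|) / t)%:E)%E &
    forall x, ~ U x -> `|\sum_(i < n.+1) c i / (x - a i)| < t].
Proof.
move=> t0; pose S := \sum_(i < n.+1) `|c i|.
have S0 : 0 <= S by apply: sumr_ge0.
have [S00|Sneq0] := eqVneq S 0.
  exists set0; split => //.
    by rewrite measure0 lee_fin divr_ge0// ?mulr_ge0// ltW.
  move=> x _; rewrite big1 ?normr0// => i _.
  have /eqP := S00; rewrite psumr_eq0// => /allP/(_ i).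
  rewrite mem_index_enum => /(_ isT)/=; rewrite normr_eq0 => /eqP ->.
  by rewrite mul0r.
have {}S0 : 0 < S by rewrite lt_neqAle eq_sym Sneq0.
(* Boole's identity wants strictly positive masses; this shift provides them at a total cost of
   [S]. *)
pose e := S / n.+1%:R.
have e0 : 0 < e by rewrite divr_gt0.
have se : \sum_(i < n.+1) e = S.
  by rewrite sumr_const card_ord /e -[LHS]mulr_natr mulfVK.
pose c1 i := `|c i| + e.
pose c2 i := `|c i| - c i + e.
have c10 i : 0 < c1 i by rewrite ltr_wpDl.
have c20 i : 0 < c2 i by rewrite ltr_wpDl// subr_ge0 ler_norm.
have sc1 : \sum_(i < n.+1) c1 i = 2 * S.
  by rewrite /c1 big_split/= se -/S; ring.
have sc2 : \sum_(i < n.+1) c2 i <= 3 * S.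
  rewrite /c2 big_split/= se.
  have : \sum_(i < n.+1) (`|c i| - c i) <= \sum_(i < n.+1) (`|c i| + `|c i|).
    by apply: ler_sum => i _; rewrite lerD2l -normrN ler_norm.
  rewrite [X in _ <= X -> _]big_split/= => h2.
  by rewrite (_ : 3 * S = (S + S) + S) ?lerD2r//; ring.
have t20 : 0 < t / 2 by rewrite divr_gt0.
have [U1 [mU1 U1t U1x]] := boole_cover n c10 t20.
have [U2 [mU2 U2t U2x]] := boole_cover n c20 t20.
exists (U1 `|` U2); split; first exact: measurableU.
- apply: (le_trans (measureU2 _ _ _)); [exact: mU1|exact: mU2|].
  apply: (le_trans (leeD U1t U2t)); rewrite -EFinD lee_fin sc1 -/S.
  rewrite !invfM !invrK.
  apply: (@le_trans _ _ (2 * (2 * S) * (t^-1 * 2) + 2 * (3 * S) * (t^-1 * 2))).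
    by rewrite lerD2l ler_pM2r ?ler_pM2l// mulr_gt0// invr_gt0.
  by rewrite le_eqVlt; apply/orP; left; apply/eqP; field; lra.
- move=> x /not_orP[/U1x x1 /U2x x2].
  have -> : \sum_(i < n.+1) c i / (x - a i) =
    \sum_(i < n.+1) c1 i / (x - a i) - \sum_(i < n.+1) c2 i / (x - a i).
    by rewrite -sumrB; apply: eq_bigr => i _; rewrite /c1 /c2; ring.
  by rewrite (le_lt_trans (ler_normB _ _))// [ltRHS]splitr ltrD.
Qed.

End grid.

End boole.

(** * Integral estimates and a kernel of Poisson type *)

Section kernels.
Context {R : realType}.
Local Notation mu := (@lebesgue_measure R).
Local Notation L1 f := (mu.-integrable [set: R] (EFin \o f)).
Implicit Types f g h k : R -> R.

Lemma density_le {f g} (mf : measurable_fun [set: R] f)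
    (mg : measurable_fun [set: R] g) (A : set R) (M : R) :
  measurable A -> (0 <= M)%R -> (forall x, A x -> (`|f x| <= M * `|g x|)%R) ->
  density mf A <= M%:E * density mg A.
Proof.
move=> mA M0 fg; rewrite /density -ge0_integralZl//; last first.
  exact: measurable_norm_EFin.
apply: ge0_le_integral => //; first exact: measurable_norm_EFin.
by apply: emeasurable_funM => //; exact: measurable_norm_EFin.
Qed.

Lemma L1_density {f} (mf : measurable_fun [set: R] f) :
  L1 f <-> density mf [set: R] < +oo.
Proof.
split=> [/integrableP[]//|foo]; apply/integrableP; split => //.
exact/measurable_EFinP.
Qed.

Lemma L1_measurable f : L1 f -> measurable_fun [set: R] f.
Proof. by move=> /integrableP[/measurable_EFinP]. Qed.

Lemma L1_le f g : measurable_fun [set: R] f -> L1 g ->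
  (forall x, (`|f x| <= `|g x|)%R) -> L1 f.
Proof.
move=> mf ig fg; apply: le_integrable ig => //; first exact/measurable_EFinP.
by move=> x _; rewrite lee_fin.
Qed.

Lemma L1Z (c : R) f : L1 f -> L1 (fun x => c * f x)%R.
Proof. by move=> intf; have := integrableZl measurableT c intf; exact. Qed.

Lemma L1M f k (M : R) : L1 f -> measurable_fun [set: R] k ->
  (forall x, (`|k x| <= M)%R) -> L1 (f \* k)%R.
Proof.
move=> intf mk kM; have M0 : (0 <= M)%R by exact: le_trans (kM 0%R).
apply: (L1_le _ (L1Z M intf)).
  by apply: measurable_funM => //; exact: L1_measurable.
by move=> x; rewrite /= !normrM (ger0_norm M0) mulrC ler_wpM2r.
Qed.

Lemma Rintegral_norm_le f (M : \bar R) : L1 f ->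
  \int[mu]_y `|f y|%:E <= M -> `|\int[mu]_y f y|%:E <= M.
Proof.
move=> intf; apply: le_trans.
rewrite EFin_normr_Rintegral//; apply: le_abse_integral => //.
exact: measurable_int intf.
Qed.

Lemma Rintegral_dist_le f g {h} (mh : measurable_fun [set: R] h) : L1 f -> L1 g ->
  (forall x, (`|f x - g x| <= `|h x|)%R) ->
  `|\int[mu]_y f y - \int[mu]_y g y|%:E <= density mh [set: R].
Proof.
move=> intf intg fgh; rewrite -RintegralB//.
have intfg : L1 (fun y => f y - g y)%R.
  have := integrableB measurableT intf intg.
  by apply: eq_integrable => // x _.
apply: Rintegral_norm_le => //; apply: ge0_le_integral => //.
- by apply: measurable_norm_EFin; exact: L1_measurable.
- exact: measurable_norm_EFin.
- by move=> x _; rewrite lee_fin.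
Qed.

(** Comparable with the Poisson kernel [e / (e ^ 2 + t ^ 2)]; it dominates the error made when the
    arguments of a truncated kernel are moved. *)
Definition poisson (e t : R) : R := (e / (Num.max e `|t|) ^+ 2)%R.

Lemma poisson_ge0 e t : (0 < e)%R -> (0 <= poisson e t)%R.
Proof. by move=> e0; rewrite divr_ge0 ?(ltW e0)// sqr_ge0. Qed.

Lemma continuous_invmax (e : R) : (0 < e)%R ->
  continuous (fun t : R => (Num.max e `|t|) ^- 2)%R.
Proof.
move=> e0 t; apply: cvgV; first by rewrite expf_neq0// gt_eqF// lt_max e0.
apply: (@cvg_comp _ _ _ (fun t : R => Num.max e `|t|)%R (fun s => s ^+ 2)%R
  _ (nbhs (Num.max e `|t|)%R)); last exact: exprn_continuous.
apply: continuous_max; first exact: cvg_cst.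
exact: norm_continuous.
Qed.

Lemma measurable_poisson (e a : R) : (0 < e)%R ->
  measurable_fun [set: R] (fun y => poisson e (y - a)).
Proof.
move=> e0; apply: measurable_funM => //.
apply: (@measurableT_comp _ _ _ _ _ _ (fun t : R => (Num.max e `|t|) ^- 2)%R) => //.
- by apply: continuous_measurable_fun; exact: continuous_invmax.
- by apply: measurable_funB => //.
Qed.

Lemma poisson_le (e r t : R) : (0 < e)%R -> (e <= r)%R -> (r <= `|t|)%R ->
  (poisson e t <= e / r ^+ 2)%R.
Proof.
move=> e0 er rt; have r0 : (0 < r)%R by exact: lt_le_trans er.
have m0 : (0 < Num.max e `|t|)%R by rewrite lt_max e0.
rewrite ler_pM2l// lef_pV2 ?posrE ?exprn_gt0//.
by rewrite ler_sqr ?nnegrE ?(ltW r0) ?(ltW m0)// le_max rt orbT.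
Qed.

Lemma poisson_le_inv (e t : R) : (0 < e)%R -> (poisson e t <= e^-1)%R.
Proof.
move=> e0; rewrite ler_pdivrMr; last by rewrite exprn_gt0// lt_max e0.
rewrite -ler_pdivrMl ?invr_gt0// invrK -expr2.
by rewrite ler_sqr ?nnegrE ?(ltW e0)// le_max ?lexx// (ltW e0).
Qed.

(** Dyadic annuli: the ball of radius [e] contributes at most [K], and the annulus from radius
    [2 ^ n e] to twice that at most [2 K / 2 ^ n]; the total is [K + 4 K]. *)
Lemma poisson_density {g} (mg : measurable_fun [set: R] g) (e a K : R)
    (mgp : measurable_fun [set: R] (g \* (fun y => poisson e (y - a)))%R) :
  (0 < e)%R -> (0 <= K)%R ->
  (forall r, (e <= r)%R -> density mg (ball a r) <= (K * r)%:E) ->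
  density mgp [set: R] <= (5 * K)%:E.
Proof.
move=> e0 K0 gK.
pose B (n : nat) : set R := ball a (2 ^+ n * e)%R.
have mB n : measurable (B n) by exact: measurable_ball.
have e2 n : (0 < 2 ^+ n * e)%R by rewrite mulr_gt0// exprn_gt0.
have ne2 n : (e <= 2 ^+ n * e)%R by rewrite ler_peMl ?(ltW e0)// exprn_ege1// ler1n.
(* The right-hand side is the partial sum [K + \sum_(j < n) 2 K / 2 ^ j]. *)
have Bn n : density mgp (B n) <= (5 * K - 4 * K * 2 ^- n)%:E.
  elim: n => [|n IH].
    rewrite expr0 invr1 mulr1 -mulrBl (_ : 5 - 4 = 1)%R; last by lra.
    apply: (@le_trans _ _ (e^-1%:E * density mg (B 0%N))).
      apply: density_le => //; first by rewrite invr_ge0 ltW.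
      move=> x _; rewrite normrM mulrC ler_wpM2r// ger0_norm ?poisson_ge0//.
      exact: poisson_le_inv.
    apply: (@le_trans _ _ (e^-1%:E * (K * (2 ^+ 0 * e))%:E)).
      by rewrite lee_wpmul2l ?lee_fin ?invr_ge0 ?(ltW e0)// gK.
    by rewrite -EFinM lee_fin expr0 mul1r mulrC mulfK ?gt_eqF// mul1r.
  have BB : B n `<=` B n.+1.
    by apply: le_ball; rewrite exprS -mulrA ler_peMl ?(ltW (e2 n))// ler1n.
  rewrite -(setDUK BB) measureU//; last 2 first.
  - exact: measurableD.
  - by rewrite setDIK.
  apply: (@le_trans _ _ ((5 * K - 4 * K * 2 ^- n)%:E + (2 * K * 2 ^- n)%:E)).
    apply: leeD => //.
    apply: (@le_trans _ _ ((e / (2 ^+ n * e) ^+ 2)%:E * density mg (B n.+1 `\` B n))).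
      apply: density_le; first exact: measurableD.
        by rewrite divr_ge0 ?(ltW e0)// sqr_ge0.
      move=> x [_ nBx]; rewrite normrM mulrC ler_wpM2r// ger0_norm ?poisson_ge0//.
      apply: poisson_le => //; rewrite leNgt; apply/negP => xB; apply: nBx.
      by rewrite /B -ball_normE/= distrC.
    apply: (@le_trans _ _ ((e / (2 ^+ n * e) ^+ 2)%:E * (K * (2 ^+ n.+1 * e))%:E)).
      rewrite lee_wpmul2l ?lee_fin ?divr_ge0 ?(ltW e0)// ?exprn_ge0 ?(ltW (e2 _))//.
      apply: (@le_trans _ _ (density mg (B n.+1))).
        by apply: le_measure; rewrite ?inE//; exact: measurableD.
      by rewrite gK.
    rewrite -EFinM lee_fin (exprS _ n) le_eqVlt; apply/orP; left; apply/eqP.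
    have : (2 ^+ n : R)%R != 0%R by rewrite expf_neq0.
    by move: (2 ^+ n)%R => s s0; field; rewrite s0 gt_eqF.
  rewrite -EFinD lee_fin (exprS _ n) le_eqVlt; apply/orP; left; apply/eqP.
  have : (2 ^+ n : R)%R != 0%R by rewrite expf_neq0.
  by move: (2 ^+ n)%R => s s0; field.
have -> : [set: R] = \bigcup_n B n.
  apply/esym/seteqP; split => // x _.
  exists (Num.truncn (`|a - x| / e)%R).+1 => //.
  rewrite /B -ball_normE/=.
  have h1 : (`|a - x| / e < (Num.truncn (`|a - x| / e)%R).+1%:R)%R.
    by rewrite truncnS_gt.
  rewrite -ltr_pdivrMr// (lt_le_trans h1)// -natrX ler_nat ltnW//.
  exact: ltn_expl.
have ndB : nondecreasing_seq B.
  apply/nondecreasing_seqP => n; apply/subsetPset.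
  by apply: le_ball; rewrite exprS -mulrA ler_peMl ?(ltW (e2 n))// ler1n.
have mUB : measurable (\bigcup_n B n) by exact: bigcup_measurable.
have cB := @nondecreasing_cvg_mu _ _ _ (density mgp) B mB mUB ndB.
rewrite -(cvg_lim _ cB)//; apply: lime_le; first by apply/cvg_ex; eexists; exact: cB.
apply: nearW => n /=; apply: (le_trans (Bn n)).
by rewrite lee_fin gerBl mulr_ge0 ?mulr_ge0// invr_ge0 exprn_ge0.
Qed.

End kernels.

(** * Truncated Hilbert transforms and their discretization *)

Section truncated_hilbert.
Context {R : realType}.
Local Notation mu := (@lebesgue_measure R).
Local Notation L1 f := (mu.-integrable [set: R] (EFin \o f)).
Implicit Types f g h k : R -> R.

(** The truncation sits in the kernel and not in the domain of integration, so that kernels for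
    different [e] and [x] can be compared under one integral. *)
Definition ktrunc (e t : R) : R := if (e < `|t|)%R then t^-1%R else 0%R.

Definition htrunc (e : R) f (x : R) : R := (\int[mu]_y (f y * ktrunc e (x - y)))%R.

Lemma hilbert_truncE f (x e : R) : hilbert_trunc f x e = htrunc e f x.
Proof.
rewrite /hilbert_trunc Rintegral_mkcond; apply: eq_Rintegral => y _.
rewrite patchE /ktrunc; case: ifPn => [/set_mem/= -> //|].
by rewrite notin_setE/= => /negP/negPf ->; rewrite mulr0.
Qed.

Lemma ktrunc_le (e t : R) : (0 < e)%R -> (`|ktrunc e t| <= e^-1)%R.
Proof.
move=> e0; rewrite /ktrunc; case: ifPn => et; last by rewrite normr0 invr_ge0 ltW.
by rewrite normfV lef_pV2 ?posrE ?ltW// (lt_trans e0).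
Qed.

(** An indicator times a continuous function, which makes the measurability of the kernel
    visible. *)
Lemma ktruncE (e t : R) :
  ktrunc e t = ((e < `|t|)%R%:R * (t * (Num.max e `|t|) ^- 2))%R.
Proof.
rewrite /ktrunc; case: ifPn => et; last by rewrite mul0r.
rewrite mul1r (max_idPr (ltW et)) real_normK ?num_real//.
have [->|t0] := eqVneq t 0%R; first by rewrite invr0 mul0r.
by rewrite expr2 invfM mulrA mulfV// mul1r.
Qed.

Lemma measurable_ktrunc (e x : R) : (0 < e)%R ->
  measurable_fun [set: R] (fun y => ktrunc e (x - y)).
Proof.
move=> e0.
have mk : measurable_fun [set: R] (ktrunc e).
  rewrite (_ : ktrunc e = fun t => (\1_[set t | (e < `|t|)%R] t *
      (t * (Num.max e `|t|) ^- 2))%R); last first.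
    apply/funext => t; rewrite ktruncE indicE; congr (_%:R * _)%R.
    by rewrite mem_setE.
  apply: measurable_funM; last first.
    apply: measurable_funM => //.
    by apply: continuous_measurable_fun; exact: continuous_invmax.
  apply: measurable_indic; apply: open_measurable.
  rewrite (_ : mkset _ = (fun t : R => `|t|%R) @^-1` [set t : R | (e < t)%R])//.
  by apply: open_comp; [move=> ? _; exact: norm_continuous|exact: open_gt].
apply: (@measurableT_comp _ _ _ _ _ _ (ktrunc e)) => //.
exact: measurable_funB.
Qed.

Lemma L1_ktrunc f (e x : R) : (0 < e)%R -> L1 f ->
  L1 (fun y => f y * ktrunc e (x - y))%R.
Proof.
move=> e0 intf.
exact: (L1M intf (measurable_ktrunc x e0) (fun y => ktrunc_le (x - y) e0)).
Qed.

Lemma hilbert_existsP f (x : R) :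
  (forall e, (0 < e)%R -> L1 (fun y => f y * ktrunc e (x - y))%R) ->
  cvg (htrunc e f x @[e --> (0 : R)^'+]) -> hilbert_exists f x.
Proof.
move=> fL1 cf; split; last by under eq_fun do rewrite hilbert_truncE.
move=> e e0; have := fL1 _ e0.
have mS : measurable [set y : R | (e < `|x - y|)%R].
  rewrite (_ : mkset _ = ~` closed_ball x e).
    by apply: measurableC; exact: measurable_closed_ball.
  by rewrite closed_ballE//; apply/seteqP; split => y;
    rewrite /= /closed_ball_/= ltNge => /negP.
move=> h; have {h} := @integrableS _ _ R mu _ _ _ measurableT mS (@subsetT _ _) h.
apply: eq_integrable => // y; rewrite inE/= => ey.
by rewrite /ktrunc ey.
Qed.

Lemma htruncB f g (e x : R) : (0 < e)%R -> L1 f -> L1 g ->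
  htrunc e (f \- g)%R x = (htrunc e f x - htrunc e g x)%R.
Proof.
move=> e0 intf intg; rewrite /htrunc -RintegralB//; [|exact: L1_ktrunc..].
by apply: eq_Rintegral => y _; rewrite /= mulrBl.
Qed.

Lemma Rintegral_sum_ord (n : nat) (g : nat -> R -> R) :
  (forall i, L1 (g i)) -> L1 (fun y => \sum_(i < n) g i y)%R /\
  (\int[mu]_y (\sum_(i < n) g i y) = \sum_(i < n) \int[mu]_y g i y)%R.
Proof.
move=> ig; elim: n => [|n [IH1 IH2]].
  split.
    apply: (L1_le (g := g 0%N)) => //.
    rewrite (_ : (fun _ => _) = cst 0%R)//.
    by apply/funext => y; rewrite big_ord0.
    by move=> x; rewrite big_ord0 normr0.
  by rewrite big_ord0; under eq_Rintegral do rewrite big_ord0; rewrite Rintegral_cst// mul0r.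
split.
  have := integrableD measurableT IH1 (ig n).
  by apply: eq_integrable => // x _; rewrite /= big_ord_recr.
rewrite big_ord_recr/= -IH2 -RintegralD//.
by apply: eq_Rintegral => y _; rewrite big_ord_recr.
Qed.

Section discretization.
Context (A0 h : R) (h0 : (0 < h)%R) (n : nat).

Let a (i : nat) : R := (A0 + i%:R * h)%R.
Let cell (i : nat) : set R := `[a i, a i.+1[%classic.

Definition gridfun (F : R -> R) (y : R) : R :=
  (\sum_(i < n.+1) \1_(cell i) y * F (a i))%R.

(** The kernel [1 / (z - y)] with [y] moved to the left end of its cell: integrals against it are
    the finite sums of [weak_discrete]. *)
Definition kgrid (z : R) : R -> R := gridfun (fun b => (z - b)^-1)%R.

Let mcell i : measurable (cell i). Proof. exact: measurable_itv. Qed.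

Let cell_inj i j y : cell i y -> cell j y -> i = j.
Proof.
rewrite /cell/= !in_itv/= => /andP[iy yi] /andP[jy yj].
have ij : (i < j.+1)%N.
  have := le_lt_trans iy yj; rewrite /a ltrD2l ltr_pM2r// ltr_nat; exact.
have ji : (j < i.+1)%N.
  have := le_lt_trans jy yi; rewrite /a ltrD2l ltr_pM2r// ltr_nat; exact.
by apply/eqP; rewrite eqn_leq -ltnS ij -ltnS ji.
Qed.

Let trivIset_cell : trivIset [set: nat] cell.
Proof. by move=> i j _ _ [y [iy jy]]; exact: cell_inj iy jy. Qed.

Lemma gridfun_cell (F : R -> R) (y : R) :
  (A0 <= y)%R -> (y < A0 + n.+1%:R * h)%R ->
  exists b, [/\ (A0 <= b)%R, (b <= y)%R, (y < b + h)%R & gridfun F y = F b].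
Proof.
move=> Ay yA; have yh0 : (0 <= (y - A0) / h)%R by rewrite divr_ge0 ?subr_ge0// ltW.
pose j := Num.truncn ((y - A0) / h)%R.
have /andP[jy yj] := Num.Theory.truncn_itv yh0.
have jn : (j < n.+1)%N.
  rewrite -(@ltr_nat R) (le_lt_trans jy)// ltr_pdivrMr// ltrBlDl//.
have cj : cell j y.
  rewrite /cell/= in_itv/= /a -lerBrDl -ler_pdivlMr// jy/=.
  by rewrite -ltrBlDl -ltr_pdivrMr.
exists (a j); split.
- by rewrite /a lerDl mulr_ge0// ltW.
- by move: cj; rewrite /cell/= in_itv/= => /andP[].
- move: cj; rewrite /cell/= in_itv/= => /andP[_].
  by rewrite /a -natr1 mulrDl mul1r addrA.
- rewrite /gridfun (bigD1 (Ordinal jn))//= [X in (_ + X)%R]big1 => [|i ij].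
    by rewrite addr0 indicE mem_set// mul1r.
  rewrite indicE memNset ?mul0r// => ci.
  by move/eqP : ij; apply; apply/val_inj => /=; exact: cell_inj ci cj.
Qed.

Lemma gridfun_out (F : R -> R) (y : R) :
  ~~ (A0 <= y < A0 + n.+1%:R * h)%R -> gridfun F y = 0%R.
Proof.
move=> yA; rewrite /gridfun big1// => i _; rewrite indicE memNset ?mul0r//.
rewrite /cell/= in_itv/= => /andP[iy yi]; move/negP : yA; apply.
rewrite (le_trans _ iy) ?lerDl ?mulr_ge0 ?(ltW h0)//=.
by rewrite (lt_le_trans yi)// lerD2l ler_pM2r// ler_nat.
Qed.

(** Only the cell ends are exceptional. Local constancy is what makes the truncated transforms of a
    step function stationary as [e] tends to 0. *)
Lemma gridfun_near_cst (F : R -> R) :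
  {ae mu, forall x, \forall y \near x, gridfun F y = gridfun F x}.
Proof.
have ind i : {ae mu, forall x,
    \forall y \near x, \1_(cell i) y = \1_(cell i) x :> R}.
  exists [set a i; a i.+1]; split.
  - by apply: measurableU; exact: measurable_set1.
  - by apply: null_set_setU; [exact: measurable_set1|exact: measurable_set1| |];
      exact: lebesgue_measure_set1.
  move=> x; apply: contra_notP => /not_orP[/= /eqP x1 /eqP x2].
  have [xi|xi] := ltP x (a i).
    near=> y; rewrite !indicE !memNset// /cell/= in_itv/= => /andP[].
      by rewrite leNgt xi.
    by rewrite leNgt => /negP + _; apply; near: y; exact: lt_nbhsl.
  have [ix|ix] := ltP x (a i.+1).
    have {}xi : (a i < x)%R by rewrite lt_neqAle eq_sym x1.
    near=> y; rewrite !indicE !mem_set// /cell/= in_itv/= ?(ltW xi)//.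
    apply/andP; split; last by near: y; exact: lt_nbhsl.
    by apply: ltW; near: y; exact: lt_nbhsr.
  have {}ix : (a i.+1 < x)%R by rewrite lt_neqAle eq_sym x2.
  near=> y; rewrite !indicE !memNset// /cell/= in_itv/= => /andP[_].
    by rewrite ltNge (ltW ix).
  by rewrite ltNge => /negP; apply; apply: ltW; near: y; exact: lt_nbhsr.
rewrite /gridfun; elim: (n.+1) => [|k IH].
  by apply: aeW => x; near=> y; rewrite !big_ord0.
apply: lebesgue_aeS (lebesgue_aeI IH (ind k)) => x [h1 h2].
by near=> y; rewrite !big_ord_recr/=; congr (_ + _ * _)%R; near: y.
Unshelve. all: by end_near. Qed.

Lemma measurable_gridfun (F : R -> R) : measurable_fun [set: R] (gridfun F).
Proof. by apply: measurable_sum => i; apply: measurable_funM. Qed.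

(** The integral is [\sum_i c i / (z - a i)], with [c i] the integral of [f] over a cell. The sum of
    the [|c i|] is at most the L1 norm, so the bound does not depend on the mesh. *)
Lemma kgrid_weak f (mf : measurable_fun [set: R] f) (t : R) : L1 f -> (0 < t)%R ->
  (forall z, L1 (fun y => f y * kgrid z y)%R) /\
  exists U : set R, [/\ measurable U,
    mu U <= (20 / t)%:E * density mf [set: R] &
    forall z, ~ U z -> (`|\int[mu]_y (f y * kgrid z y)| < t)%R].
Proof.
move=> intf t0.
pose c i := (\int[mu]_(y in cell i) f y)%R.
have intc i : mu.-integrable (cell i) (EFin \o f).
  by apply: integrableS intf => //; exact: mcell.
have L1c i : L1 (fun y => f y * \1_(cell i) y)%R.
  apply: (L1M (M := 1%R) intf); first exact: measurable_indic.
  by move=> y; rewrite indicE; case: (_ \in _); rewrite ?normr1 ?normr0.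
have cE i : (c i = \int[mu]_y (f y * \1_(cell i) y))%R.
  rewrite /c Rintegral_mkcond; apply: eq_Rintegral => y _.
  by rewrite patchE indicE; case: ifPn; rewrite ?mulr1 ?mulr0.
have kE z : L1 (fun y => f y * kgrid z y)%R /\
    (\int[mu]_y (f y * kgrid z y) = \sum_(i < n.+1) c i / (z - a i))%R.
  have [|ig sg] := @Rintegral_sum_ord n.+1
      (fun i y => (z - a i)^-1 * (f y * \1_(cell i) y))%R.
    by move=> i; exact: L1Z.
  have E y : (\sum_(i < n.+1) (z - a i)^-1 * (f y * \1_(cell i) y) =
      f y * kgrid z y)%R.
    rewrite /kgrid /gridfun mulr_sumr; apply: eq_bigr => i _.
    by rewrite mulrC mulrA.
  split; first by apply: eq_integrable ig => // y _; rewrite /= E.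
  under eq_Rintegral do rewrite -E.
  rewrite sg; apply: eq_bigr => i _.
  by rewrite RintegralZl// -cE mulrC.
split; first by move=> z; have [] := kE z.
have [U [mU Ut Uz]] := weak_discrete A0 h0 n c t0.
exists U; split => //; last by move=> z /Uz; have [_ ->] := kE z.
apply: (le_trans Ut); rewrite mulrAC EFinM lee_wpmul2l//.
  by rewrite lee_fin divr_ge0// ltW.
rewrite -sumEFin.
apply: (@le_trans _ _ (\sum_(i < n.+1) density mf (cell i))).
  apply: lee_sum => i _; rewrite /c EFin_normr_Rintegral//; last exact: mcell.
  apply: le_abse_integral; first exact: mcell.
  exact: measurable_int (intc i).
rewrite -measure_bigsetU//.
by apply: le_measure; rewrite ?inE//; apply: measurable_bigU.
Qed.

End discretization.

End truncated_hilbert.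

(** * Unweighted weak type bound for the maximal truncated transform *)

Section unweighted_weak_type.
Context {R : realType}.
Local Notation mu := (@lebesgue_measure R).
Local Notation L1 f := (mu.-integrable [set: R] (EFin \o f)).
Implicit Types f g h k : R -> R.

(** Passing from [x - y] to [z - b] costs at most [e / 2], so [|z - b|] is still at least
    [|x - y| / 2], and the inverses differ by at most [e / |x - y| ^ 2]. *)
Lemma kgrid_near (A0 h e x y z b : R) : (0 < e)%R -> (e < `|x - y|)%R ->
  (`|x - z| <= e / 4)%R -> (b <= y)%R -> (y < b + h)%R -> (h <= e / 4)%R ->
  (`|(x - y)^-1 - (z - b)^-1| <= poisson e (y - x))%R.
Proof.
move=> e0 exy xz yb yb' he.
have [xy0 E] : (x - y != 0)%R /\ (`|y - x| = `|x - y|)%R.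
  by rewrite -normr_gt0 (lt_trans e0)// distrC.
have zbxy : (`|(z - b) - (x - y)| <= e / 2)%R.
  have -> : ((z - b) - (x - y) = (y - b) - (x - z))%R by ring.
  rewrite (le_trans (ler_normB _ _))//.
  have : (`|y - b| <= e / 4)%R by rewrite ger0_norm; lra.
  by lra.
have zb : (`|x - y| / 2 <= `|z - b|)%R.
  have := ler_normB (z - b)%R ((z - b) - (x - y))%R.
  rewrite (_ : (z - b - (z - b - (x - y)) = x - y)%R); last by ring.
  by lra.
have zb0 : (z - b != 0)%R by rewrite -normr_gt0 (lt_le_trans _ zb)// divr_gt0// (lt_trans e0).
rewrite /poisson E (max_idPr (ltW exy)).
have -> : ((x - y)^-1 - (z - b)^-1 = ((z - b) - (x - y)) / ((x - y) * (z - b)))%R.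
  by field; rewrite xy0 zb0.
rewrite normrM normfV normrM.
have n0 : (0 < `|x - y|)%R by exact: lt_trans exy.
have m0 : (0 < `|z - b|)%R by rewrite normr_gt0.
apply: (@le_trans _ _ (e / 2 / (`|x - y| * `|z - b|)))%R.
  by rewrite ler_pM2r// invr_gt0 mulr_gt0.
rewrite ler_pdivrMr ?mulr_gt0// mulrAC ler_pdivlMr ?exprn_gt0//.
rewrite expr2 -subr_ge0.
have -> : (e * (`|x - y| * `|z - b|) - e / 2 * (`|x - y| * `|x - y|) =
    e * `|x - y| * (`|z - b| - `|x - y| / 2))%R by field.
by rewrite mulr_ge0 ?mulr_ge0 ?subr_ge0 ?(ltW e0).
Qed.

Lemma ball_measure (x r : R) : (0 < r)%R -> mu (ball x r) = (2 * r)%:E.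
Proof.
by move=> r0; rewrite lebesgue_measure_ball ?ltW// mulr2n mulrDl mul1r.
Qed.

Let one : R -> R := cst 1%R.
Let m1 : measurable_fun [set: R] one. Proof. exact: measurable_cst. Qed.

Lemma density1 (A : set R) : measurable A -> density m1 A = mu A.
Proof.
move=> mA; rewrite /density; under eq_integral do rewrite normr1.
by rewrite integral_cst// mul1e.
Qed.

Let A1_one : A1_bound m1 1.
Proof.
exists set0; split => // x /= nx; exfalso; apply: nx => a b ax xb.
rewrite density1// lebesgue_measure_itv/= lte_fin (lt_trans ax xb) normr1 mul1r.
by rewrite mulr1 -EFinD.
Qed.

Lemma maximal_weak1 f (mf : measurable_fun [set: R] f) (t : R) :
  (0 < t)%R -> density mf [set: R] < +oo ->
  covered mu [set x | exists2 r, (0 < r)%R & (t * r)%:E < density mf (ball x r)]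
    ((12 / t)%:E * density mf [set: R]).
Proof.
move=> t0 foo.
have mf1 : measurable_fun [set: R] (f \* one)%R by exact: measurable_funM.
have [A [mA EA Ac]] := maximal_weak ler01 A1_one mf1 t0 foo.
exists A; split => //; rewrite -density1//; apply: (le_trans Ac).
rewrite expr1n mulr1 lee_wpmul2l ?lee_fin ?divr_ge0 ?(ltW t0)//.
rewrite -[leRHS]mul1e; apply: density_le => // x _.
by rewrite /= mulr1 mul1r.
Qed.

(** Cotlar's comparison. Let [f1] be the part of [f] within distance [e] of [x]. For [z] within
    [e / 4] of [x], the discretized transform of [f - f1] at [z] is within [5 K] of [htrunc e f x].
    If [z] also avoids [U] and the exceptional set of [f1], then [t < 2 t / 3 + 5 K], false for
    [t = 480 K]. The exceptional set of [f1] takes at most half of the ball, so [U] fills at least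
    the other half. *)
Lemma htrunc_pointwise {f} (mf : measurable_fun [set: R] f) (A0 h t e x K : R) (n : nat) :
  L1 f -> (0 < h)%R -> (0 < t)%R -> (0 < e)%R -> (h <= e / 4)%R ->
  (forall y, ~~ (A0 <= y < A0 + n.+1%:R * h)%R -> f y = 0%R) ->
  (t < `|htrunc e f x|)%R ->
  t = (480 * K)%R ->
  (forall r, (0 < r)%R -> density mf (ball x r) <= (K * r)%:E) ->
  forall U : set R, measurable U ->
    (forall z, ~ U z -> (`|\int[mu]_y (f y * kgrid A0 h n z y)| < t / 3)%R) ->
  (e / 4)%:E <= mu (U `&` ball x (e / 4)).
Proof.
move=> intf h0 t0 e0 he suppf tH tK Mf U mU Uz.
have K0 : (0 <= K)%R by lra.
pose B : set R := [set y | ~~ (e < `|x - y|)%R].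
have BE : B = closed_ball x e.
  rewrite closed_ballE//; apply/seteqP; split => y; by rewrite /closed_ball_ /B/= leNgt.
have mB : measurable B by rewrite BE; exact: measurable_closed_ball.
pose f1 : R -> R := (\1_B \* f)%R.
have m1B : measurable_fun [set: R] (\1_B : R -> R) by exact: measurable_indic.
have mf1 : measurable_fun [set: R] f1 by exact: measurable_funM.
have L1f1 : L1 f1.
  apply: (L1_le mf1 intf) => y; rewrite /f1/= indicE.
  by case: (_ \in _); rewrite ?mul1r// mul0r normr0.
have t30 : (0 < t / 3)%R by rewrite divr_gt0.
have [L1k _] := kgrid_weak A0 h0 n mf intf t30.
have [L1k1 [U1 [mU1 U1t U1z]]] := kgrid_weak A0 h0 n mf1 L1f1 t30.
have f1mass : density mf1 [set: R] <= (K * (2 * e))%:E.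
  apply: le_trans (Mf (2 * e)%R _); last by rewrite mulr_gt0.
  rewrite (density_indicM _ mB) setTI BE.
  apply: le_measure; rewrite ?inE//.
  - exact: measurable_closed_ball.
  - exact: measurable_ball.
  - by apply: closed_ball_subset => //; rewrite ltr_pMl// ltr1n.
(* [60 / t] times the mass [2 e K] equals [e / 4]; this is what the ratio 480 is for. *)
have muU1 : mu U1 <= (e / 4)%:E.
  apply: (le_trans U1t).
  apply: (@le_trans _ _ ((20 / (t / 3))%:E * (K * (2 * e))%:E)).
    by rewrite lee_wpmul2l// lee_fin divr_ge0// ltW.
  by rewrite -EFinM lee_fin le_eqVlt; apply/orP; left; apply/eqP; rewrite tK; field; lra.
have ball_sub : ball x (e / 4) `<=` U1 `|` (U `&` ball x (e / 4)).
  move=> z xz; have [U1z'|nU1] := pselect (U1 z); [by left|right].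
  split => //; apply: contrapT => nU.
  have := Uz _ nU; have := U1z _ nU1.
  move: xz; rewrite -ball_normE/= => xz h1 h2.
  have mp : measurable_fun [set: R] (f \* (fun y => poisson e (y - x)))%R.
    by apply: measurable_funM => //; exact: measurable_poisson.
  have L1d : L1 (fun y => f y * kgrid A0 h n z y - f1 y * kgrid A0 h n z y)%R.
    have := integrableB measurableT (L1k z) (L1k1 z).
    by apply: eq_integrable.
  have := Rintegral_dist_le mp (L1_ktrunc x e0 intf) L1d.
  have pw y : (`|f y * ktrunc e (x - y) -
      (f y * kgrid A0 h n z y - f1 y * kgrid A0 h n z y)| <=
      `|(f \* (fun y => poisson e (y - x))) y|)%R.
    have [|/suppf fy0] := boolP (A0 <= y < A0 + n.+1%:R * h)%R; last first.
      by rewrite /f1/= fy0 !(mul0r, mulr0) !subr0 normr0.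
    move=> /andP[Ay yA].
    have [b [_ by1 by2]] := gridfun_cell h0 (fun b => (z - b)^-1)%R Ay yA.
    rewrite -/(kgrid A0 h n z y) => ->.
    have yB : (y \in B) = ~~ (e < `|x - y|)%R by apply/idP/idP => [/set_mem|/mem_set].
    rewrite /f1/= /ktrunc indicE yB; case: ifPn => /= exy; last first.
      by rewrite mulr0 mul1r subrr subr0 normr0.
    rewrite !mul0r subr0 -mulrBr normrM [leRHS]normrM ler_wpM2l//.
    rewrite [leRHS]ger0_norm ?poisson_ge0//.
    exact: (kgrid_near A0 e0 exy (ltW xz) by1 by2 he).
  move=> /(_ pw); rewrite RintegralB// => d.
  have : (`|htrunc e f x - (\int[mu]_y (f y * kgrid A0 h n z y) -
      \int[mu]_y (f1 y * kgrid A0 h n z y))| <= 5 * K)%R.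
    rewrite -lee_fin; apply: (le_trans d).
    apply: poisson_density => //.
    by move=> r er; apply: Mf; exact: lt_le_trans er.
  move: tH h1 h2; set X := htrunc e f x; set Y := (\int[mu]_y _)%R.
  set Z := (\int[mu]_y _)%R; rewrite !ltr_norml ler_norml lter_normr.
  by move=> /orP[] ? /andP[? ?] /andP[? ?] /andP[? ?]; lra.
have e40 : (0 < e / 4)%R by rewrite divr_gt0.
have mb : measurable (ball x (e / 4)) by exact: measurable_ball.
have : mu (ball x (e / 4)) <= mu U1 + mu (U `&` ball x (e / 4)).
  apply: (@le_trans _ _ (mu (U1 `|` (U `&` ball x (e / 4))))).
    apply: le_measure; rewrite ?inE//; apply: measurableU => //.
    exact: measurableI.
  by apply: measureU2 => //; exact: measurableI.
rewrite ball_measure//.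
move=> h1; have {h1} : (2 * (e / 4))%:E <= (e / 4)%:E + mu (U `&` ball x (e / 4)).
  by apply: (le_trans h1); exact: leeD2r.
by rewrite -leeBlDl// -EFinB (_ : 2 * (e / 4) - e / 4 = e / 4)%R//; lra.
Qed.

(** With [K = t / 480], the first term accounts for the points where the maximal function is at most
    [K], the second for the others. *)
Definition hstar_const : R := (24 * 60 + 12 * 480)%R.

(** Where the maximal function exceeds [t / 480], [maximal_weak1] applies. Elsewhere, by
    [htrunc_pointwise], a point with a large truncation has, for every fine enough mesh, a ball in
    which [U n] is dense. The measure of [U n] is bounded independently of the mesh, so the maximal
    theorem for its indicator and [covered_liminf] conclude. *)
Lemma hstar_weak {f} (mf : measurable_fun [set: R] f) (A t : R) :
  L1 f -> (0 < A)%R -> (0 < t)%R ->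
  (forall y, ~~ (- A <= y < A)%R -> f y = 0%R) ->
  covered mu [set x | exists2 e, (0 < e)%R & (t < `|htrunc e f x|)%R]
    ((hstar_const / t)%:E * density mf [set: R]).
Proof.
move=> intf A0 t0 suppf.
have foo : density mf [set: R] < +oo by exact/L1_density.
have t30 : (0 < t / 3)%R by rewrite divr_gt0.
(* With this mesh the [n.+1] cells fill exactly [[-A, A[]. *)
pose h n : R := (2 * A / n.+1%:R)%R.
have h0 n : (0 < h n)%R by rewrite divr_gt0// mulr_gt0.
have [K [K0 tK]] : exists K, (0 < K)%R /\ t = (480 * K)%R.
  by exists (t / 480)%R; split; [lra|field].
have /choice[U U_] n := (kgrid_weak (- A) (h0 n) n mf intf t30).2.
have mU n : measurable (U n) by have [] := U_ n.
have m1U n : measurable_fun [set: R] (\1_(U n) : R -> R) by exact: measurable_indic.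
have Ut n : mu (U n) <= (60 / t)%:E * density mf [set: R].
  have [_ + _] := U_ n; rewrite (_ : 20 / (t / 3) = 60 / t)%R//.
  by field; rewrite gt_eqF.
pose E1 : set R := [set x | (exists2 e, (0 < e)%R & (t < `|htrunc e f x|)%R) /\
  forall r, (0 < r)%R -> density mf (ball x r) <= (K * r)%:E].
pose E2 : set R := [set x | exists2 r, (0 < r)%R &
  (K * r)%:E < density mf (ball x r)].
have E2c : covered mu E2 ((12 / K)%:E * density mf [set: R]).
  exact: maximal_weak1 K0 foo.
have E1c : covered mu E1 ((24 * (60 / t))%:E * density mf [set: R]).
  pose En n : set R := [set x | exists2 r, (0 < r)%R &
    (1 / 2 * r)%:E < density (m1U n) (ball x r)].
  apply: (covered_liminf (m := lebesgue_measure) (E_ := En)) => [n|x [[e e0 xe] Mf]].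
    have Utoo : density (m1U n) [set: R] < +oo.
      rewrite density_indic// setIT (le_lt_trans (Ut n))//.
      by rewrite lte_mul_pinfty// lee_fin divr_ge0// ltW.
    have h2 : (0 < 1 / 2 :> R)%R by [].
    apply: covered_sub (maximal_weak1 h2 Utoo) => //.
    rewrite density_indic// setIT.
    apply: (@le_trans _ _ ((12 / (1 / 2))%:E * ((60 / t)%:E * density mf [set: R]))).
      by rewrite lee_wpmul2l.
    rewrite muleA -EFinM (_ : 12 / (1 / 2) = 24)%R//.
    by field.
  have hN : (0 <= 8 * A / e)%R by rewrite divr_ge0 ?mulr_ge0 ?(ltW A0) ?(ltW e0).
  exists (Num.truncn (8 * A / e)%R) => n Nn.
  have he : (h n <= e / 4)%R.
    have : (8 * A / e < n.+1%:R)%R.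
      rewrite (lt_le_trans (Num.Theory.truncnS_gt _))// ler_nat ltnS//.
    rewrite ltr_pdivrMr// => hn; rewrite ler_pdivrMr//.
    by nra.
  exists (e / 4)%R; first by rewrite divr_gt0.
  have [_ _ Uz] := U_ n.
  have suppf' y : ~~ (- A <= y < - A + n.+1%:R * h n)%R -> f y = 0%R.
    rewrite (_ : - A + n.+1%:R * h n = A)%R; first exact: suppf.
    by rewrite /h mulrCA mulfV// mulr1; ring.
  have := htrunc_pointwise intf (h0 n) t0 e0 he suppf' xe tK Mf (mU n) Uz.
  rewrite density_indic//; last exact: measurable_ball.
  by apply: lt_le_trans; rewrite lte_fin; lra.
apply: covered_sub (coveredU E1c E2c).
  move=> x xe.
  have [Mf|nMf] := pselect (forall r, (0 < r)%R ->
    density mf (ball x r) <= (K * r)%:E); first by left.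
  right; apply: contrapT => nE2; apply: nMf => r r0.
  by rewrite leNgt; apply/negP => xr; apply: nE2; exists r.
rewrite -ge0_muleDl ?lee_fin.
- suff -> : (hstar_const / t = 24 * (60 / t) + 12 / K)%R by rewrite -EFinD.
  by rewrite /hstar_const tK; field; rewrite gt_eqF.
- by rewrite mulr_ge0// divr_ge0// ltW.
- by rewrite divr_ge0// ltW.
Qed.

End unweighted_weak_type.

(** * Dominated convergence and open level sets *)

Section dominated.
Context {R : realType}.
Local Notation mu := (@lebesgue_measure R).
Local Notation L1 f := (mu.-integrable [set: R] (EFin \o f)).

Lemma Rintegral_dominated (F : nat -> R -> R) (G g : R -> R) :
  (forall n, measurable_fun [set: R] (F n)) -> measurable_fun [set: R] G ->
  L1 g -> (forall n x, (`|F n x| <= g x)%R) ->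
  {ae mu, forall x, F n x @[n --> \oo] --> G x} ->
  (\int[mu]_x F n x @[n --> \oo] --> \int[mu]_x G x)%R /\
  \int[mu]_x `|F n x - G x|%:E @[n --> \oo] --> 0.
Proof.
move=> mF mG intg Fg FG.
have mF' n : measurable_fun [set: R] (EFin \o F n) by exact/measurable_EFinP.
have mG' : measurable_fun [set: R] (EFin \o G) by exact/measurable_EFinP.
have FG' : {ae mu, forall x, [set: R] x -> (EFin \o F n) x @[n --> \oo] --> (EFin \o G) x}.
  by apply: lebesgue_aeS FG => x + _; apply: cvg_EFin; exact: nearW.
have Fg' : {ae mu, forall x n, [set: R] x -> `|(EFin \o F n) x| <= (EFin \o g) x}.
  by apply: aeW => x n _; rewrite lee_fin.
have [iG c1 c2] := @dominated_convergence _ _ R mu [set: R] measurableT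
  (fun n => EFin \o F n) (EFin \o G) (EFin \o g) mF' mG' FG' intg Fg'.
split; last exact: c1.
apply: (fine_cvg (f := fun n => \int[mu]_x (F n x)%:E)).
by rewrite fineK ?integrable_fin_num.
Qed.

Lemma lebesgue_ae_notin (N : set R) (P : R -> Prop) :
  measurable N -> mu N = 0 -> (forall x, ~ N x -> P x) -> {ae mu, forall x, P x}.
Proof.
move=> mN N0 NP; exists N; split => // x nPx; apply: contrapT => nNx.
exact/nPx/NP.
Qed.

(** Dominated convergence along sequences: the limit kernel jumps only at [y = p - e] and
    [y = p + e]. *)
Lemma continuous_htrunc (e : R) (f : R -> R) : (0 < e)%R -> L1 f ->
  continuous (htrunc e f).
Proof.
move=> e0 intf p; apply/continuous_withinNx/cvgr_dnbhsP => u [_ up].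
have mf := L1_measurable intf.
apply: (Rintegral_dominated (g := fun y => (e^-1 * `|f y|)%R) _ _ _ _ _).1.
- by move=> n; apply: measurable_funM => //; exact: measurable_ktrunc.
- by apply: measurable_funM => //; exact: measurable_ktrunc.
- by apply: L1Z; exact: integrable_norm.
- by move=> n x; rewrite normrM mulrC ler_wpM2r// ktrunc_le.
apply: (@lebesgue_ae_notin [set (p - e)%R; (p + e)%R]).
- by apply: measurableU; exact: measurable_set1.
- apply: null_set_setU; [exact: measurable_set1|exact: measurable_set1| |];
    exact: lebesgue_measure_set1.
move=> y /not_orP[/= y1 y2].
apply: cvgM; first exact: cvg_cst.
have uy : (u n - y)%R @[n --> \oo] --> (p - y)%R.
  by apply: cvgB => //; exact: cvg_cst.
have nuy : (`|u n - y|)%R @[n --> \oo] --> (`|p - y|)%R by exact: cvg_norm.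
have [ey|ye|ye] := ltgtP e `|p - y|%R.
- have nz : (p - y != 0)%R by rewrite -normr_gt0 (lt_trans e0).
  rewrite [X in _ --> X](_ : _ = (p - y)^-1)%R; last by rewrite /ktrunc ey.
  have : ((u n - y)^-1)%R @[n --> \oo] --> ((p - y)^-1)%R by exact: cvgV.
  have ev : \forall n \near \oo, (e < `|u n - y|)%R by exact: (cvgr_gt _ nuy).
  apply: cvg_trans; apply: near_eq_cvg; near=> n.
  by rewrite /ktrunc ifT//; near: n.
- have ev : \forall n \near \oo, (`|u n - y| < e)%R by exact: (cvgr_lt _ nuy).
  rewrite [X in _ --> X](_ : _ = 0)%R; last by rewrite /ktrunc ltNge ltW.
  apply: cvg_near_cst; near=> n.
  by rewrite /ktrunc ifF//; apply/negbTE; rewrite -leNgt ltW//; near: n.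
- exfalso; move/eqP : ye; rewrite eq_sym eqr_norml => /andP[/orP[]/eqP h _].
    by apply: y1; lra.
  by apply: y2; lra.
Unshelve. all: by end_near. Qed.

(** A union of open sets over all [e]. Openness makes the level set measurable and splits it into
    intervals. *)
Lemma open_hstar_gt (f : R -> R) (t : R) : L1 f ->
  open [set x | exists2 e, (0 < e)%R & (t < `|htrunc e f x|)%R].
Proof.
move=> intf.
rewrite (_ : mkset _ = \bigcup_(e in [set e | (0 < e)%R])
    [set x | (t < `|htrunc e f x|)%R]).
  apply: bigcup_open => e /= e0.
  rewrite (_ : mkset _ = (fun x => `|htrunc e f x|%R) @^-1` [set s | (t < s)%R])//.
  apply: open_comp; last exact: open_gt.
  move=> x _; apply: cvg_norm; exact: continuous_htrunc.
by apply/seteqP; split => [x [e e0 te]|x [e e0 te]]; exists e.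
Qed.

End dominated.

(** * Components of bounded open sets *)

Section components.
Context {R : realType}.

Definition component (O : set R) (a b : R) :=
  [/\ (a < b)%R, `]a, b[ `<=` O, ~ O a & ~ O b].

Lemma open_component (O : set R) (B x : R) : open O ->
  (forall y, O y -> (`|y| <= B)%R) -> O x ->
  exists a b, [/\ component O a b, (a < x)%R & (x < b)%R].
Proof.
move=> oO OB Ox.
have xB := OB _ Ox.
have cO : closed (~` O) by rewrite closedC.
(* The left end is the supremum of the points of the complement below [y], a nonempty set because
   [P] is bounded below. The right end comes from the reflected set. *)
have left (P : set R) y : open P -> (forall z, P z -> (- B <= z)%R) -> P y ->
    exists b, [/\ (b < y)%R, ~ P b & forall z, (z <= y)%R -> (b < z)%R -> P z].
  move=> oP PB Py.
  pose S := [set z | (z <= y)%R /\ ~ P z].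
  have S0 : S !=set0.
    exists (- B - 1)%R; split; first by rewrite (le_trans _ (PB _ Py))// gerBl.
    by move=> /PB; rewrite leNgt gtrBl ltr01.
  have uS : has_ubound S by exists y => z [].
  have PI : ~ P (sup S).
    have cS : closed S.
      apply: closedI; first exact: closed_le.
      by rewrite closedC.
    by have [] := cS _ (closure_sup S0 uS).
  exists (sup S); split => //.
    rewrite lt_neqAle; apply/andP; split.
      by apply/eqP => h; apply: PI; rewrite h.
    by apply: ge_sup => // z [].
  move=> z yz zS; apply: contrapT => nPz.
  by move: zS; rewrite ltNge => /negP; apply; apply: ub_le_sup.
have OB' z : O z -> (- B <= z)%R.
  by move=> /OB zB; rewrite lerNl; apply: le_trans zB; rewrite -normrN ler_norm.
have [a [ax nOa aO]] := left O x oO OB' Ox.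
pose P : set R := -%R @^-1` O.
have oP : open P by apply: open_comp => // z _; exact: oppr_continuous.
have [||b [bx nOb bO]] := left P (- x)%R oP.
- by move=> z /OB zB; rewrite lerNl; apply: le_trans zB; exact: ler_norm.
- by rewrite /P/= opprK.
exists a, (- b)%R; split=> //; last by rewrite ltrNr.
split=> //; first by rewrite (lt_trans ax)// ltrNr.
move=> z /=; rewrite in_itv/= => /andP[az zb].
have [zx|xz] := leP z x; first exact: aO.
have := bO (- z)%R; rewrite /P/= opprK; apply; last by rewrite ltrNr.
by rewrite lerN2 ltW.
Qed.

Lemma component_eq (O : set R) (a b c d x : R) : component O a b ->
  component O c d -> (a < x)%R -> (x < b)%R -> (c < x)%R -> (x < d)%R ->
  a = c /\ b = d.
Proof.
move=> [ab abO nOa nOb] [cd cdO nOc nOd] ax xb cx xd; split.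
- have [ac|ca|//] := ltgtP a c; exfalso.
    by apply: nOc; apply: abO; rewrite /= in_itv/= ac (lt_trans cx xb).
  by apply: nOa; apply: cdO; rewrite /= in_itv/= ca (lt_trans ax xd).
- have [bd|db|//] := ltgtP b d; exfalso.
    by apply: nOb; apply: cdO; rewrite /= in_itv/= bd (lt_trans cx xb).
  by apply: nOd; apply: abO; rewrite /= in_itv/= db (lt_trans ax xd).
Qed.

(** Components are disjoint, and countably many since each contains a rational; the bounds on them
    add up. *)
Lemma component_sum (m : {measure set R -> \bar R}) (O A : set R) (B eta : R) :
  open O -> (forall y, O y -> (`|y| <= B)%R) -> measurable A -> A `<=` O ->
  (0 <= eta)%R ->
  (forall a b, component O a b -> m (A `&` `]a, b[%classic) <= eta%:E * m `]a, b[%classic) ->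
  m A <= eta%:E * m O.
Proof.
move=> oO OB mA AO eta0 Aab.
(* [I_ n] is the component of the rational with code [n], so each component occurs once for every
   rational in it. *)
have /choice[I_ IP] : forall n : nat, exists I : set R,
    (I = set0 \/ exists a b, component O a b /\ I = `]a, b[%classic) /\
    (forall q : rat, unpickle n = Some q -> O (ratr q) -> I (ratr q)).
  move=> n; case: (unpickle n) => [q|]; last by exists set0; split; [left|].
  have [Oq|nOq] := pselect (O (ratr q)); last first.
    by exists set0; split; [left|move=> q' [<-]].
  have [a [b [Cab aq qb]]] := open_component oO OB Oq.
  exists `]a, b[%classic; split; first by right; exists a, b.
  by move=> q' [<-] _; rewrite /= in_itv/= aq.
have mI n : measurable (I_ n).
  by have [[->|[a [b [_ ->]]]] _] := IP n.
have OE : O = \bigcup_n I_ n.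
  apply/seteqP; split => [x Ox|x [n _]]; last first.
    by have [[->|[a [b [[_ abO _ _] ->]]]] _] := IP n => //; exact: abO.
  have [a [b [Cab ax xb]]] := open_component oO OB Ox.
  have [q] := rat_in_itvoo ax; rewrite in_itv/= => /andP[aq qx].
  have Oq : O (ratr q).
    by have [_ + _ _] := Cab; apply; rewrite /= in_itv/= aq (lt_trans qx).
  exists (pickle q) => //.
  have [[I0|[c [d [Ccd Icd]]]] Iq] := IP (pickle q).
    by have := Iq q (pickleK q) Oq; rewrite I0.
  have := Iq q (pickleK q) Oq; rewrite Icd /= !in_itv/= => /andP[cq qd].
  have [<- <-] := component_eq Cab Ccd aq (lt_trans qx xb) cq qd.
  by rewrite ax.
have mO : measurable O by exact: open_measurable.
(* Two components are equal or disjoint, so [seqDU] keeps the first copy of each whole and empties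
   the later ones. *)
pose F := seqDU I_.
have FI n : F n = set0 \/ F n = I_ n.
  rewrite /F /seqDU.
  have [[I0|[a [b [Cab Iab]]]] _] := IP n; first by left; rewrite I0 set0D.
  have [[k kn Ik]|nk] := pselect (exists2 k, (k < n)%N & I_ k = I_ n).
    left; rewrite -subset0 => x [Inx]; apply.
    by rewrite (bigD1 (Ordinal kn))//=; left; rewrite Ik.
  right; apply/seteqP; split => [x []//|x Inx]; split => //.
  rewrite -bigcup_mkord => -[k /= kn Ikx]; apply: nk; exists k => //.
  have [[I0|[c [d [Ccd Icd]]]] _] := IP k; first by rewrite I0 in Ikx.
  move: Ikx Inx; rewrite Icd Iab /= !in_itv/= => /andP[cx xd] /andP[ax xb].
  by have [-> ->] := component_eq Cab Ccd ax xb cx xd.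
have mF n : measurable (F n) by have [->|->] := FI n.
have tF : trivIset [set: nat] F by exact: trivIset_seqDU.
have OF : O = \bigcup_n F n by rewrite OE seqDU_bigcup_eq.
have AF : A = \bigcup_n (A `&` F n) by rewrite -setI_bigcupr -OF setIidl.
have mAF n : measurable (A `&` F n) by exact: measurableI.
rewrite {1}AF measure_semi_bigcup//; last 2 first.
- exact: trivIset_setIl.
- exact: bigcup_measurable.
rewrite {1}OF measure_semi_bigcup//; last exact: bigcup_measurable.
rewrite -nneseriesZl//; apply: lee_nneseries => // n _.
have [->|->] := FI n; first by rewrite setI0 measure0 mule0.
have [[->|[a [b [Cab ->]]]] _] := IP n; last exact: Aab.
by rewrite setI0 measure0 mule0.
Qed.

End components.

(** * The good-lambda estimate on one component *)

Section good_lambda_local.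
Context {R : realType}.
Local Notation mu := (@lebesgue_measure R).
Local Notation L1 f := (mu.-integrable [set: R] (EFin \o f)).
Implicit Types f g h k : R -> R.

(** Compares the far part of the kernel at [x] with a kernel at the end point [a]. Where both are
    present they differ by about [|x - a| / |y - a| ^ 2]; with [e' = max e (2 L)], where only one is
    present its size is about [1 / e']. *)
Lemma ktrunc_shift (a x y e L e' : R) : (a < x)%R -> (x - a < L)%R -> (0 < e)%R ->
  e' = Num.max e (2 * L)%R ->
  (`|(2 * L < `|y - a|)%R%:R * ktrunc e (x - y) - ktrunc e' (a - y)| <=
   2 * poisson e' (y - a))%R.
Proof.
move=> ax xL e0 e'E.
have L0 : (0 < L)%R by lra.
have e'0 : (0 < e')%R by rewrite e'E lt_max e0.
have Le' : (2 * L <= e')%R by rewrite e'E le_max lexx orbT.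
have ee' : (e <= e')%R by rewrite e'E le_max lexx.
have P0 := poisson_ge0 (y - a) e'0.
set D := `|y - a|%R.
case: (ltP (2 * L)%R D) => LD; last first.
  rewrite mul0r /ktrunc (distrC a y) -/D ifF; last by apply/negbTE; rewrite -leNgt (le_trans LD).
  by rewrite subrr normr0 mulr_ge0.
have D0 : (0 < D)%R by apply: lt_trans LD; rewrite mulr_gt0.
have xaL : (`|x - a| < L)%R by rewrite gtr0_norm ?subr_gt0.
have xyD : (D - L <= `|x - y|)%R.
  have := ler_normB (x - a)%R (x - y)%R.
  by rewrite (_ : x - a - (x - y) = y - a)%R; [rewrite -/D; lra|ring].
have xyD' : (`|x - y| <= D + L)%R.
  have := ler_normB (x - a)%R (y - a)%R.
  by rewrite (_ : x - a - (y - a) = x - y)%R; [rewrite -/D; lra|ring].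
have xy2 : (D / 2 < `|x - y|)%R by lra.
have xy0 : (0 < `|x - y|)%R by apply: lt_trans xy2; rewrite divr_gt0.
have xyn0 : (x - y != 0)%R by rewrite -normr_gt0.
have ayn0 : (a - y != 0)%R by rewrite -normr_gt0 distrC.
rewrite mul1r /ktrunc (distrC a y) -/D.
case: (ltP e' D) => eD; case: (ltP e `|x - y|%R) => exy.
- rewrite /poisson -/D (max_idPr (ltW eD)).
  have -> : ((x - y)^-1 - (a - y)^-1 = (a - x) / ((x - y) * (a - y)))%R.
    by field; rewrite xyn0 ayn0.
  rewrite normrM normfV normrM (distrC a x) (distrC a y) -/D.
  rewrite ler_pdivrMr ?mulr_gt0// mulrA mulrAC ler_pdivlMr ?exprn_gt0//.
  have h1 : (`|x - a| * D <= e' / 2 * D)%R by rewrite ler_pM2r//; lra.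
  have h2 : (e' / 2 * D <= 2 * e' * `|x - y|)%R by nra.
  rewrite expr2 mulrA [leRHS]mulrA ler_pM2r//.
  exact: le_trans h2.
- rewrite sub0r normrN normfV (distrC a y) -/D /poisson -/D (max_idPr (ltW eD)).
  rewrite mulrA ler_pdivlMr ?exprn_gt0// expr2 mulrA mulVf ?gt_eqF// mul1r.
  by lra.
- have ee : e = e'.
    by move: eD LD; rewrite e'E; case: (leP e (2 * L)%R) => // _; lra.
  rewrite subr0 normfV /poisson -/D (max_idPl eD) expr2 invfM.
  rewrite [X in (_ <= 2 * X)%R](_ : _ = e'^-1)%R; last by field; rewrite gt_eqF.
  have : (`|x - y|^-1 <= e'^-1)%R by rewrite lef_pV2 ?posrE -?ee// ltW.
  by have := invr_gt0 e'; rewrite e'0; lra.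
- by rewrite subr0 normr0 mulr_ge0.
Qed.

Lemma hstar_const_gt0 : (0 < hstar_const :> R)%R.
Proof. by rewrite /hstar_const; lra. Qed.

(** Split [f] at distance [2 L] from [a], with [L = b - a]. The far part at [x] is within
    [20 K <= delta t / 2] of a truncation of [f] at [a], which is at most [t]. So the near part must
    exceed [delta t / 2]; its mass is at most [6 K L], and the unweighted weak type bound leaves
    measure at most [L / 2]. *)
Lemma good_lambda_local {f} (mf : measurable_fun [set: R] f)
    (A a b x0 t delta K : R) :
  L1 f -> (0 < A)%R -> (forall y, ~~ (- A <= y < A)%R -> f y = 0%R) ->
  (a < x0)%R -> (x0 < b)%R -> (0 < t)%R -> (0 < delta)%R -> (0 <= K)%R ->
  (forall e, (0 < e)%R -> (`|htrunc e f a| <= t)%R) ->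
  (forall r, (0 < r)%R -> density mf (ball x0 r) <= (K * r)%:E) ->
  ((24 * hstar_const + 40) * K <= delta * t)%R ->
  covered mu [set x | [/\ (a < x)%R, (x < b)%R &
    exists2 e, (0 < e)%R & ((1 + delta) * t < `|htrunc e f x|)%R]]
    ((b - a) / 2)%:E.
Proof.
move=> intf A0 suppf ax0 x0b t0 d0 K0 Ha Mf Kt.
have hc0 := hstar_const_gt0.
pose L := (b - a)%R.
have L0 : (0 < L)%R by rewrite /L; lra.
(* A ball about [a] of radius [r >= L] lies in the ball of radius [2 r] about [x0], where the mass
   is controlled. *)
have balla r : (L <= r)%R -> density mf (ball a r) <= (2 * K * r)%:E.
  move=> Lr; rewrite mulrAC mulrC.
  apply: (le_trans _ (Mf (2 * r)%R _)); last by rewrite mulr_gt0// (lt_le_trans L0).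
  apply: le_measure; rewrite ?inE; [exact: measurable_ball..|].
  move=> y; rewrite -!ball_normE/= => ay.
  rewrite -(subrK a x0) -addrA (le_lt_trans (ler_normD _ _))//.
  rewrite gtr0_norm ?subr_gt0//.
  by rewrite /L in Lr; lra.
pose D : set R := [set y | (2 * L < `|y - a|)%R].
have mD : measurable D.
  rewrite (_ : D = ~` closed_ball a (2 * L)%R).
    by apply: measurableC; exact: measurable_closed_ball.
  rewrite closed_ballE ?mulr_gt0//; apply/seteqP; split => y;
    by rewrite /D/= /closed_ball_/= distrC ltNge => /negP.
pose f2 : R -> R := (\1_D \* f)%R.
pose f1 : R -> R := (\1_(~` D) \* f)%R.
have m1D : measurable_fun [set: R] (\1_D : R -> R) by exact: measurable_indic.
have m1D' : measurable_fun [set: R] (\1_(~` D) : R -> R).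
  by apply: measurable_indic; exact: measurableC.
have mf2 : measurable_fun [set: R] f2 by exact: measurable_funM.
have mf1 : measurable_fun [set: R] f1 by exact: measurable_funM.
have L1f2 : L1 f2.
  apply: (L1_le mf2 intf) => y; rewrite /f2/= indicE.
  by case: (_ \in _); rewrite ?mul1r// mul0r normr0.
have L1f1 : L1 f1.
  apply: (L1_le mf1 intf) => y; rewrite /f1/= indicE.
  by case: (_ \in _); rewrite ?mul1r// mul0r normr0.
have f1E : (f \- f2)%R = f1.
  apply/funext => y; rewrite /f1 /f2/= !indicE in_setC.
  by case: (_ \in _); rewrite !(mul1r, mul0r, subrr, subr0).
have f1mass : density mf1 [set: R] <= (6 * K * L)%:E.
  rewrite density_indicM; last exact: measurableC.
  rewrite setTI; apply: (@le_trans _ _ (density mf (ball a (3 * L)%R))).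
    apply: le_measure; rewrite ?inE; [exact: measurableC|exact: measurable_ball|].
    move=> y /= /negP; rewrite -leNgt -ball_normE/= distrC; lra.
  apply: (le_trans (balla _ _)); first by lra.
  by rewrite lee_fin; lra.
have suppf1 y : ~~ (- A <= y < A)%R -> f1 y = 0%R.
  by move=> /suppf fy; rewrite /f1/= fy mulr0.
have dt : (0 < delta * t / 2)%R by rewrite divr_gt0 ?mulr_gt0.
apply: covered_sub (hstar_weak mf1 L1f1 A0 dt suppf1); last first.
  apply: (@le_trans _ _ ((hstar_const / (delta * t / 2))%:E * (6 * K * L)%:E)).
    by rewrite lee_wpmul2l// lee_fin divr_ge0// ltW.
  rewrite -EFinM lee_fin -/L mulrAC ler_pdivrMr//.
  have : (24 * hstar_const * K <= delta * t)%R.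
    have : (0 <= 40 * K)%R by rewrite mulr_ge0.
    by move: Kt; move: (hstar_const) => hc; lra.
  by move: (hstar_const) => hc; nra.
move=> x /= [ax xb [e e0 xe]]; exists e => //.
pose e' := Num.max e (2 * L)%R.
have e'0 : (0 < e')%R by rewrite /e' lt_max e0.
pose g : R -> R := (fun y => 2 * f y)%R.
have mg : measurable_fun [set: R] g by exact: measurable_funM.
have mgp : measurable_fun [set: R] (g \* (fun y => poisson e' (y - a)))%R.
  by apply: measurable_funM => //; exact: measurable_poisson.
have := Rintegral_dist_le mgp (L1_ktrunc x e0 L1f2) (L1_ktrunc a e'0 intf).
have pw y : (`|f2 y * ktrunc e (x - y) - f y * ktrunc e' (a - y)| <=
    `|(g \* (fun y => poisson e' (y - a))) y|)%R.
  have yD : (y \in D) = (2 * L < `|y - a|)%R by apply/idP/idP => [/set_mem|/mem_set].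
  rewrite /f2 /g/= indicE yD.
  rewrite (_ : _ - _ = f y * ((2 * L < `|y - a|)%R%:R * ktrunc e (x - y) -
    ktrunc e' (a - y)))%R; last by ring.
  have -> : (2 * f y * poisson e' (y - a) = f y * (2 * poisson e' (y - a)))%R by ring.
  rewrite normrM [leRHS]normrM ler_wpM2l//.
  rewrite [leRHS]ger0_norm; last by rewrite mulr_ge0 ?poisson_ge0.
  by apply: ktrunc_shift => //; rewrite /L; lra.
move=> /(_ pw) d.
have dK : (`|htrunc e f2 x - htrunc e' f a| <= 20 * K)%R.
  rewrite -lee_fin; apply: (le_trans d).
  rewrite (_ : 20 * K = 5 * (4 * K))%R; last by ring.
  apply: poisson_density => //; first by rewrite mulr_ge0.
  move=> r er; apply: (@le_trans _ _ (2%:E * density mf (ball a r))).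
    apply: density_le => //; first exact: measurable_ball.
    by move=> y _; rewrite /g normrM ger0_norm.
  apply: (@le_trans _ _ (2%:E * (2 * K * r)%:E)).
    rewrite lee_wpmul2l// balla// (le_trans _ er)// /e' le_max.
    by apply/orP; right; lra.
  by rewrite -EFinM lee_fin; lra.
have ha := Ha _ e'0.
have K40 : (40 * K <= delta * t)%R.
  have : (0 <= hstar_const * K)%R by rewrite mulr_ge0// ltW.
  by move: Kt; move: (hstar_const) => hc; lra.
have : (htrunc e f1 x = htrunc e f x - htrunc e f2 x)%R.
  by rewrite -f1E htruncB.
move: xe ha dK; move: (htrunc e f1 x) (htrunc e f x) (htrunc e f2 x) (htrunc e' f a).
move=> X Y Z W; rewrite lter_normr !ler_norml => h /andP[? ?] /andP[? ?] XYZ.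
rewrite lter_normr XYZ; case/orP : h => h; apply/orP; [left|right]; lra.
Qed.

End good_lambda_local.

(** * Good-lambda inequality and weak type bound for A1 weights *)

Section weighted_weak_type.
Context {R : realType}.
Local Notation mu := (@lebesgue_measure R).
Local Notation L1 f := (mu.-integrable [set: R] (EFin \o f)).
Context {w : R -> R} (mw : measurable_fun [set: R] w).
Context {C : R} (C1 : (1 <= C)%R) (wC : A1_bound mw C).

Let C0 : (0 <= C)%R. Proof. exact: le_trans C1. Qed.

(** [A1_set] for the complement of [E], which fills at least half of the interval and so carries at
    least [(2 C)^-1] of its weight. *)
Lemma A1_half (E : set R) (a b : R) : measurable E -> (a < b)%R ->
  E `<=` `]a, b[ -> mu E <= ((b - a) / 2)%:E ->
  density mw E <= (1 - (2 * C)^-1)%:E * density mw `]a, b[%classic.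
Proof.
move=> mE ab Eab muE.
have mI : measurable (`]a, b[%classic : set R) by exact: measurable_itv.
have mD : measurable (`]a, b[ `\` E) by exact: measurableD.
have nuI : density mw `]a, b[%classic =
    density mw E + density mw (`]a, b[ `\` E).
  by rewrite -measureU// ?setDIK// setDUK.
have finI := A1_fin_num wC a b.
have finE : density mw E \is a fin_num.
  rewrite ge0_fin_numE ?measure_ge0//; apply: le_lt_trans (A1_fin wC a b).
  by apply: le_measure; rewrite ?inE.
have finD : density mw (`]a, b[ `\` E) \is a fin_num.
  rewrite ge0_fin_numE ?measure_ge0//; apply: le_lt_trans (A1_fin wC a b).
  by apply: le_measure; rewrite ?inE.
have muD : ((b - a) / 2)%:E <= mu (`]a, b[ `\` E).
  have : mu `]a, b[%classic <= mu E + mu (`]a, b[ `\` E).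
    rewrite -{1}(setDUK Eab); apply: measureU2 => //.
  rewrite lebesgue_measure_itv/= lte_fin ab -EFinD => h.
  have : (b - a)%:E <= ((b - a) / 2)%:E + mu (`]a, b[ `\` E).
    by apply: (le_trans h); exact: leeD2r.
  by rewrite -leeBlDl// -EFinB (_ : b - a - (b - a) / 2 = (b - a) / 2)%R//; field.
have := A1_set C0 wC mD ab (@subDsetl _ _ _).
move: nuI; rewrite -(fineK finI) -(fineK finE) -(fineK finD).
set I := fine _; set e := fine _; set d := fine _; rewrite -EFinD => -[IE] h.
have {}h : (((b - a) / 2) * I)%:E <= (C * (b - a) * d)%:E.
  rewrite !EFinM; apply: le_trans h; rewrite lee_wpmul2r// lee_fin.
  by rewrite fine_ge0 ?measure_ge0.
move: h; rewrite -EFinM !lee_fin => h.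
have {}h : (I <= 2 * C * d)%R.
  by rewrite -(@ler_pM2l _ ((b - a) / 2)%R); lra.
rewrite mulrBl mul1r lerBrDr -lerBrDl.
rewrite mulrC ler_pdivrMr; last by rewrite mulr_gt0// (lt_le_trans _ C1).
by apply: (le_trans h); rewrite IE; lra.
Qed.

Section test_function.
Context {f : R -> R} (mf : measurable_fun [set: R] f)
  (mfw : measurable_fun [set: R] (f \* w)%R) (A : R).
Hypotheses (intf : L1 f) (A0 : (0 < A)%R)
  (suppf : forall y, ~~ (- A <= y < A)%R -> f y = 0%R).

Let Om (t : R) : set R :=
  [set x | exists2 e, (0 < e)%R & (t < `|htrunc e f x|)%R].
Let N := fine (density mf [set: R]).

Let finf : density mf [set: R] \is a fin_num.
Proof. by rewrite ge0_fin_numE ?measure_ge0//; exact/L1_density. Qed.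

(** At distance [|x| - A] from the support of [f] every truncation is at most [N / (|x| - A)]. *)
Let Om_bounded (t x : R) : (0 < t)%R -> Om t x -> (`|x| <= A + N / t)%R.
Proof.
move=> t0 [e e0 xe]; rewrite leNgt; apply/negP => xA.
have N0 : (0 <= N)%R by rewrite fine_ge0 ?measure_ge0.
have Nt : (0 <= N / t)%R by rewrite divr_ge0// ltW.
have xA0 : (0 < `|x| - A)%R by lra.
move: xe; apply/negP; rewrite -leNgt -lee_fin.
apply: Rintegral_norm_le; first exact: L1_ktrunc.
have mk : measurable_fun [set: R] (fun y => f y * ktrunc e (x - y))%R.
  by apply: measurable_funM => //; exact: measurable_ktrunc.
apply: (@le_trans _ _ (((`|x| - A)^-1)%:E * density mf [set: R])).
  apply: (density_le mk mf) => //; first by rewrite invr_ge0 ltW.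
  move=> y _; have [yA|/suppf ->] := boolP (- A <= y < A)%R; last first.
    by rewrite mul0r normr0 mulr0.
  rewrite normrM mulrC ler_wpM2r//.
  have xy : (`|x| - A <= `|x - y|)%R.
    have := ler_normB x (x - y)%R; rewrite opprB addrC subrK => h.
    have : (`|y| <= A)%R by rewrite ler_norml; case/andP: yA => -> /ltW.
    have := ler_normD (x - y)%R y; rewrite subrK; lra.
  rewrite /ktrunc; case: ifPn => _; last by rewrite normr0 invr_ge0 ltW.
  by rewrite normfV lef_pV2 ?posrE// (lt_le_trans xA0).
rewrite -(fineK finf) -/N -EFinM lee_fin mulrC ler_pdivrMr// mulrC.
by rewrite -ler_pdivrMr// ltW// ltrBrDl.
Qed.

Let Om_open t : open (Om t). Proof. exact: open_hstar_gt. Qed.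

Let Om_measurable t : measurable (Om t).
Proof. exact: open_measurable. Qed.

(** [delta] is both the relative increase of the level and the loss of weight in [A1_half]; since
    [(1 + delta) (1 - delta) < 1], the iteration contracts. [gam] makes [K = gam t] satisfy the
    smallness condition of [good_lambda_local] with equality. *)
Let delta : R := (2 * C)^-1%R.
Let gam : R := (delta / (24 * hstar_const + 40))%R.

Let d0 : (0 < delta)%R.
Proof. by rewrite invr_gt0 mulr_gt0// (lt_le_trans _ C1). Qed.

Let del1 : (delta <= 2^-1)%R.
Proof.
by rewrite lef_pV2 ?posrE// ?mulr_gt0// ?(lt_le_trans _ C1)// ler_peMr.
Qed.

Let gam0 : (0 < gam)%R.
Proof.
rewrite divr_gt0//; have := @hstar_const_gt0 R; move: (hstar_const) => h; lra.
Qed.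

Let foo : density mf [set: R] < +oo.
Proof. by rewrite ltey_eq finf. Qed.

(** Off a cover [G] of the set where the maximal function exceeds [gam t], argue on each component
    of [Om t]. Its left end is outside [Om t], so [good_lambda_local] bounds the Lebesgue measure of
    the bad part by half the length, and [A1_half] converts this into weight. *)
Lemma good_lambda (t : R) : (0 < t)%R ->
  density mw (Om ((1 + delta) * t)) <=
  (1 - delta)%:E * density mw (Om t) +
  (12 * C ^+ 2 / (gam * t))%:E * density mfw [set: R].
Proof.
move=> t0; pose K := (gam * t)%R.
have K0 : (0 < K)%R by rewrite mulr_gt0.
have [G [mG MG nuG]] := maximal_weak C0 wC mfw K0 foo.
have OmS : Om ((1 + delta) * t) `<=` Om t.
  move=> x [e e0 xe]; exists e => //; apply: lt_trans xe.
  by rewrite ltr_pMl// ltrDl.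
pose E := Om ((1 + delta) * t) `\` G.
have mE : measurable E by exact: measurableD.
have OmE : Om ((1 + delta) * t) `<=` E `|` G.
  by move=> x Ox; have [Gx|nGx] := pselect (G x); [right|left].
apply: (@le_trans _ _ (density mw E + density mw G)).
  apply: (@le_trans _ _ (density mw (E `|` G))); last exact: measureU2.
  by apply: le_measure; rewrite ?inE//; exact: measurableU.
apply: leeD => //.
apply: (component_sum (B := (A + N / t)%R)) => //.
- by move=> y; exact: Om_bounded.
- by move=> x [/OmS].
- by rewrite subr_ge0 (le_trans del1)// invf_le1// ler1n.
move=> a b [ab abO nOa nOb].
have mEI : measurable (E `&` `]a, b[%classic).
  by apply: measurableI => //; exact: measurable_itv.
(* A component that meets [E] provides the point [x0] outside [G], where the maximal function is
   small. *)
have [EI0|/set0P[x0 [[Ox0 nGx0]]]] := eqVneq (E `&` `]a, b[%classic) set0.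
  by rewrite EI0 measure0 mule_ge0// lee_fin subr_ge0 (le_trans del1)// invf_le1// ler1n.
rewrite /= in_itv/= => /andP[ax0 x0b].
apply: A1_half => //.
have : covered mu [set x | [/\ (a < x)%R, (x < b)%R &
    exists2 e, (0 < e)%R & ((1 + delta) * t < `|htrunc e f x|)%R]]
    ((b - a) / 2)%:E.
  apply: (good_lambda_local intf A0 suppf ax0 x0b t0 d0 (ltW K0)).
  - by move=> e e0; rewrite leNgt; apply/negP => ea; apply: nOa; exists e.
  - move=> r r0; rewrite leNgt; apply/negP => xr; apply: nGx0; apply: MG.
    by exists r.
  - have := @hstar_const_gt0 R; rewrite /K /gam; move: (hstar_const) => h h0.
    rewrite le_eqVlt; apply/orP; left; apply/eqP; field; lra.
move=> /(covered_sub (m := mu) (E := E `&` `]a, b[%classic)) h.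
apply: (covered_measurable (m := lebesgue_measure) mEI); apply: h => //.
by move=> x [[Ox _]]; rewrite /= in_itv/= => /andP[].
Qed.

Let fin_Om t : (0 < t)%R -> density mw (Om t) \is a fin_num.
Proof.
move=> t0; rewrite ge0_fin_numE ?measure_ge0//.
apply: le_lt_trans (A1_fin wC (- (A + N / t + 1)) (A + N / t + 1)%R).
apply: le_measure; rewrite ?inE; [exact: Om_measurable|exact: measurable_itv|].
move=> x /(Om_bounded t0); rewrite ler_norml => /andP[? ?].
by rewrite /= in_itv/=; apply/andP; split; lra.
Qed.

(** The a priori bound needed by the iteration: [Om t] lies in an interval of radius
    [A + N / t + 1], whose weight is at most linear in its length by the A1 bound at one fixed point
    [z]. *)
Let Om_small (t0 : R) : (0 < t0)%R ->
  exists2 B, (0 <= B)%R & forall t, (0 < t)%R -> (t <= t0)%R ->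
    (t%:E * density mw (Om t) <= B%:E).
Proof.
move=> t00.
have [z [z1 z2 Hz]] := ae_itv_exists wC (@ltr01 R).
have N0 : (0 <= N)%R by rewrite fine_ge0 ?measure_ge0.
exists (C * (2 * (t0 * (A + 1) + N)) * `|w z|)%R.
  by rewrite !(mulr_ge0, addr_ge0)// ltW.
move=> t tpos tt0; pose r := (A + N / t + 1)%R.
have Nt : (0 <= N / t)%R by rewrite divr_ge0// ltW.
have : density mw (Om t) <= density mw `](- r)%R, r[%classic.
  apply: le_measure; rewrite ?inE; [exact: Om_measurable|exact: measurable_itv|].
  move=> x /(Om_bounded tpos); rewrite ler_norml /r => /andP[? ?].
  by rewrite /= in_itv/=; apply/andP; split; lra.
have r1 : (1 <= r)%R by rewrite /r lerDr addr_ge0// ltW.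
have rz1 : (- r < z)%R by lra.
have rz2 : (z < r)%R by lra.
move=> /le_trans/(_ (Hz _ _ rz1 rz2)) h.
apply: (@le_trans _ _ (t%:E * (C * (r - - r) * `|w z|)%:E)).
  by rewrite lee_wpmul2l// lee_fin ltW.
rewrite -EFinM lee_fin.
have tr : (t * r <= t0 * (A + 1) + N)%R.
  have -> : (t * r = t * (A + 1) + N)%R by rewrite /r; field; rewrite gt_eqF.
  by rewrite lerD2r ler_wpM2r// addr_ge0// ltW.
have -> : (t * (C * (r - - r) * `|w z|) = C * (2 * (t * r)) * `|w z|)%R by ring.
by rewrite ler_wpM2r// ler_wpM2l// ler_wpM2l.
Qed.

(** With [Phi s = s phi s], [good_lambda] reads [Phi ((1 + delta) s) <= (1 - delta ^ 2) Phi s +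
    const]. Going down from [t] sums a geometric series, hence the division by [delta ^ 2]; the
    remainder tends to 0 because [Phi] is bounded on []0, t]] by [Om_small]. *)
Lemma weighted_weak_compact (t : R) : (0 < t)%R ->
  density mw (Om t) <=
    ((1 + delta) * (12 * C ^+ 2 / gam) / delta ^+ 2 / t)%:E *
    density mfw [set: R].
Proof.
move=> t0; pose D := (12 * C ^+ 2 / gam)%R.
have C0' : (0 < C)%R by exact: lt_le_trans C1.
have D0 : (0 < D)%R by rewrite divr_gt0// mulr_gt0// exprn_gt0.
have k1 : (0 < 1 + delta)%R by rewrite addr_gt0.
have kD : (0 < (1 + delta) * D / delta ^+ 2 / t)%R.
  by rewrite divr_gt0// divr_gt0 ?exprn_gt0// mulr_gt0.
have [->|Moo] := eqVneq (density mfw [set: R]) +oo.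
  by rewrite gt0_muley ?leey// lte_fin.
have Mfin : density mfw [set: R] \is a fin_num.
  by rewrite ge0_fin_numE ?measure_ge0// lt_neqAle Moo leey.
pose M := fine (density mfw [set: R]).
have M0 : (0 <= M)%R by rewrite fine_ge0 ?measure_ge0.
pose phi s := fine (density mw (Om s)).
have phiE s : (0 < s)%R -> density mw (Om s) = (phi s)%:E.
  by move=> s0; rewrite fineK// fin_Om.
have step s : (0 < s)%R ->
    ((1 + delta) * s * phi ((1 + delta) * s) <=
     (1 - delta ^+ 2) * (s * phi s) + (1 + delta) * D * M)%R.
  move=> s0; have := good_lambda s0.
  rewrite !phiE ?mulr_gt0// -(fineK Mfin) -/M -!EFinM -EFinD lee_fin.
  have -> : (12 * C ^+ 2 / (gam * s) = D / s)%R by rewrite /D; field; rewrite !gt_eqF.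
  rewrite -(@ler_pM2l _ ((1 + delta) * s)%R) ?mulr_gt0// => /le_trans; apply.
  by rewrite le_eqVlt; apply/orP; left; apply/eqP; field; rewrite gt_eqF.
have [B B0 HB] := Om_small t0.
pose s n := (t / (1 + delta) ^+ n)%R.
have s0 n : (0 < s n)%R by rewrite divr_gt0// exprn_gt0.
have th0 : (0 <= 1 - delta ^+ 2)%R.
  have dd : (delta <= 1)%R by rewrite (le_trans del1)// invf_le1// ler1n.
  by rewrite subr_ge0 exprn_ile1// ltW.
have iter_step n : (t * phi t <= (1 - delta ^+ 2) ^+ n * (s n * phi (s n)) +
    (1 + delta) * D * M / delta ^+ 2 * (1 - (1 - delta ^+ 2) ^+ n))%R.
  elim: n => [|n IH]; first by rewrite /s !expr0 subrr mulr0 addr0 divr1 mul1r.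
  apply: (le_trans IH).
  have sS : (s n = (1 + delta) * s n.+1)%R.
    by rewrite /s (exprS _ n); field; rewrite expf_neq0 ?gt_eqF.
  have := step _ (s0 n.+1); rewrite -sS.
  have := exprn_ge0 n th0; rewrite (exprS _ n).
  move: ((1 - delta ^+ 2) ^+ n)%R => q q0 h.
  have := ler_wpM2l q0 h.
  have -> : ((1 + delta) * D * M / delta ^+ 2 * (1 - q) =
    (1 + delta) * D * M / delta ^+ 2 * (1 - (1 - delta ^+ 2) * q) -
    q * ((1 + delta) * D * M))%R by field; rewrite gt_eqF.
  by rewrite [X in (_ <= X)%R -> _]mulrDr; lra.
have small n : (s n * phi (s n) <= B)%R.
  rewrite -lee_fin EFinM -phiE//; apply: HB => //.
  by rewrite ler_pdivrMr ?exprn_gt0// ler_peMr ?(ltW t0)// exprn_ege1// lerDl ltW.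
have key : (t * phi t <= (1 + delta) * D * M / delta ^+ 2)%R.
  apply/ler_addgt0Pl => e e0.
  have : ((1 - delta ^+ 2) ^+ n)%R @[n --> \oo] --> (0%R : R).
    by apply: cvg_expr; rewrite ger0_norm// gtrBl exprn_gt0.
  move=> /cvgrPdist_lt/(_ (e / (B + 1))%R); rewrite divr_gt0 ?ltr_wpDl//.
  move=> /(_ isT)[n _ /(_ n (leqnn n))] /=.
  rewrite sub0r normrN ger0_norm ?exprn_ge0// => qn.
  apply: (le_trans (iter_step n)); apply: lerD.
    apply: (@le_trans _ _ ((1 - delta ^+ 2) ^+ n * B)%R).
      by rewrite ler_wpM2l ?exprn_ge0.
    move: qn; rewrite ltr_pdivlMr ?ltr_wpDl//; have := exprn_ge0 n th0.
    by move: ((1 - delta ^+ 2) ^+ n)%R => q; nra.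
  have T0 : (0 <= (1 + delta) * D * M / delta ^+ 2)%R.
    apply: divr_ge0; last exact: exprn_ge0 (ltW d0).
    by apply: mulr_ge0 => //; apply: mulr_ge0; exact: ltW.
  apply: ler_piMr => //.
  by rewrite gerBl exprn_ge0.
rewrite phiE// -(fineK Mfin) -/M -EFinM lee_fin -(@ler_pM2l _ t)//.
apply: (le_trans key); rewrite le_eqVlt; apply/orP; left; apply/eqP.
by rewrite /D; field; rewrite !gt_eqF.
Qed.

End test_function.

End weighted_weak_type.

(** * Cancellation in the kernel *)

Section cancellation.
Context {R : realType}.
Local Notation mu := (@lebesgue_measure R).
Local Notation L1 f := (mu.-integrable [set: R] (EFin \o f)).
Implicit Types f g h k : R -> R.

Lemma integral_inv_reflect (x e e' : R) : (0 < e)%R -> (e <= e')%R ->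
  \int[mu]_(y in `[(x - e')%R, (x - e)%R]) ((x - y)^-1)%:E =
  \int[mu]_(y in `[(x + e)%R, (x + e')%R]) ((y - x)^-1)%:E.
Proof.
move=> e0 ee'.
pose F y : R := (x + x - y)%R.
have dF y : derivable F y 1 by apply: derivableB.
have F'E : F^`()%classic = cst (-1)%R.
  apply/funext => z; rewrite derive1E /F deriveB//.
  by rewrite derive_cst derive_id sub0r.
have cF : continuous F by move=> y; apply: cvgB; [exact: cvg_cst|exact: cvg_id].
have := @integration_by_substitution_decreasing R F (fun y => (x - y)^-1)%R
  (x + e)%R (x + e')%R.
rewrite F'E lerD2l => /(_ ee').
have -> : F (x + e')%R = (x - e')%R by rewrite /F; ring.
have -> : F (x + e)%R = (x - e)%R by rewrite /F; ring.
move=> ->.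
- apply: eq_integral => y _ /=; congr EFin; rewrite /F opprK mulr1.
  by congr (_^-1)%R; ring.
- by move=> ? ? _ _; rewrite /F ltrD2l ltrN2.
- by move=> ? _; exact: cvg_cst.
- exact: is_cvg_cst.
- exact: is_cvg_cst.
- by split; [move=> y _; exact: dF|exact/cvg_at_right_filter/cF|exact/cvg_at_left_filter/cF].
- apply: continuous_in_subspaceT => y; rewrite inE/= in_itv/= => /andP[_ yx].
  apply: cvgV; first by rewrite gt_eqF//; lra.
  by apply: cvgB; [exact: cvg_cst|exact: cvg_id].
Qed.

(** The difference is [1 / (x - y)] on two intervals exchanged by the reflection about [x], under
    which it is odd. *)
Lemma ktruncB_integral0 (x e e' : R) : (0 < e)%R -> (e <= e')%R ->
  (\int[mu]_y (ktrunc e (x - y) - ktrunc e' (x - y)) = 0)%R.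
Proof.
move=> e0 ee'; have e'0 : (0 < e')%R by exact: lt_le_trans ee'.
pose A : set R := `[(x - e')%R, (x - e)%R[%classic.
pose B : set R := `](x + e)%R, (x + e')%R]%classic.
have AB : [disjoint A & B].
  apply/disj_setPS => y []; rewrite /A /B/= !in_itv/= => /andP[_ h1] /andP[h2 _].
  by lra.
have mA : measurable A by exact: measurable_itv.
have mB : measurable B by exact: measurable_itv.
have E y : (ktrunc e (x - y) - ktrunc e' (x - y) =
    ((fun y => (x - y)^-1) \_ (A `|` B)) y)%R.
  rewrite patchE /ktrunc.
  have -> : (y \in A `|` B) = (e < `|x - y|)%R && (`|x - y| <= e')%R.
    rewrite in_setU /A /B !mem_setE !in_itv/=.
    have [yx|xy] := leP y x.
      rewrite (@ger0_norm _ (x - y)%R) ?subr_ge0//.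
      by apply/idP/idP => [/orP[/andP[h1 h2]|/andP[h1 h2]]|/andP[h1 h2]];
        [apply/andP; split|exfalso|apply/orP; left; apply/andP; split]; lra.
    rewrite distrC (@ger0_norm _ (y - x)%R) ?subr_ge0 ?(ltW xy)//.
    by apply/idP/idP => [/orP[/andP[h1 h2]|/andP[h1 h2]]|/andP[h1 h2]];
      [exfalso|apply/andP; split|apply/orP; right; apply/andP; split]; lra.
  case: (ltP e `|x - y|%R) => h1; case: (leP `|x - y|%R e') => h2 //=.
  - by rewrite subr0.
  - by rewrite subrr.
  - by rewrite subrr.
  - by have := lt_le_trans h2 h1; lra.
have mAB : measurable (A `|` B) by exact: measurableU.
have iAB : mu.-integrable (A `|` B) (EFin \o (fun y => (x - y)^-1)%R).
  apply: (@eq_integrable _ _ _ mu _ mAB (EFin \o (fun y => ktrunc e (x - y)))).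
    move=> y; rewrite inE => ABy /=; congr EFin; rewrite /ktrunc ifT//.
    move: ABy; rewrite /A /B => -[]/=; rewrite in_itv/= => /andP[h1 h2].
      by rewrite ger0_norm; lra.
    by rewrite distrC ger0_norm; lra.
  apply: measurable_bounded_integrable => //.
  - apply: (@le_lt_trans _ _ (mu A + mu B)); first exact: measureU2.
    rewrite lte_add_pinfty// /A /B lebesgue_measure_itv/= lte_fin;
      by case: ifPn => _; rewrite ?ltry// -EFinD ltry.
  - by apply: measurable_funTS; exact: measurable_ktrunc.
  - exists e^-1%R; split; first exact: num_real.
    by move=> M eM y _; apply: le_trans (ltW eM); exact: ktrunc_le.
under eq_Rintegral do rewrite E.
rewrite -Rintegral_mkcond Rintegral_setU//.
have iA : mu.-integrable A (EFin \o (fun y => (x - y)^-1)%R).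
  by apply: integrableS iAB => //; exact: subsetUl.
have iB : mu.-integrable B (EFin \o (fun y => (x - y)^-1)%R).
  by apply: integrableS iAB => //; exact: subsetUr.
have -> : (\int[mu]_(y in B) (x - y)^-1 = - \int[mu]_(y in B) (y - x)^-1)%R.
  rewrite -mulN1r -RintegralZl//; last first.
    have := integrableN iB; apply: eq_integrable => // y _ /=.
    by rewrite -invrN opprB.
  by apply: eq_Rintegral => y _; rewrite mulN1r -invrN opprB.
apply/eqP; rewrite subr_eq0; apply/eqP.
rewrite /A /B Rintegral_itv_bndo_bndc// Rintegral_itv_obnd_cbnd; last first.
  have := integrableN iB; apply: eq_integrable => // y _ /=.
  by rewrite -invrN opprB.
by rewrite /Rintegral integral_inv_reflect.
Qed.

(** Two truncations at small radii differ by an integral near [x], where [g] is the constant [g x],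
    against a kernel of integral zero. *)
Lemma htrunc_near_cst (g : R -> R) (x : R) : L1 g -> (\forall y \near x, g y = g x) ->
  exists2 d, (0 < d)%R & forall e e', (0 < e < d)%R -> (0 < e' < d)%R ->
    htrunc e g x = htrunc e' g x.
Proof.
move=> intg [d d0 dg]; exists d => //.
suff wl e e' : (0 < e)%R -> (e <= e')%R -> (e' < d)%R ->
    htrunc e g x = htrunc e' g x.
  move=> e e' /andP[e0 ed] /andP[e'0 e'd].
  by have [ee'|/ltW ee'] := leP e e'; [exact: wl|symmetry; exact: wl].
move=> e0 ee' e'd; have e'0 : (0 < e')%R by exact: lt_le_trans ee'.
apply/eqP; rewrite -subr_eq0; apply/eqP.
rewrite /htrunc -RintegralB//; [|exact: L1_ktrunc..].
have E y : (g y * ktrunc e (x - y) - g y * ktrunc e' (x - y) =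
    g x * (ktrunc e (x - y) - ktrunc e' (x - y)))%R.
  rewrite -mulrBr; have [xyd|dxy] := ltP `|x - y|%R d.
    by rewrite dg// /ball/=.
  by rewrite /ktrunc !ifT ?subrr ?mulr0//; lra.
under eq_Rintegral do rewrite E.
(* Below, integrability of the difference of kernels is recovered by dividing by [g x], so the value
   0 is treated apart. *)
have [gx0|gx0] := eqVneq (g x) 0%R.
  by under eq_Rintegral do rewrite gx0 mul0r; rewrite Rintegral_cst// mul0r.
rewrite RintegralZl ?ktruncB_integral0 ?mulr0//.
have : L1 (fun y => (g x)^-1 * (g x * (ktrunc e (x - y) - ktrunc e' (x - y))))%R.
  apply: L1Z.
  have := integrableB measurableT (L1_ktrunc x e0 intg) (L1_ktrunc x e'0 intg).
  by apply: eq_integrable => // y _ /=; rewrite -EFinB E.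
by apply: eq_integrable => // y _ /=; rewrite mulKf.
Qed.

End cancellation.

(** * Almost everywhere convergence for compact support *)

Section ae_existence.
Context {R : realType}.
Local Notation mu := (@lebesgue_measure R).
Local Notation L1 f := (mu.-integrable [set: R] (EFin \o f)).
Implicit Types f g : R -> R.

Lemma covered_negligible (E : set R) :
  (forall c : R, (0 < c)%R -> covered mu E c%:E) ->
  exists N, [/\ measurable N, mu N = 0 & E `<=` N].
Proof.
move=> cE.
have /choice[A A_] : forall n : nat, exists A : set R,
    [/\ measurable A, E `<=` A & mu A <= (n.+1%:R^-1)%:E].
  by move=> n; apply: cE; rewrite invr_gt0.
have mA n : measurable (A n) by have [] := A_ n.
exists (\bigcap_n A n); split; first exact: bigcapT_measurable.
- apply/eqP; rewrite eq_le measure_ge0 andbT.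
  apply/lee_addgt0Pr => e e0; rewrite add0e.
  have [n ne] : exists n : nat, (n.+1%:R^-1 < e)%R.
    exists (Num.truncn e^-1); rewrite -[ltRHS]invrK ltf_pV2 ?posrE ?invr_gt0//.
    exact: Num.Theory.truncnS_gt.
  apply: (@le_trans _ _ (mu (A n))).
    apply: le_measure; rewrite ?inE; [exact: bigcapT_measurable|exact: mA|].
    exact: bigcap_inf.
  have [_ _ /le_trans] := A_ n; apply.
  by rewrite lee_fin ltW.
- by move=> x Ex n _; have [_ + _] := A_ n; apply.
Qed.

Lemma cvge_lt_exists (u : nat -> \bar R) (e : R) : (0 < e)%R ->
  u n @[n --> \oo] --> 0 -> exists n, u n < e%:E.
Proof.
move=> e0 u0.
have : nbhs (0 : \bar R) [set x | x < e%:E].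
  by apply: open_nbhs_nbhs; split; [exact: open_ereal_lt_ereal|rewrite /= lte_fin].
by move=> /u0[n _ /(_ n (leqnn n))] h; exists n.
Qed.

(** Approximate [f] in L1 by a continuous [G], then [G] by its samples on finer and finer grids,
    using dominated convergence. *)
Lemma step_approx f (A eta : R) : L1 f -> (0 < A)%R -> (0 < eta)%R ->
  (forall y, ~~ (- A <= y < A)%R -> f y = 0%R) ->
  exists g, [/\ L1 g, forall y, ~~ (- A <= y < A)%R -> g y = 0%R,
    {ae mu, forall x, \forall y \near x, g y = g x} &
    \int[mu]_y `|f y - g y|%:E < eta%:E].
Proof.
move=> intf A0 eta0 suppf.
pose E : set R := `[(- A)%R, A[%classic.
have mE : measurable E by exact: measurable_itv.
have muE : mu E < +oo.
  by rewrite /E lebesgue_measure_itv/= lte_fin; case: ifPn => _; rewrite -?EFinD ltry.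
have intfE : mu.-integrable E (EFin \o f) by exact: integrableS intf.
have [G_ [cG_ iG_ fG_]] := approximation_continuous_integrable mE muE intfE.
have e2 : (0 < eta / 2)%R by rewrite divr_gt0.
have [G [cG iG fG]] : exists G : R -> R, [/\ continuous G,
    mu.-integrable E (EFin \o G) & \int[mu]_(z in E) `|(f z - G z)%:E| < (eta / 2)%:E].
  by have [N h] := cvge_lt_exists e2 fG_; exists (G_ N).
have mG : measurable_fun [set: R] G by exact: continuous_measurable_fun.
pose h n : R := (2 * A / n.+1%:R)%R.
have h0 n : (0 < h n)%R by rewrite divr_gt0// mulr_gt0.
have hA n : (- A + n.+1%:R * h n = A)%R by rewrite /h mulrCA mulfV// mulr1; ring.
pose s n := gridfun (- A) (h n) n G.
pose GE := (G \* \1_E)%R.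
have EP y : (- A <= y < A)%R = (y \in E) by rewrite /E; apply/idP/idP; rewrite inE/= in_itv.
have sout n y : ~~ (- A <= y < A)%R -> s n y = 0%R.
  by move=> yA; apply: gridfun_out => //; rewrite hA.
have [M M0 GM] : exists2 M, (0 <= M)%R & forall y, (- A <= y <= A)%R -> (`|G y| <= M)%R.
  have AA : (- A <= A)%R by lra.
  have cGn : {within `[(- A)%R, A], continuous (fun y => `|G y|%R)}.
    by apply: continuous_subspaceT => y; apply: cvg_norm; exact: cG.
  have [c cA cmax] := EVT_max AA cGn.
  by exists `|G c|%R => // y yA; apply: cmax; rewrite in_itv.
have sGE : {ae mu, forall x, s n x @[n --> \oo] --> GE x}.
  apply: aeW => y; rewrite /GE/= indicE.
  have [yE|yE] := boolP (y \in E); last first.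
    rewrite mulr0; apply: cvg_near_cst; near=> n.
    by apply: sout; rewrite EP.
  rewrite mulr1; have := yE; rewrite -EP => /andP[Ay yA].
  have /choice[b bP] : forall n, exists b, [/\ (b <= y)%R, (y < b + h n)%R & s n y = G b].
    move=> n; have [|b [_ b1 b2 b3]] := gridfun_cell (h0 n) G (n := n) Ay.
      by rewrite hA.
    by exists b.
  rewrite (_ : (fun n => s n y) = G \o b); last by apply/funext => n; have [] := bP n.
  apply: (@cvg_comp _ _ _ b G _ (nbhs y)); last exact: cG.
  apply: (@squeeze_cvgr _ _ _ _ (fun n => y - h n)%R (cst y)).
  - near=> n; have [b1 b2 _] := bP n; rewrite b1 andbT; lra.
  - rewrite -[X in _ --> X]subr0; apply: cvgB; first exact: cvg_cst.
    rewrite -(mulr0 (2 * A)%R); apply: cvgM; first exact: cvg_cst.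
    exact: cvg_harmonic.
  - exact: cvg_cst.
have L1M1 : L1 (fun y => M * \1_E y)%R.
  apply: L1Z; have m1E : measurable_fun [set: R] (\1_E : R -> R) by exact: measurable_indic.
  by apply/(L1_density m1E); rewrite density_indic// setIT.
have ms n : measurable_fun [set: R] (s n) by exact: measurable_gridfun.
have m1E : measurable_fun [set: R] (\1_E : R -> R) by exact: measurable_indic.
have sM n y : (`|s n y| <= M * \1_E y)%R.
  rewrite indicE -EP; have [|/sout ->] := boolP (- A <= y < A)%R; last by rewrite normr0 mulr0.
  move=> /andP[Ay yA]; rewrite mulr1.
  have [|b [b0 b1 _ bE]] := gridfun_cell (h0 n) G (n := n) Ay; first by rewrite hA.
  rewrite /s bE.
  by apply: GM; rewrite b0 (le_trans b1)// ltW.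
have mGE : measurable_fun [set: R] GE by exact: measurable_funM.
have [_ c0] := Rintegral_dominated ms mGE L1M1 sM sGE.
have [n c0n] := cvge_lt_exists e2 c0.
exists (s n); split.
- apply: (L1_le (ms n) L1M1) => y; apply: (le_trans (sM n y)).
  exact: ler_norm.
- exact: sout.
- exact: gridfun_near_cst.
have fGE : \int[mu]_y `|f y - GE y|%:E < (eta / 2)%:E.
  apply: le_lt_trans fG; rewrite [leRHS]integral_mkcond le_eqVlt.
  apply/orP; left; apply/eqP; apply: eq_integral => y _.
  rewrite patchE /GE/= indicE -EP; have [|/suppf ->] := boolP (- A <= y < A)%R.
    by rewrite mulr1.
  by rewrite mulr0 subrr normr0.
have mf := L1_measurable intf.
have m1 : measurable_fun [set: R] (fun y => `|f y - GE y|%:E).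
  by apply: measurable_norm_EFin; exact: measurable_funB.
have m2 : measurable_fun [set: R] (fun y => `|s n y - GE y|%:E).
  by apply: measurable_norm_EFin; exact: measurable_funB.
rewrite (splitr eta) EFinD; apply: le_lt_trans (lteD fGE c0n).
rewrite -ge0_integralD//; apply: ge0_le_integral => //.
- by apply: measurable_norm_EFin; exact: measurable_funB.
- exact: emeasurable_funD.
- move=> y _; rewrite -EFinD lee_fin (distrC (s n y)).
  by rewrite (le_trans _ (ler_normD _ _))// addrA subrK.
Unshelve. all: by end_near. Qed.

End ae_existence.

Section ae_existence_compact.
Context {R : realType}.
Local Notation mu := (@lebesgue_measure R).
Local Notation L1 f := (mu.-integrable [set: R] (EFin \o f)).
Implicit Types f g : R -> R.

Let osc_le f (x eps : R) := exists2 d : R, (0 < d)%R &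
  forall e e', (0 < e < d)%R -> (0 < e' < d)%R ->
    (`|htrunc e f x - htrunc e' f x| <= eps)%R.

(** Write [f = g + (f - g)] with [g] a step function close to [f] in L1. Truncations of [g] are
    stationary off a null set, and those of [f - g] are at most [eps / 2] off a set made small by
    [hstar_weak]. *)
Let osc_covered f (A eps c : R) : L1 f -> (0 < A)%R -> (0 < eps)%R -> (0 < c)%R ->
  (forall y, ~~ (- A <= y < A)%R -> f y = 0%R) ->
  covered mu [set x | ~ osc_le f x eps] c%:E.
Proof.
move=> intf A0 eps0 c0 suppf; pose t := (eps / 2)%R.
have t0 : (0 < t)%R by rewrite divr_gt0.
have hc0 := @hstar_const_gt0 R.
(* With this L1 error the bound of [hstar_weak] at level [t] is [c]. *)
have eta0 : (0 < c / (hstar_const / t))%R by rewrite !divr_gt0.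
have [g [intg suppg [N [mN N0 gN]] fg]] := step_approx intf A0 eta0 suppf.
have intfg : L1 (f \- g)%R.
  have := integrableB measurableT intf intg.
  by apply: eq_integrable => // y _; rewrite /= EFinB.
have mfg := L1_measurable intfg.
have suppfg y : ~~ (- A <= y < A)%R -> (f \- g)%R y = 0%R.
  by move=> yA; rewrite /= suppf// suppg// subrr.
have cN : covered mu N 0 by exists N; split => //; rewrite N0.
have := coveredU (m := lebesgue_measure) cN (hstar_weak mfg intfg A0 t0 suppfg).
rewrite add0e; apply: covered_sub; last first.
  apply: (@le_trans _ _ ((hstar_const / t)%:E * (c / (hstar_const / t))%:E)).
    by rewrite lee_wpmul2l ?lee_fin ?divr_ge0 ?(ltW t0) ?(ltW hc0)// ltW.
  by rewrite -EFinM lee_fin mulrC divfK// gt_eqF// divr_gt0.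
move=> x nosc; have [Nx|nNx] := pselect (N x); [by left|right].
have gx : \forall y \near x, g y = g x by apply: contrapT => ng; exact/nNx/gN.
have [d d0 gd] := htrunc_near_cst intg gx.
apply: contrapT => nx; apply: nosc; exists d => // e e' ed e'd.
have small s : (0 < s)%R -> (`|htrunc s f x - htrunc s g x| <= t)%R.
  move=> s0; rewrite -htruncB// leNgt; apply/negP => xs; apply: nx.
  by exists s.
have := gd _ _ ed e'd.
have := small _ (andP ed).1; have := small _ (andP e'd).1; rewrite /t.
move: (htrunc e f x) (htrunc e' f x) (htrunc e g x) (htrunc e' g x).
by move=> X Y Z W; rewrite !ler_norml => /andP[? ?] /andP[? ?] ?; apply/andP; split; lra.
Qed.

(** Off a countable union of null sets the oscillation near 0 is at most [1 / k.+1] for every [k],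
    which is the Cauchy criterion. *)
Lemma htrunc_cvg_compact f (A : R) : L1 f -> (0 < A)%R ->
  (forall y, ~~ (- A <= y < A)%R -> f y = 0%R) ->
  {ae mu, forall x, cvg (htrunc e f x @[e --> (0 : R)^'+])}.
Proof.
move=> intf A0 suppf.
have /choice[N N_] : forall k : nat, exists N, [/\ measurable N, mu N = 0 &
    [set x | ~ osc_le f x k.+1%:R^-1] `<=` N].
  move=> k; apply: covered_negligible => c c0.
  by apply: osc_covered suppf => //; rewrite invr_gt0.
exists (\bigcup_k N k); split.
- by apply: bigcup_measurable => k _; have [] := N_ k.
- apply/eqP; rewrite eq_le measure_ge0 andbT.
  have mN k : measurable (N k) by have [] := N_ k.
  apply: (@le_trans _ _ (\sum_(k <oo) mu (N k))).
    by apply: measure_sigma_subadditive => //; exact: bigcup_measurable.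
  by rewrite eseries0// => k _ _; have [_ ->] := N_ k.
move=> x; apply: contra_notP => nN; apply/cauchy_cvgP/cauchy_exP => eps eps0.
have [k keps] : exists k : nat, (k.+1%:R^-1 < eps)%R.
  exists (Num.truncn eps^-1); rewrite -[ltRHS]invrK ltf_pV2 ?posrE ?invr_gt0//.
  exact: Num.Theory.truncnS_gt.
have [d d0 od] : osc_le f x k.+1%:R^-1.
  by apply: contrapT => no; apply: nN; exists k => //; have [_ _] := N_ k; apply.
exists (htrunc (d / 2) f x).
suff : \forall e \near (0 : R)^'+, ball (htrunc (d / 2) f x) eps (htrunc e f x) by [].
near=> e.
rewrite -ball_normE/=; apply: le_lt_trans keps; apply: od.
  by apply/andP; split; lra.
by apply/andP; split; near: e; [exact: nbhs_right_gt|exact: nbhs_right_lt].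
Unshelve. all: by end_near. Qed.

End ae_existence_compact.

(** * Extension to all functions integrable against the weight *)

Section weighted.
Context {R : realType}.
Local Notation mu := (@lebesgue_measure R).
Local Notation L1 f := (mu.-integrable [set: R] (EFin \o f)).
Context {w : R -> R} (mw : measurable_fun [set: R] w).
Context {C : R} (C1 : (1 <= C)%R) (wC : A1_bound mw C).
Hypothesis w0 : {ae mu, forall x, (0 < `|w x|)%R}.
Let C0 : (0 <= C)%R. Proof. exact: le_trans C1. Qed.

Section function.
Context {f : R -> R} (mf : measurable_fun [set: R] f)
  (mfw : measurable_fun [set: R] (f \* w)%R).
Hypothesis ffin : density mfw [set: R] < +oo.

(** By [A1_lower] the truncated kernel is bounded by a multiple of [|w y|]. *)
Lemma A1_L1_ktrunc (e x : R) : (0 < e)%R -> L1 (fun y => f y * ktrunc e (x - y))%R.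
Proof.
move=> e0; have [c c0 Hc] := A1_lower C0 wC w0.
have mk : measurable_fun [set: R] (fun y => f y * ktrunc e (x - y))%R.
  by apply: measurable_funM => //; exact: measurable_ktrunc.
apply/(L1_density mk).
(* Chosen so that [1 + |y| <= M |x - y|] as soon as [|x - y| > e]. *)
pose M := ((1 + `|x|) / e + 1)%R.
have M0 : (0 <= M)%R by rewrite addr_ge0// divr_ge0 ?addr_ge0// ltW.
apply: (@le_lt_trans _ _ ((M / c)%:E * density mfw [set: R])); last first.
  by rewrite lte_mul_pinfty// lee_fin divr_ge0// ltW.
rewrite /density -ge0_integralZl//; last 2 first.
- exact: measurable_norm_EFin.
- by rewrite lee_fin divr_ge0// ltW.
apply: ae_ge0_le_integral => //.
- exact: measurable_norm_EFin.
- by move=> y _; rewrite mule_ge0// lee_fin divr_ge0// ltW.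
- by apply: emeasurable_funM => //; exact: measurable_norm_EFin.
apply: lebesgue_aeS Hc => y cy _; rewrite -EFinM lee_fin.
rewrite !normrM mulrCA ler_wpM2l// mulrAC ler_pdivlMr//.
rewrite /ktrunc; case: ifPn => xy; last first.
  by rewrite normr0 mul0r mulr_ge0.
have xy0 : (0 < `|x - y|)%R by exact: lt_trans xy.
rewrite normfV ler_pdivrMl//; apply: (le_trans cy).
rewrite mulrA ler_wpM2r//.
have yx : (`|y| <= `|x| + `|x - y|)%R.
  by have := ler_normB x (x - y)%R; rewrite opprB addrC subrK.
have : ((1 + `|x|) <= (1 + `|x|) / e * `|x - y|)%R.
  rewrite mulrAC ler_pdivlMr// ler_wpM2l ?addr_ge0// ltW//.
by rewrite /M mulrDr mulr1 mulrC; lra.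
Qed.

Let trunc (n : nat) : R -> R := (f \* \1_(`[(- n.+1%:R)%R, n.+1%:R[%classic : set R))%R.

Let m1 (n : nat) : measurable_fun [set: R]
  (\1_(`[(- n.+1%:R)%R, n.+1%:R[%classic : set R) : R -> R).
Proof. by apply: measurable_indic; exact: measurable_itv. Qed.

Let mtrunc n : measurable_fun [set: R] (trunc n).
Proof. exact: measurable_funM. Qed.

Let trunc_out n y : ~~ (- n.+1%:R <= y < n.+1%:R)%R -> trunc n y = 0%R.
Proof.
by move=> ny; rewrite /trunc/= indicE memNset ?mulr0// /= in_itv/=; exact/negP.
Qed.

Let trunc_in n y : (- n.+1%:R <= y < n.+1%:R)%R -> trunc n y = f y.
Proof. by move=> ny; rewrite /trunc/= indicE mem_set ?mulr1. Qed.

Let trunc_le n y : (`|trunc n y| <= `|f y|)%R.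
Proof.
have [/trunc_in ->//|/trunc_out ->] := boolP (- n.+1%:R <= y < n.+1%:R)%R.
by rewrite normr0.
Qed.

(** [A1_avg] on a slightly larger interval: the integral of [|f|] times a positive weight is bounded
    by a finite quantity. *)
Let trunc_L1 n : L1 (trunc n).
Proof.
apply/(L1_density (mtrunc n)).
pose a := (- (n.+1%:R + 1) : R)%R; pose b := (n.+1%:R + 1 : R)%R.
have ab : (a < b)%R.
  by rewrite /a /b gtrN// addr_gt0.
have nu0 := density_gt0 mw w0 ab.
have nuoo := A1_fin_num wC a b.
have h := A1_avg C0 wC mf mfw ab.
have fab : density mf `]a, b[%classic < +oo.
  rewrite ltNge leye_eq; apply/negP => /eqP foo.
  move: h; rewrite foo gt0_mulye// leye_eq => /eqP h.
  have : (C * (b - a))%:E * density mfw `]a, b[%classic < +oo.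
    rewrite lte_mul_pinfty// ?lee_fin ?mulr_ge0 ?subr_ge0 ?(ltW ab)//.
    apply: le_lt_trans ffin; apply: le_measure; rewrite ?inE//.
  by rewrite h ltxx.
apply: le_lt_trans fab; rewrite /density [leRHS]integral_mkcond.
apply: ge0_le_integral => //.
- exact: measurable_norm_EFin.
- by apply/(measurable_restrictT _ _).1 => //; exact: measurable_norm_EFin.
move=> y _; have [yn|/trunc_out ->] := boolP (- n.+1%:R <= y < n.+1%:R)%R.
  rewrite trunc_in// patchE mem_set//= in_itv/= /a /b.
  by case/andP: yn => ? ?; apply/andP; split; lra.
by rewrite normr0; apply: erestrict_ge0.
Qed.

Let htrunc_trunc_cvg (e x : R) : (0 < e)%R ->
  htrunc e (trunc n) x @[n --> \oo] --> htrunc e f x.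
Proof.
move=> e0.
apply: (Rintegral_dominated (g := fun y => `|f y * ktrunc e (x - y)|%R) _ _ _ _ _).1.
- by move=> n; apply: measurable_funM => //; exact: measurable_ktrunc.
- by apply: measurable_funM => //; exact: measurable_ktrunc.
- by apply: integrable_norm; exact: A1_L1_ktrunc.
- by move=> n y; rewrite normrM [leRHS]normrM ler_wpM2r//; exact: trunc_le.
apply: aeW => y; apply: cvg_near_cst; exists (Num.truncn `|y|) => // n /= ny.
congr (_ * _)%R; apply: trunc_in.
have yn : (`|y| < n.+1%:R)%R.
  by rewrite (lt_le_trans (Num.Theory.truncnS_gt _))// ler_nat ltnS.
by move: yn; rewrite ltr_norml => /andP[/ltW -> ->].
Qed.

(** Truncated transforms of [trunc n] converge to those of [f], so a point of the level set of [f]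
    is in that of [trunc n] for all large [n], and [covered_liminf] applies. *)
Lemma weighted_weak (t : R) : (0 < t)%R ->
  let delta := (2 * C)^-1%R in
  let gam := (delta / (24 * hstar_const + 40))%R in
  covered (density mw) [set x | exists2 e, (0 < e)%R & (t < `|htrunc e f x|)%R]
    (((1 + delta) * (12 * C ^+ 2 / gam) / delta ^+ 2 / t)%:E * density mfw [set: R]).
Proof.
move=> t0 delta gam.
pose E n : set R := [set x | exists2 e, (0 < e)%R & (t < `|htrunc e (trunc n) x|)%R].
apply: (covered_liminf (E_ := E)) => [n|x [e e0 xe]].
  have mtw : measurable_fun [set: R] (trunc n \* w)%R by exact: measurable_funM.
  have n0 : (0 < n.+1%:R :> R)%R by [].
  apply: measurable_covered.
    by apply: open_measurable; exact: open_hstar_gt.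
  apply: (le_trans (weighted_weak_compact C1 wC (mtrunc n) mtw (trunc_L1 n) n0
    (@trunc_out n) t0)).
  rewrite lee_wpmul2l//; last first.
    rewrite -[leRHS]mul1e; apply: density_le => // y _.
    by rewrite /= mul1r normrM [leRHS]normrM ler_wpM2r//; exact: trunc_le.
  have hc0 := @hstar_const_gt0 R.
  have d0 : (0 <= delta)%R by rewrite invr_ge0 mulr_ge0.
  rewrite lee_fin; apply: divr_ge0; last exact: ltW.
  apply: divr_ge0; last exact: exprn_ge0.
  apply: mulr_ge0; first by rewrite addr_ge0.
  apply: divr_ge0; first by rewrite mulr_ge0// exprn_ge0.
  by apply: divr_ge0 => //; move: (hstar_const) hc0 => k k0; lra.
have h : \forall n \near \oo, (t < `|htrunc e (trunc n) x|)%R.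
  have nc : `|htrunc e (trunc n) x|%R @[n --> \oo] --> `|htrunc e f x|%R.
    by apply: cvg_norm; exact: htrunc_trunc_cvg.
  by exact: (cvgr_gt _ nc).
by have [N _ hN] := h; exists N => n Nn; exists e => //; exact: hN.
Qed.

Lemma hilbert_exists_ae : {ae mu, forall x, hilbert_exists f x}.
Proof.
have cn (n : nat) : {ae mu, forall x, (`|x| < n.+1%:R)%R ->
    cvg (htrunc e f x @[e --> (0 : R)^'+])}.
  (* [trunc N] agrees with [f] up to [2 n.+1 + 1], so for [|x| < n.+1] the two differ only at
     distance at least 1 from [x]. *)
  pose N := (2 * n.+1)%N.
  have N0 : (0 < N.+1%:R :> R)%R by [].
  apply: lebesgue_aeS (htrunc_cvg_compact (trunc_L1 N) N0 (@trunc_out N)) => x cx xn.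
  have iM (e : R) : (0 < e)%R -> L1 (fun y => trunc N y * ktrunc e (x - y))%R.
    by move=> e0; exact: L1_ktrunc.
  (* the part of [f] away from [x] contributes a constant for small [e] *)
  have far e e' : (0 < e < 1)%R -> (0 < e' < 1)%R ->
    (htrunc e f x - htrunc e (trunc N) x = htrunc e' f x - htrunc e' (trunc N) x)%R.
    move=> /andP[e0 e1] /andP[e'0 e'1].
    rewrite /htrunc -!RintegralB//; do ?[exact: iM|exact: A1_L1_ktrunc].
    apply: eq_Rintegral => y _; rewrite -!mulrBl.
    have [/trunc_in ->|yN] := boolP (- N.+1%:R <= y < N.+1%:R)%R.
      by rewrite subrr !mul0r.
    suff xy : (1 <= `|x - y|)%R.
      by rewrite /ktrunc !ifT// (lt_le_trans _ xy).
    have NE : (N.+1%:R = 2 * n.+1%:R + 1 :> R)%R by rewrite -natrM natr1.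
    have n1 : (1 <= n.+1%:R :> R)%R by rewrite ler1n.
    move: xn; rewrite ltr_norml => /andP[x1 x2].
    move: yN; rewrite negb_and -ltNge -leNgt => /orP[yN|yN].
      by rewrite ger0_norm; lra.
    by rewrite distrC ger0_norm; lra.
  have [l hl] := (cvg_ex _).1 cx.
  pose c := (htrunc 2^-1 f x - htrunc 2^-1 (trunc N) x)%R.
  apply/cvg_ex; exists (l + c)%R.
  have : (htrunc e (trunc N) x + c)%R @[e --> (0 : R)^'+] --> (l + c)%R.
    by apply: cvgD => //; exact: cvg_cst.
  apply: cvg_trans; apply: near_eq_cvg; near=> e.
  have e01 : (0 < e < 1)%R.
    by apply/andP; split; near: e; [exact: nbhs_right_gt|exact: nbhs_right_lt].
  have h2 : (0 < (2^-1 : R) < 1)%R by rewrite invr_gt0 ltr0n/= invf_lt1// ltr1n.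
  by have := far _ _ e01 h2; rewrite -/c => <-; rewrite addrC subrK.
have : {ae mu, forall x, forall n : nat, (`|x| < n.+1%:R)%R ->
    cvg (htrunc e f x @[e --> (0 : R)^'+])} by exact: ae_foralln.
apply: lebesgue_aeS => x xn; apply: hilbert_existsP; first by move=> e e0; exact: A1_L1_ktrunc.
exact/xn/Num.Theory.truncnS_gt.
Unshelve. all: by end_near. Qed.

End function.
End weighted.

(** * Monotonicity of integrals and integrals of powers *)

Section monotone_integral.
Context {d : measure_display} {T : measurableType d} {R : realType}.
Variable m : {measure set T -> \bar R}.

(* No measurability is assumed: a nonnegative integral is a supremum over the
   simple functions below the integrand. *)
Lemma ge0_le_integral_sup (D E : set T) (f g : T -> \bar R) :
  D `<=` E -> (forall x, D x -> 0 <= f x) -> (forall x, E x -> 0 <= g x) ->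
  (forall x, D x -> f x <= g x) ->
  \int[m]_(x in D) f x <= \int[m]_(x in E) g x.
Proof.
move=> DE f0 g0 fg; rewrite !ge0_integralE//.
apply: ge_ereal_sup => _ /= [h hf <-]; apply: ereal_sup_ubound.
exists h => // x; apply: (le_trans (hf x)).
rewrite !patchE; case: (boolP (x \in D)) => [/set_mem Dx|_].
  by rewrite mem_set; [exact: fg|exact: DE].
by case: (boolP (x \in E)) => // /set_mem Ex; exact: g0.
Qed.

Lemma le_integral_funepos (D : set T) (f : T -> \bar R) :
  \int[m]_(x in D) f x <= \int[m]_(x in D) f^\+ x.
Proof.
by rewrite integralE -[leRHS]sube0 leeB// integral_ge0.
Qed.

End monotone_integral.

Section power_integral.
Context {R : realType}.
Local Notation mu := (@lebesgue_measure R).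

Lemma continuous_powR (al t : R) : (0 < t)%R ->
  {for t, continuous (fun s : R => s `^ al)%R}.
Proof.
move=> t0; apply: differentiable_continuous; apply/derivable1_diffP.
by apply: derivable_powR; rewrite in_itv/= andbT.
Qed.

Lemma lee_poweR (r : R) (x y : \bar R) : (0 <= r)%R -> 0 <= x -> x <= y ->
  x `^ r <= y `^ r.
Proof.
move=> r0 x0 xy; apply: (gt0_ler_poweR r0) => //; rewrite in_itv/= leey andbT//.
exact: (le_trans x0).
Qed.

Lemma poweR_le_of_inv (q c : R) (x : \bar R) : (0 < q)%R -> 0 <= x ->
  x `^ q^-1 <= c%:E -> x <= (c `^ q)%:E.
Proof.
move=> q0 x0 xc; rewrite -poweR_EFin -[leLHS](poweRe1 x0) -(mulVf (lt0r_neq0 q0)) poweRrM.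
by apply: lee_poweR => //; rewrite ?(ltW q0)// poweR_ge0.
Qed.

(** The integrand may blow up at 0, so the fundamental theorem of calculus is used on
    [[a / n.+2, a]] and the bound passes to the increasing union. *)
Lemma integral_powR_le (a al : R) : (0 < a)%R -> (0 < al)%R ->
  \int[mu]_(t in `]0%R, a[) (t `^ (al - 1))%:E <= (a `^ al / al)%:E.
Proof.
move=> a0 al0.
have mp : measurable_fun [set: R] (fun t : R => t `^ (al - 1))%R by exact: measurable_powR.
pose F n : set R := `[(a / n.+2%:R)%R, a]%classic.
have mF n : measurable (F n) by exact: measurable_itv.
have an0 n : (0 < a / n.+2%:R)%R by rewrite divr_gt0.
have ana n : (a / n.+2%:R < a)%R by rewrite gtr_pMr// invf_lt1// ltr1n.
have FE n : \int[mu]_(t in F n) (t `^ (al - 1))%:E <= (a `^ al / al)%:E.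
  rewrite /F (@continuous_FTC2 _ _ (fun t => t `^ al / al)%R)//.
  - by rewrite -EFinB lee_fin gerBl divr_ge0// ?powR_ge0// ltW.
  - apply: continuous_in_subspaceT => t; rewrite inE/= in_itv/= => /andP[at_ _].
    by apply: continuous_powR; exact: lt_le_trans (an0 n) at_.
  - have cF t : (0 < t)%R -> {for t, continuous (fun t : R => t `^ al / al)%R}.
      move=> t0; apply: cvgM; last exact: cvg_cst.
      exact: continuous_powR.
    split.
    + move=> t; rewrite in_itv/= => /andP[at_ _].
      apply: derivableM; last exact: derivable_cst.
      by apply: derivable_powR; rewrite in_itv/= andbT (lt_trans (an0 n)).
    + by apply/cvg_at_right_filter/cF.
    + by apply/cvg_at_left_filter/cF.
  - move=> t; rewrite in_itv/= => /andP[at_ _].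
    have t0 : (0 < t)%R by exact: lt_trans (an0 n) at_.
    have h := is_derive1_powR al t0.
    have -> : (fun t : R => t `^ al / al)%R = (al^-1 \*: (@powR R ^~ al))%R.
      by apply/funext => y; rewrite /= mulrC.
    rewrite derive1E deriveZ//.
    have [_ ->] := h; rewrite -[LHS]/(al^-1 * (al * t `^ (al - 1)))%R.
    by rewrite mulKf// gt_eqF.
pose nu : {measure set R -> \bar R} := density mp.
have -> : \int[mu]_(t in `]0%R, a[) (t `^ (al - 1))%:E = nu `]0%R, a[%classic.
  rewrite /nu /density; apply: eq_integral => t _.
  by rewrite ger0_norm ?powR_ge0.
have UF : `]0%R, a[%classic `<=` \bigcup_n F n.
  move=> t; rewrite /= in_itv/= => /andP[t0 ta].
  exists (Num.truncn (a / t)) => //; rewrite /F/= in_itv/= (ltW ta) andbT.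
  rewrite ler_pdivrMr// mulrC -ler_pdivrMr//.
  by rewrite (le_trans (ltW (Num.Theory.truncnS_gt _)))// ler_nat.
have ndF : nondecreasing_seq F.
  apply/nondecreasing_seqP => n; apply/subsetPset.
  apply: subset_itv; rewrite bnd_simp// ler_pM2l// lef_pV2 ?posrE//.
  by rewrite ler_nat.
have mUF : measurable (\bigcup_n F n) by exact: bigcup_measurable.
have cB := @nondecreasing_cvg_mu _ _ _ nu F mF mUF ndF.
apply: (@le_trans _ _ (nu (\bigcup_n F n))).
  by apply: le_measure; rewrite ?inE.
rewrite -(cvg_lim _ cB)//; apply: lime_le; first by apply/cvg_ex; eexists; exact: cB.
apply: nearW => n /=; apply: le_trans (FE n).
rewrite le_eqVlt; apply/orP; left; apply/eqP.
rewrite /nu /density; apply: eq_integral => t _.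
by rewrite ger0_norm ?powR_ge0.
Qed.

End power_integral.

(** * Bounds for weighted rearrangements and Lorentz norms *)

Section weighted_lorentz.
Context {R : realType}.
Local Notation mu := (@lebesgue_measure R).
Context {u : R -> R} (mu_ : measurable_fun [set: R] u)
  (u0 : {ae mu, forall x, (0 < u x)%R}).
Local Notation nu := (density mu_).

(** Only [A] has to be measurable; [E] will be a level set of [hilbert f]. *)
Lemma wmeas_le (E A : set R) : measurable A -> E `<=` A -> wmeas u E <= nu A.
Proof.
move=> mA EA; apply: (le_trans (@le_integral_funepos _ _ R mu _ _)).
apply: (@ge0_le_integral_sup _ _ R mu) => // x _.
by rewrite funeposE -EFin_max lee_fin ge_max ler_norm normr_ge0.
Qed.

(** The negative part of [u] vanishes almost everywhere, so its integral is 0 even over an arbitrary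
    [E]. *)
Lemma le_wmeas (E A : set R) : measurable A -> A `<=` E -> nu A <= wmeas u E.
Proof.
move=> mA AE; rewrite /wmeas integralE.
have mupos : measurable_fun [set: R] (fun x => (u x)%:E) by exact/measurable_EFinP.
have neg0 : \int[mu]_(x in E) (fun x => (u x)%:E)^\- x = 0.
  apply/eqP; rewrite eq_le integral_ge0// andbT.
  apply: (@le_trans _ _ (\int[mu]_x (fun x => (u x)%:E)^\- x)).
    exact: (@ge0_le_integral_sup _ _ R mu).
  rewrite (@ae_eq_integral _ _ R mu [set: R] (cst 0))//.
  - by rewrite integral0.
  - exact: measurable_funeneg.
  - apply: lebesgue_aeS u0 => x ux _.
    by rewrite funenegE -EFinN -EFin_max max_r// oppr_le0 ltW.
rewrite neg0 sube0.
apply: (@le_trans _ _ (\int[mu]_(x in A) (fun x => (u x)%:E)^\+ x)); last first.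
  exact: (@ge0_le_integral_sup _ _ R mu).
rewrite le_eqVlt; apply/orP; left; apply/eqP.
apply: ae_eq_integral => //.
- exact: measurable_norm_EFin.
- by apply: measurable_funTS; exact: measurable_funepos.
- apply: lebesgue_aeS u0 => x ux _.
  by rewrite funeposE -EFin_max max_l ?ltW// gtr0_norm.
Qed.

Lemma wmeasE (A : set R) : measurable A -> wmeas u A = nu A.
Proof.
by move=> mA; apply/eqP; rewrite eq_le wmeas_le// le_wmeas.
Qed.

Lemma rearrangement_ge0 f (t : R) : 0 <= rearrangement u f t.
Proof. by apply: le_ereal_inf_tmp => _ [s [s0 _] <-]; rewrite lee_fin. Qed.

Lemma rearrangement_le f (s t : R) : (0 <= s)%R ->
  wmeas u [set x | (s < `|f x|)%R] <= t%:E -> rearrangement u f t <= s%:E.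
Proof. by move=> s0 st; apply: ereal_inf_lbound; exists s. Qed.

Lemma rearrangement_ge f (s t : R) :
  (forall s', (0 <= s')%R -> (s' < s)%R -> t%:E < wmeas u [set x | (s' < `|f x|)%R]) ->
  s%:E <= rearrangement u f t.
Proof.
move=> H; apply: le_ereal_inf_tmp => _ [s' [s'0 s't] <-]; rewrite lee_fin leNgt.
by apply/negP => /(H _ s'0); rewrite ltNge s't.
Qed.

Lemma rearrangement_nonincreasing f (t t' : R) : (t <= t')%R ->
  rearrangement u f t' <= rearrangement u f t.
Proof.
move=> tt'; apply: le_ereal_inf_tmp => _ [s [s0 st] <-].
by apply: rearrangement_le => //; rewrite (le_trans st)// lee_fin.
Qed.

(* On [a/2, a] the weight t^(al-1) is comparable with its value at [a]. *)
Lemma powR_half_ge (a al t : R) : (0 < a)%R -> (a / 2 <= t)%R -> (t <= a)%R ->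
  (Num.min 1 (2^-1 `^ (al - 1)) * a `^ (al - 1) <= t `^ (al - 1))%R.
Proof.
move=> a0 at_ ta; have t0 : (0 < t)%R by apply: lt_le_trans at_; rewrite divr_gt0.
have [al1|al1] := leP 0%R (al - 1)%R.
  apply: (@le_trans _ _ (2^-1 `^ (al - 1) * a `^ (al - 1))%R).
    by rewrite ler_wpM2r ?powR_ge0// ge_min lexx orbT.
  rewrite -powRM ?(ltW a0)//; apply: ge0_ler_powR => //; rewrite ?nnegrE ?(ltW t0)//.
    by rewrite mulr_ge0// ltW.
  by rewrite mulrC.
apply: (@le_trans _ _ (a `^ (al - 1))%R).
  by rewrite ler_piMl ?powR_ge0// ge_min lexx.
rewrite -(opprK (al - 1)%R) !(powRN _ (- (al - 1))).
rewrite lef_pV2 ?posrE ?powR_gt0//.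
by apply: ge0_ler_powR; rewrite ?nnegrE ?(ltW t0) ?(ltW a0)// oppr_ge0 ltW.
Qed.

Definition lorentz_const (p : R) (q : \bar R) : R :=
  (if q is q'%:E then
    (Num.min 1 (2^-1 `^ (q' / p - 1)) / 2) `^ q'^-1
  else 2^-1 `^ p^-1)%R.

Lemma lorentz_const_gt0 p q : (0 < lorentz_const p q)%R.
Proof.
case: q => [q| |]; rewrite /lorentz_const powR_gt0//.
Qed.

(** Keep only [t] in []a / 2, a[], where the power of [t] is comparable with that of [a], or the
    single value [t = a / 2] when [q = +oo]. *)
Lemma lorentz_lower (p : R) (q : \bar R) f (a k : R) :
  (0 < p)%R -> 0 < q -> (0 < a)%R -> (0 <= k)%R ->
  (forall t, (0 < t)%R -> (t < a)%R -> k%:E <= rearrangement u f t) ->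
  (lorentz_const p q * k * a `^ p^-1)%:E <= lorentz_norm u p q f.
Proof.
move=> p0 q0 a0 k0 fk; case: q q0 => [q| |]//= q0; last first.
  apply: (@le_trans _ _ (((a / 2) `^ p^-1)%:E * rearrangement u f (a / 2))).
    rewrite mulrAC EFinM mulrC -powRM ?(ltW a0)//.
    rewrite lee_wpmul2l ?lee_fin ?powR_ge0// fk ?divr_gt0//; lra.
  by apply: ereal_sup_ubound; exists (a / 2)%R => //=; rewrite in_itv/= divr_gt0.
rewrite lte_fin in q0.
set c := Num.min _ _.
have c0 : (0 <= c)%R by rewrite le_min ler01 powR_ge0.
have qi : (0 <= q^-1)%R by rewrite invr_ge0 ltW.
apply: (@le_trans _ _ ((c / 2 * k `^ q * a `^ (q / p))%:E `^ q^-1)).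
  rewrite poweR_EFin lee_fin !powRM ?mulr_ge0 ?powR_ge0// ?divr_ge0//.
  rewrite -!powRrM mulfV ?gt_eqF// powRr1//.
  by have -> : (q / p / q = p^-1)%R by field; rewrite !gt_eqF.
have int0 : 0 <= (c / 2 * k `^ q * a `^ (q / p))%:E.
  by rewrite lee_fin !mulr_ge0 ?powR_ge0// divr_ge0.
apply: lee_poweR => //.
pose I : set R := `](a / 2)%R, a[%classic.
have mI : measurable I by exact: measurable_itv.
apply: (@le_trans _ _ (\int[mu]_(t in I) (k `^ q * (c * a `^ (q / p - 1)))%:E)).
  have muI : mu I = (a / 2)%:E.
    rewrite [LHS]lebesgue_measure_itv/= lte_fin ltr_pdivrMr// ltr_pMr// ltr1n -EFinD.
    by congr _%:E; field.
  rewrite integral_cst// [X in _ * X]muI -EFinM lee_fin.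
  rewrite -(mulr_powRB1 (ltW a0) (_ : 0 < q / p)%R) ?divr_gt0//.
  by rewrite le_eqVlt; apply/orP; left; apply/eqP; field.
apply: (@ge0_le_integral_sup _ _ R mu).
- move=> t; rewrite /I/= !in_itv/= => /andP[t1 t2]; rewrite andbT.
  by apply: lt_trans t1; rewrite divr_gt0.
- by move=> t _; rewrite lee_fin !mulr_ge0 ?powR_ge0.
- by move=> t _; rewrite mule_ge0 ?poweR_ge0// lee_fin powR_ge0.
move=> t; rewrite /I/= in_itv/= => /andP[t1 t2].
have t0 : (0 < t)%R by apply: lt_trans t1; rewrite divr_gt0.
rewrite EFinM; apply: lee_pmul; rewrite ?lee_fin ?powR_ge0 ?mulr_ge0 ?powR_ge0//.
  rewrite -poweR_EFin; apply: lee_poweR; rewrite ?(ltW q0)//.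
  exact: fk.
by apply: powR_half_ge => //; exact: ltW.
Qed.

(** Chebyshev: the rearrangement is at least [k] on []0, nu J[]. *)
Lemma lorentz_lower_set (p : R) (q : \bar R) f (J : set R) (k : R) :
  (0 < p)%R -> 0 < q -> measurable J -> 0 < nu J -> nu J < +oo -> (0 <= k)%R ->
  (forall x, J x -> (k <= `|f x|)%R) ->
  (lorentz_const p q * k * fine (nu J) `^ p^-1)%:E <= lorentz_norm u p q f.
Proof.
move=> p0 q0 mJ J0 Joo k0 Jk; apply: lorentz_lower => //.
  by rewrite fine_gt0// J0.
move=> t t0 tJ; apply: rearrangement_ge => s' s'0 s'k.
apply: (@lt_le_trans _ _ (nu J)).
  by rewrite -(@fineK _ (nu J)) ?lte_fin// ge0_fin_numE// ltW.
by apply: le_wmeas => // x /Jk; exact: lt_le_trans.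
Qed.

Lemma lorentz_upper (p q : R) f (n : nat) (b a : nat -> R) :
  (0 < p)%R -> (0 < q)%R -> (forall i, (0 <= b i)%R) -> (forall i, (0 < a i)%R) ->
  (forall t, (0 < t)%R -> rearrangement u f t `^ q <=
     \sum_(i < n) (b i * (t < a i)%R%:R)%:E) ->
  lorentz_norm u p q%:E f <=
    ((\sum_(i < n) b i * (a i `^ (q / p) / (q / p))) `^ q^-1)%:E.
Proof.
move=> p0 q0 b0 a0 fb; rewrite /lorentz_norm -poweR_EFin.
have al0 : (0 < q / p)%R by rewrite divr_gt0.
apply: lee_poweR; first by rewrite invr_ge0 ltW.
  apply: integral_ge0 => t _.
  by rewrite mule_ge0 ?poweR_ge0// lee_fin powR_ge0.
pose g i t : \bar R := (b i * (t < a i)%R%:R * t `^ (q / p - 1))%:E.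
have g0 i t : 0 <= g i t by rewrite lee_fin !mulr_ge0 ?powR_ge0.
have mg i : measurable_fun [set: R] (g i).
  apply/measurable_EFinP; apply: measurable_funM; last exact: measurable_powR.
  apply: measurable_funM => //.
  rewrite (_ : (fun t => _) = \1_(`]-oo, a i[%classic : set R)).
    by apply: measurable_indic; exact: measurable_itv.
  by apply/funext => t; rewrite indicE mem_setE in_itv.
have D0 : measurable (`]0%R, +oo[%classic : set R) by exact: measurable_itv.
apply: (@le_trans _ _ (\int[mu]_(t in `]0%R, +oo[) \sum_(i < n) g i t)).
  apply: (@ge0_le_integral_sup _ _ R mu) => //.
  - by move=> t _; rewrite mule_ge0 ?poweR_ge0// lee_fin powR_ge0.
  - by move=> t _; apply: sume_ge0.
  move=> t; rewrite /= in_itv/= andbT => t0.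
  rewrite /g; under eq_bigr do rewrite EFinM.
  rewrite -ge0_sume_distrl => [|i _]; last by rewrite lee_fin mulr_ge0.
  by rewrite lee_wpmul2r ?lee_fin ?powR_ge0// fb.
rewrite ge0_integral_sum//; last by move=> i; apply: measurable_funTS; exact: mg.
rewrite -sumEFin; apply: lee_sum => i _.
apply: (@le_trans _ _ (\int[mu]_(t in `]0%R, a i[) ((b i)%:E * (t `^ (q / p - 1))%:E))).
  rewrite integral_mkcond [leRHS]integral_mkcond.
  apply: (@ge0_le_integral_sup _ _ R mu) => //.
  - by move=> t _; apply: erestrict_ge0.
  - by move=> t _; apply: erestrict_ge0 => s _; rewrite mule_ge0// lee_fin ?powR_ge0.
  move=> t _; rewrite !patchE !mem_setE !in_itv/= andbT /g.
  case: (ltP 0%R t) => //= t0; case: ifPn => //= ta; first by rewrite mulr1 EFinM.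
  by rewrite mulr0 mul0r.
rewrite ge0_integralZl//.
- by rewrite EFinM lee_wpmul2l ?lee_fin// integral_powR_le.
- by apply: measurable_funTS; apply/measurable_EFinP; exact: measurable_powR.
- by move=> t _; rewrite lee_fin powR_ge0.
- by rewrite lee_fin.
Qed.

End weighted_lorentz.

(** * The embedding of L^{1,q}(u) into L^1(u) for q at most 1 *)

Section lorentz_L1.
Context {R : realType}.
Local Notation mu := (@lebesgue_measure R).

(** A discrete layer-cake formula: the sum is [dl] times the number of levels [dl, ..., n dl] below
    [y], and loses at most one step. *)
Lemma layer_sum_ge (n : nat) (dl y : R) : (0 < dl)%R ->
  (Num.min (n%:R * dl) (y - dl) <= \sum_(j < n) dl * (j.+1%:R * dl < y)%R%:R)%R.
Proof.
move=> d0; elim: n => [|n IH]; first by rewrite big_ord0 mul0r ge_min lexx.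
rewrite big_ord_recr/=; have [ny|yn] := ltP (n.+1%:R * dl)%R y.
  rewrite mulr1; apply: (@le_trans _ _ (n%:R * dl + dl)%R).
    by rewrite ge_min -natr1 mulrDl mul1r lexx.
  rewrite lerD2r; apply: le_trans IH; rewrite le_min lexx/=.
  by rewrite lerBrDr -[X in (_ + X)%R]mul1r -mulrDl natr1 ltW.
rewrite mulr0 addr0; apply: le_trans IH.
by rewrite le_min !ge_min lexx orbT andbT lerBlDr -[X in (_ + X)%R]mul1r -mulrDl natr1 yn orbT.
Qed.

Context {u : R -> R} (mu_ : measurable_fun [set: R] u)
  (u0 : {ae mu, forall x, (0 < u x)%R}).
Context {f : R -> R} (mf : measurable_fun [set: R] f).
Local Notation nu := (density mu_).
Let Lv (s : R) : set R := [set x | (s < `|f x|)%R].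

Let mLv s : measurable (Lv s).
Proof.
rewrite (_ : Lv s = (Num.norm \o f) @^-1` `]s, +oo[%classic).
  rewrite -[X in measurable X]setTI.
  have mnf : measurable_fun [set: R] (Num.norm \o f) by exact: measurableT_comp.
  exact: (mnf measurableT _ (measurable_itv _)).
by apply/seteqP; split => x /=; rewrite in_itv/= andbT.
Qed.

Lemma rearrangement_ge_level (s t : R) : t%:E < nu (Lv s) ->
  s%:E <= rearrangement u f t.
Proof.
move=> ts; apply: rearrangement_ge => s' s'0 s's; apply: (lt_le_trans ts).
by apply: (le_wmeas mu_ u0) => // x /=; exact: lt_trans.
Qed.

(** If the top level is exceeded on mass more than [t], that level bounds the rearrangement from
    below and the whole sum from above; otherwise the top term is 0. *)
Lemma layer_sum_le (n : nat) (dl t : R) : (0 <= dl)%R ->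
  (\sum_(j < n) dl * (t%:E < nu (Lv (j.+1%:R * dl)))%E%:R)%R%:E
    <= rearrangement u f t.
Proof.
move=> d0; elim: n => [|n IH]; first by rewrite big_ord0 rearrangement_ge0.
rewrite big_ord_recr/=; have [tn|nt] := ltP; last by rewrite mulr0 addr0.
apply: le_trans (rearrangement_ge_level tn); rewrite lee_fin mulr1 -natr1 mulrDl mul1r lerD2r.
apply: (@le_trans _ _ (\sum_(j < n) dl)%R); last by rewrite sumr_const card_ord mulr_natl.
by apply: ler_sum => j _; rewrite ler_piMr// lern1 leq_b1.
Qed.

Variables (q B : R) (q0 : (0 < q)%R) (q1 : (q <= 1)%R) (B0 : (0 < B)%R).
Let c := lorentz_const (1%R : R) q%:E.
(** A bound by [c B] with [B > 0] in place of the norm itself, so that norm 0 is included. *)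
Hypothesis fB : lorentz_norm u 1 q%:E f <= (c * B)%:E.

Let level_fin (s : R) : (0 < s)%R -> nu (Lv s) < +oo.
Proof.
move=> s0; rewrite ltNge; apply/negP; rewrite leye_eq => /eqP soo.
have b0 : (0 < B / s + 1)%R by rewrite ltr_pwDr// divr_ge0// ltW.
have : (c * s * (B / s + 1) `^ 1^-1)%:E <= (c * B)%:E.
  apply: le_trans fB; apply: lorentz_lower => //; first exact: ltW.
  by move=> t _ _; apply: rearrangement_ge_level; rewrite soo ltry.
rewrite lee_fin invr1 powRr1 ?(ltW b0)// -mulrA ler_pM2l ?lorentz_const_gt0//.
by rewrite mulrDr mulr1 mulrCA divff ?gt_eqF// mulr1 gerDl leNgt s0.
Qed.

(** [lorentz_lower] gives [S t <= B]; as [q <= 1], [S = S ^ q S ^ (1 - q)] is then at most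
    [S ^ q (B / t) ^ (1 - q)]. *)
Let layer_pointwise (S t : R) : (0 < t)%R -> (0 <= S)%R ->
  S%:E <= rearrangement u f t ->
  (B `^ (1 - q))^-1%:E * S%:E <= rearrangement u f t `^ q * (t `^ (q / 1 - 1))%:E.
Proof.
move=> t0 S0 St.
have StB : (S * t <= B)%R.
  have : (c * S * t `^ 1^-1)%:E <= (c * B)%:E.
    apply: le_trans fB; apply: lorentz_lower => // t' _ t't.
    by rewrite (le_trans St)// rearrangement_nonincreasing// ltW.
  by rewrite lee_fin invr1 powRr1 ?(ltW t0)// -mulrA ler_pM2l ?lorentz_const_gt0.
apply: (@le_trans _ _ ((S `^ q)%:E * (t `^ (q / 1 - 1))%:E)); last first.
  rewrite lee_wpmul2r ?lee_fin ?powR_ge0// -poweR_EFin.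
  by apply: lee_poweR; rewrite ?(ltW q0).
rewrite -!EFinM lee_fin divr1 -[(q - 1)%R]opprB powRN ler_pdivlMr ?powR_gt0//.
rewrite -mulrA ler_pdivrMl ?powR_gt0//.
have -> : (S * t `^ (1 - q) = S `^ q * (S * t) `^ (1 - q))%R.
  rewrite (powRM _ S0 (ltW t0)) mulrA; congr (_ * _)%R.
  rewrite -powRD; first by rewrite addrC subrK powRr1.
  by rewrite addrC subrK oner_eq0.
rewrite mulrC ler_wpM2r ?powR_ge0// ge0_ler_powR ?subr_ge0 ?nnegrE//.
- by rewrite mulr_ge0// ltW.
- exact: ltW.
Qed.

Let mE (dl : R) n : measurable (Lv (2 * dl) `\` Lv (n%:R * dl)).
Proof. exact: measurableD. Qed.

(** The left-hand side is the integral over [t > 0] of the layer sum, which [layer_pointwise] bounds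
    by [B ^ (1 - q) (c B) ^ q = c ^ q B]. *)
Let layer_bound (dl : R) n : (0 < dl)%R ->
  \sum_(j < n) dl%:E * nu (Lv (j.+1%:R * dl)) <= (c `^ q * B)%:E.
Proof.
move=> d0; pose D := `]0%R, +oo[%classic : set R.
have mD : measurable D by exact: measurable_itv.
pose a j := fine (nu (Lv (j.+1%:R * dl))).
have jd j : (0 < j.+1%:R * dl)%R by rewrite mulr_gt0.
have aE j : nu (Lv (j.+1%:R * dl)) = (a j)%:E.
  by rewrite fineK// ge0_fin_numE// level_fin.
pose S t : R := (\sum_(j < n) dl * (t < a j)%R%:R)%R.
have S0 t : (0 <= S t)%R by apply: sumr_ge0 => j _; rewrite mulr_ge0// ltW.
have mterm j : measurable_fun [set: R] (fun t : R => dl * (t < a j)%R%:R)%R.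
  apply: measurable_funM => //.
  rewrite (_ : (fun t => _) = \1_(`]-oo, a j[%classic : set R)).
    by apply: measurable_indic; exact: measurable_itv.
  by apply/funext => t; rewrite indicE mem_setE in_itv.
have mS : measurable_fun [set: R] S by exact: measurable_sum.
have SE : \int[mu]_(t in D) (S t)%:E = \sum_(j < n) dl%:E * (a j)%:E.
  under eq_integral do rewrite /S -sumEFin.
  rewrite ge0_integral_sum//; last first.
  - by move=> j t _; rewrite lee_fin mulr_ge0// ltW.
  - by move=> j; apply: measurable_funTS; apply/measurable_EFinP; exact: mterm.
  apply: eq_bigr => j _.
  rewrite (_ : (fun t => _) = (fun t => (dl * \1_(`]-oo, a j[%classic : set R) t)%:E)); last first.
    by apply/funext => t; rewrite indicE mem_setE in_itv.
  under eq_integral do rewrite EFinM.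
  rewrite ge0_integralZl//; last first.
  - by rewrite lee_fin ltW.
  - by apply: measurable_funTS; apply/measurable_EFinP; apply: measurable_indic; exact: measurable_itv.
  rewrite integral_indic//.
  congr (_ * _).
  rewrite (_ : _ `&` _ = `]0%R, a j[%classic); last first.
    apply/seteqP; split => t; rewrite /D/= !in_itv/= andbT.
      by move=> [-> ->].
    by move=> /andP[].
  rewrite [LHS]lebesgue_measure_itv/= lte_fin; case: ifPn => [_|]; first by rewrite oppr0 adde0.
  by rewrite -leNgt => a0; congr _%:E; apply/esym/le_anti; rewrite a0 fine_ge0.
under eq_bigr do rewrite aE; rewrite -SE.
have h : (B `^ (1 - q))^-1%:E * \int[mu]_(t in D) (S t)%:E <= ((c * B) `^ q)%:E.
  rewrite -ge0_integralZl//; last first.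
  - by rewrite lee_fin invr_ge0 powR_ge0.
  - by move=> t _; rewrite lee_fin.
  - by apply: measurable_funTS; apply/measurable_EFinP.
  apply: (@le_trans _ _ (\int[mu]_(t in D)
       (rearrangement u f t `^ q * (t `^ (q / 1 - 1))%:E))).
    apply: (@ge0_le_integral_sup _ _ R mu) => // t.
    - by move=> _; rewrite mule_ge0 ?lee_fin// invr_ge0 powR_ge0.
    - by move=> _; rewrite mule_ge0 ?poweR_ge0// lee_fin powR_ge0.
    rewrite /D/= in_itv/= andbT => t0; apply: layer_pointwise => //.
    apply: le_trans (layer_sum_le n t (ltW d0)); rewrite lee_fin /S.
    by apply: ler_sum => j _; rewrite aE lte_fin.
  apply: poweR_le_of_inv => //.
  by apply: integral_ge0 => t _; rewrite mule_ge0 ?poweR_ge0// lee_fin powR_ge0.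
have Bq : (0 < B `^ (1 - q))%R by exact: powR_gt0.
rewrite -(@lee_pmul2l _ (B `^ (1 - q))^-1%:E)//; last by rewrite lte_fin invr_gt0.
apply: (le_trans h); rewrite -EFinM lee_fin powRM ?(ltW B0)//; last exact/ltW/lorentz_const_gt0.
rewrite mulrCA ler_pM2l ?powR_gt0 ?lorentz_const_gt0// ler_pdivlMl//.
by rewrite -powRD ?subrK ?powRr1 ?(ltW B0)//; apply/implyP => _; rewrite gt_eqF.
Qed.

(** On [E n], where [2 / n.+1 < |f| <= n.+1], [|f|] is at most twice its layer sum, and
    [layer_bound] applies. The sets [E n] increase to the set where [f] is not 0. *)
Lemma lorentz_L1 (mfu : measurable_fun [set: R] (f \* u)%R) :
  density mfu [set: R] <= (2 * c `^ q * B)%:E.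
Proof.
pose dl n : R := (n.+1%:R^-1)%R.
have d0 n : (0 < dl n)%R by rewrite invr_gt0.
pose E n := Lv (2 * dl n) `\` Lv ((n.+1 * n.+1)%:R * dl n).
have mEn n : measurable (E n) by exact: mE.
have En n : density mfu (E n) <= (2 * c `^ q * B)%:E.
  set N := (n.+1 * n.+1)%N.
  apply: (@le_trans _ _ (\int[mu]_(x in E n)
      \sum_(j < N) ((2 * dl n)%:E * ((\1_(Lv (j.+1%:R * dl n)) x)%:E * `|u x|%:E)))).
    apply: (@ge0_le_integral_sup _ _ R mu) => // x.
    - by move=> _; apply: sume_ge0 => j _; rewrite !mule_ge0// lee_fin ?mulr_ge0// ltW.
    move=> [/= x1 /negP]; rewrite -leNgt => x2.
    under eq_bigr do rewrite -!EFinM.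
    rewrite sumEFin lee_fin normrM.
    have -> : (\sum_(j < N) 2 * dl n * (\1_(Lv (j.+1%:R * dl n)) x * `|u x|) =
       2 * (\sum_(j < N) dl n * (j.+1%:R * dl n < `|f x|)%R%:R) * `|u x|)%R.
      rewrite mulr_sumr mulr_suml; apply: eq_bigr => j _.
      rewrite indicE; have -> : (x \in Lv (j.+1%:R * dl n)) = (j.+1%:R * dl n < `|f x|)%R by apply/idP/idP; rewrite inE.
      by rewrite !mulrA.
    apply: ler_wpM2r => //; have := layer_sum_ge N `|f x| (d0 n).
    have fx0 := normr_ge0 (f x); move: (\sum_(j < N) _)%R => Z.
    have {}x1 : (2 * dl n < `|f x|)%R := x1.
    have {}x2 : (`|f x| <= N%:R * dl n)%R by rewrite leNgt; apply/negP; rewrite ltNge x2.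
    by rewrite ge_min => /orP[|] Zge; lra.
  have mt j : measurable_fun [set: R] (fun x => (\1_(Lv (j.+1%:R * dl n)) x)%:E * `|u x|%:E).
    apply: emeasurable_funM; last exact: measurable_norm_EFin.
    by apply/measurable_EFinP; exact: measurable_indic.
  rewrite ge0_integral_sum//; last first.
  - by move=> j x _; rewrite !mule_ge0// lee_fin ?mulr_ge0// ltW.
  - by move=> j; apply: measurable_funTS; apply: emeasurable_funM => //; exact: mt.
  - exact: mEn.
  apply: (@le_trans _ _ (2%:E * \sum_(j < N) (dl n)%:E * nu (Lv (j.+1%:R * dl n)))); last first.
    by rewrite -mulrA EFinM lee_wpmul2l ?lee_fin// layer_bound.
  rewrite ge0_sume_distrr => [|j _]; last by rewrite mule_ge0// lee_fin ltW.
  apply: lee_sum => j _; rewrite ge0_integralZl//; last first.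
  - by rewrite lee_fin mulr_ge0// ltW.
  - by apply: measurable_funTS; exact: mt.
  - exact: mEn.
  rewrite muleA -EFinM lee_wpmul2l ?lee_fin ?mulr_ge0 ?(ltW (d0 n))//.
  rewrite /density [leRHS]integral_mkcond.
  apply: (@ge0_le_integral_sup _ _ R mu) => // x.
  - by move=> _; apply: erestrict_ge0.
  by move=> _; rewrite patchE indicE; case: (x \in _); rewrite ?mul1e ?mul0e.
have ndE : nondecreasing_seq E.
  apply/nondecreasing_seqP => n; apply/subsetPset => x [/= x1 /negP]; rewrite -leNgt => x2.
  have dS : (dl n.+1 <= dl n)%R by rewrite lef_pV2 ?posrE// ler_nat.
  split; first by apply: le_lt_trans x1; rewrite ler_pM2l.
  apply/negP; rewrite -leNgt (le_trans x2)// /dl !natrM -!mulrA !divff ?mulr1 ?ler_nat//.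
have mUE : measurable (\bigcup_n E n) by exact: bigcup_measurable.
have cB := @nondecreasing_cvg_mu _ _ _ (density mfu) E mEn mUE ndE.
apply: (@le_trans _ _ (density mfu (\bigcup_n E n))).
  rewrite /density [leRHS]integral_mkcond; apply: (@ge0_le_integral_sup _ _ R mu) => // x.
    by move=> _; exact: erestrict_ge0.
  move=> _; rewrite patchE; case: ifPn => //= xE.
  have [->|fx0] := eqVneq (f x) 0%R; first by rewrite mul0r normr0.
  exfalso; move/negP: xE; apply; apply/mem_set.
  have fx : (0 < `|f x|)%R by rewrite normr_gt0.
  pose n := maxn (Num.truncn `|f x|) (Num.truncn (2 / `|f x|)).
  exists n => //; split => /=.
    rewrite /Lv/= /dl ltr_pdivrMr// -ltr_pdivrMl// mulrC.
    by rewrite (lt_le_trans (Num.Theory.truncnS_gt _))// ler_nat ltnS leq_maxr.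
  apply/negP; rewrite -leNgt /dl natrM -mulrA divff// mulr1.
  by rewrite (le_trans (ltW (Num.Theory.truncnS_gt _)))// ler_nat ltnS leq_maxl.
rewrite -(cvg_lim _ cB)//; apply: lime_le; first by apply/cvg_ex; eexists; exact: cB.
by apply: nearW => n /=.
Qed.

End lorentz_L1.

(** * Hilbert transform of a nonnegative bump *)

Section hilbert_of_bump.
Context {R : realType}.
Local Notation mu := (@lebesgue_measure R).
Local Notation L1 f := (mu.-integrable [set: R] (EFin \o f)).

(* Off the support of [f] the truncated integrals are eventually constant and
   the kernel keeps its sign [s]. *)
Lemma hilbert_bump f (x e0 D s : R) : L1 f -> (forall y, (0 <= f y)%R) ->
  (0 < e0)%R -> `|s|%R = 1%R ->
  (forall y, f y != 0%R -> (e0 < s * (x - y))%R /\ (s * (x - y) <= D)%R) ->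
  hilbert_exists f x /\ (pi^-1 * (D^-1 * \int[mu]_y f y) <= `|hilbert f x|)%R.
Proof.
move=> intf f0 e00 s1 fS.
have sn y : f y != 0%R -> `|x - y|%R = (s * (x - y))%R.
  by move=> /fS[h _]; rewrite -[LHS]mul1r -s1 -normrM gtr0_norm// (lt_trans e00).
have cst_trunc e : (0 < e)%R -> (e < e0)%R -> htrunc e f x = htrunc e0 f x.
  move=> _ ee0; apply: eq_Rintegral => y _.
  have [->|fy] := eqVneq (f y) 0%R; first by rewrite !mul0r.
  have [h _] := fS _ fy; rewrite /ktrunc !ifT// sn//.
  exact: lt_trans h.
have lim_trunc : htrunc e f x @[e --> (0 : R)^'+] --> htrunc e0 f x.
  have : (htrunc e0 f x) @[_ --> (0 : R)^'+] --> htrunc e0 f x by exact: cvg_cst.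
  apply: cvg_trans; apply: near_eq_cvg; near=> e.
  by rewrite cst_trunc.
have ex : hilbert_exists f x.
  apply: hilbert_existsP; first by move=> e ?; exact: L1_ktrunc.
  by apply/cvg_ex; exists (htrunc e0 f x).
split => //; rewrite /hilbert asboolT//.
have -> : lim (hilbert_trunc f x e @[e --> (0 : R)^'+]) = htrunc e0 f x.
  by apply/cvg_lim => //; under eq_fun do rewrite hilbert_truncE.
rewrite normrM ger0_norm ?invr_ge0 ?pi_ge0// ler_pM2l ?invr_gt0 ?pi_gt0//.
rewrite -[leRHS]mul1r -s1 -normrM; apply: le_trans (ler_norm _).
have intk := L1_ktrunc x e00 intf.
rewrite /htrunc -!RintegralZl//; apply: le_Rintegral => //.
- exact: L1Z.
- exact: L1Z.
move=> y _; have [->|fy] := eqVneq (f y) 0%R; first by rewrite !(mul0r, mulr0).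
have [h1 h2] := fS _ fy.
have sxy : (0 < s * (x - y))%R by exact: lt_trans h1.
rewrite mulrCA mulrC ler_wpM2l// /ktrunc ifT ?sn//.
have ss : (s * s = 1)%R by rewrite -expr2 -real_normK ?num_real// s1 expr1n.
have -> : (s * (x - y)^-1 = (s * (x - y))^-1)%R.
  rewrite invfM; congr (_ * _)%R.
  have s0 : s != 0%R by rewrite -normr_eq0 s1 oner_eq0.
  by apply: (mulfI s0); rewrite ss divff.
by rewrite lef_pV2 ?posrE// (lt_le_trans sxy).
Unshelve. all: by end_near. Qed.

End hilbert_of_bump.

(** * Masses of intervals and test inequalities *)

Section weights.
Context {R : realType}.
Local Notation mu := (@lebesgue_measure R).
Local Notation L1 f := (mu.-integrable [set: R] (EFin \o f)).

Lemma weight_measurable (u : R -> R) : weight u -> measurable_fun [set: R] u.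
Proof. by case=> -[]. Qed.

Section weight.
Context {u : R -> R} (wu : weight u).
Local Notation nu := (density (weight_measurable wu)).

Lemma weight_norm_gt0 : {ae mu, forall x, (0 < `|u x|)%R}.
Proof.
by case: wu => _; apply: lebesgue_aeS => x ux; rewrite normr_gt0 gt_eqF.
Qed.

Lemma weight_itv_fin (a b : R) : nu `](a)%R, b[%classic < +oo.
Proof.
have [[_ _ fK] _] := wu.
have cab : compact `[a, b]%classic by exact: segment_compact.
apply: le_lt_trans (fK _ (@subsetT _ _) cab).
apply: (@ge0_le_integral_sup _ _ R mu) => // x; rewrite /= !in_itv/= => /andP[ax xb].
by rewrite !ltW.
Qed.

Definition itv_mass (a b : R) : R := fine (nu `](a)%R, b[%classic).

Lemma itv_massE (a b : R) : nu `](a)%R, b[%classic = (itv_mass a b)%:E.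
Proof. by rewrite fineK// ge0_fin_numE// weight_itv_fin. Qed.

Lemma itv_mass_ge0 (a b : R) : (0 <= itv_mass a b)%R.
Proof. exact: fine_ge0. Qed.

Lemma itv_mass_gt0 (a b : R) : (a < b)%R -> (0 < itv_mass a b)%R.
Proof.
move=> ab; rewrite -lte_fin -itv_massE.
by apply: density_gt0 => //; exact: weight_norm_gt0.
Qed.

Lemma itv_mass_bitv (l r : bool) (a b : R) : nu (bitv l r a b) = (itv_mass a b)%:E.
Proof.
by rewrite -itv_massE /density /bitv integral_itv_bndoo//; exact: (measurable_norm_EFin (weight_measurable wu)).
Qed.

Lemma itv_massD (a b c : R) : (a <= b)%R -> (b <= c)%R ->
  itv_mass a c = (itv_mass a b + itv_mass b c)%R.
Proof.
move=> ab bc; apply: EFin_inj; rewrite EFinD.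
rewrite -(itv_mass_bitv true false a c) -(itv_mass_bitv true true a b).
rewrite -(itv_mass_bitv true false b c) /bitv.
rewrite (@itv_bndbnd_setU _ _ _ (BLeft b)) ?bnd_simp// measureU//.
apply/seteqP; split => // x [/=]; rewrite !in_itv/= => /andP[_ xb] /andP[bx _].
by move: xb; rewrite ltNge bx.
Qed.

Lemma itv_mass_sub (a b c d : R) : (c <= a)%R -> (b <= d)%R ->
  (itv_mass a b <= itv_mass c d)%R.
Proof.
move=> ca bd; rewrite -lee_fin -!itv_massE; apply: le_measure; rewrite ?inE//.
move=> x; rewrite /= !in_itv/= => /andP[ax xb].
by rewrite (le_lt_trans ca)// (lt_le_trans xb).
Qed.

(** The rearrangement of the indicator is at most 1 and vanishes from [t = a] on. Bounding [nu E] by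
    a positive [a] lets null sets in. *)
Lemma lorentz_indic (p : R) (q : \bar R) : (0 < p)%R -> 0 < q ->
  exists2 K : R, (0 < K)%R & forall (E : set R) (a : R), measurable E ->
    (0 < a)%R -> nu E <= a%:E ->
    lorentz_norm u p q (\1_E : R -> R) <= (K * a `^ p^-1)%:E.
Proof.
have wp := wu.2.
move=> p0 q0.
have r1 (E : set R) t : (0 < t)%R -> rearrangement u (\1_E : R -> R) t <= 1%:E.
  move=> t0; apply: rearrangement_le => //.
  rewrite (_ : [set x | _] = set0); last first.
    apply/seteqP; split => // x /=.
    by rewrite indicE ger0_norm// ltNge lern1 leq_b1.
  by rewrite /wmeas integral_set0 lee_fin ltW.
have r0 (E : set R) a t : measurable E -> nu E <= a%:E -> (a <= t)%R ->
    rearrangement u (\1_E : R -> R) t <= 0.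
  move=> mE Ea at_; apply: rearrangement_le => //.
  apply: (@le_trans _ _ (nu E)); last by rewrite (le_trans Ea)// lee_fin.
  apply: wmeas_le => // x /=.
  by rewrite indicE; have [/set_mem//|_] := boolP (x \in E); rewrite normr0 ltxx.
move: q q0; case=> [q| |] q0 //; last first.
  exists 1%R; first by [].
  move=> E a mE a0 Ea; rewrite mul1r.
  apply: ge_ereal_sup => _ /= [t + <-]; rewrite in_itv/= andbT => t0.
  have [ta|at_] := ltP t a.
    apply: (@le_trans _ _ ((t `^ p^-1)%:E * 1%:E)).
      by rewrite lee_wpmul2l ?lee_fin ?powR_ge0// r1.
    rewrite mule1 lee_fin ge0_ler_powR ?invr_ge0 ?nnegrE//; exact: ltW.
  apply: (@le_trans _ _ ((t `^ p^-1)%:E * 0)).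
    by rewrite lee_wpmul2l ?lee_fin ?powR_ge0// (r0 E a).
  by rewrite mule0 lee_fin powR_ge0.
rewrite lte_fin in q0.
exists ((q / p)^-1 `^ q^-1)%R; first by rewrite powR_gt0// invr_gt0 divr_gt0.
move=> E a mE a0 Ea.
have h := @lorentz_upper _ u p q (\1_E : R -> R) 1 (fun=> 1%R) (fun=> a) p0 q0.
apply: (le_trans (h _ _ _)) => //.
  move=> t t0; rewrite big_ord_recl big_ord0 adde0 mul1r; have [ta|at_] := ltP t a.
    have -> : (true%:R)%:E = 1%:E `^ q :> \bar R by rewrite poweR_EFin powR1.
    by apply: lee_poweR; rewrite ?(ltW q0) ?rearrangement_ge0// r1.
  have -> : rearrangement u (\1_E : R -> R) t = 0.
    by apply/le_anti; rewrite rearrangement_ge0 (r0 E a).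
  by rewrite poweR_EFin powR0 ?gt_eqF// mulr0.
rewrite big_ord_recl big_ord0 addr0 mul1r mulrC.
rewrite powRM ?powR_ge0// ?invr_ge0 ?divr_ge0 ?(ltW q0) ?(ltW p0)// -powRrM.
by have -> : (q / p * q^-1 = p^-1)%R by field; rewrite !gt_eqF.
Qed.

(** [hilbert_bump] bounds [|hilbert f|] below on []c, d[], [lorentz_lower_set] turns this into a
    lower bound for its norm, and boundedness compares it with the norm of [f]. *)
Lemma bump_test (p r : R) (q s : \bar R) : (0 < r)%R -> 0 < s ->
  hilbert_bounded u p q r s ->
  exists2 C : R, (0 < C)%R & forall (f : R -> R) (a b c d D N : R),
    L1 f -> (forall y, (0 <= f y)%R) -> (forall y, f y != 0%R -> (a < y < b)%R) ->
    (c < d)%R -> (b <= c)%R \/ (d <= a)%R -> (0 < D)%R ->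
    (forall x y, (c < x < d)%R -> (a < y < b)%R -> (`|x - y| <= D)%R) ->
    lorentz_norm u p q f <= N%:E ->
    (D^-1 * (\int[mu]_y f y) * itv_mass c d `^ r^-1 <= C * N)%R.
Proof.
move=> r0 s0 [_ [C C0 HC]].
have k0 := lorentz_const_gt0 r s.
have pk0 : (0 < lorentz_const r s * pi^-1)%R by rewrite mulr_gt0// invr_gt0 pi_gt0.
exists (C / (lorentz_const r s * pi^-1))%R; first exact: divr_gt0.
move=> f a b c d D N intf f0 fI cd bcda D0 HD fN.
have mf : measurable_fun [set: R] f by exact: L1_measurable.
have lf : lorentz u p q f by split => //; rewrite (le_lt_trans fN)// ltry.
have If : (0 <= \int[mu]_y f y)%R.
  by apply: Rintegral_ge0.
pose J : set R := `](c)%R, d[%classic.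
have mJ : measurable J by exact: measurable_itv.
pose k := (pi^-1 * (D^-1 * \int[mu]_y f y))%R.
have Hk x : J x -> (k <= `|hilbert f x|)%R.
  rewrite /J/= in_itv/= => xJ; have /andP[cx xd] := xJ.
  case: bcda => [bc|da].
    apply: (@hilbert_bump _ f x ((x - b) / 2) D 1 _ _ _ _ _).2 => //.
    - by rewrite divr_gt0// subr_gt0 (le_lt_trans bc).
    - by rewrite normr1.
    - move=> y /fI yI; have /andP[ay yb] := yI; rewrite mul1r; split; first by lra.
      by rewrite (le_trans (ler_norm _))// HD.
  apply: (@hilbert_bump _ f x ((a - x) / 2) D (-1) _ _ _ _ _).2 => //.
  - by rewrite divr_gt0// subr_gt0 (lt_le_trans xd).
  - by rewrite normrN1.
  - move=> y /fI yI; have /andP[ay yb] := yI; rewrite mulN1r; split; first by lra.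
    by rewrite (le_trans (ler_norm _))// normrN HD.
have := @lorentz_lower_set _ u (weight_measurable wu) wu.2 r s (hilbert f) J k r0 s0 mJ.
rewrite itv_massE lte_fin itv_mass_gt0// ltry => /(_ isT isT) h.
have k00 : (0 <= k)%R.
  by rewrite /k !mulr_ge0 ?invr_ge0 ?pi_ge0// ltW.
have := le_trans (le_trans (h k00 Hk) (HC _ lf)) (lee_wpmul2l _ fN).
rewrite lee_fin (ltW C0) => /(_ isT); rewrite -EFinM lee_fin /k -/(itv_mass c d).
move=> h'; rewrite [leRHS]mulrAC ler_pdivlMr//; move: h'.
by apply: le_trans; rewrite le_eqVlt; apply/orP; left; apply/eqP; rewrite /J; ring.
Qed.

Lemma interval_test (p r : R) (q s : \bar R) : (0 < p)%R -> (0 < r)%R -> 0 < q -> 0 < s ->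
  hilbert_bounded u p q r s ->
  exists2 C : R, (0 < C)%R & forall (E : set R) (a b c d D m : R),
    measurable E -> E `<=` `](a)%R, b[%classic ->
    (c < d)%R -> (b <= c)%R \/ (d <= a)%R -> (0 < D)%R ->
    (forall x y, (c < x < d)%R -> (a < y < b)%R -> (`|x - y| <= D)%R) ->
    (0 < m)%R -> nu E <= m%:E ->
    (D^-1 * fine (mu E) * itv_mass c d `^ r^-1 <= C * m `^ p^-1)%R.
Proof.
move=> p0 r0 q0 s0 /(bump_test r0 s0)[C C0 HC].
have [K K0 HK] := lorentz_indic p0 q0.
exists (C * K)%R; first exact: mulr_gt0.
move=> E a b c d D m mE EI cd bcda D0 HD m0 Em.
have mab : measurable (`](a)%R, b[%classic : set R) by exact: measurable_itv.
have Efin : mu E < +oo.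
  apply: (@le_lt_trans _ _ (mu `](a)%R, b[%classic)); first by apply: le_measure; rewrite ?inE.
  by rewrite [ltLHS]lebesgue_measure_itv/=; case: ifPn => _; rewrite ?ltry// -EFinD ltry.
have L1E : L1 (\1_E : R -> R).
  apply/integrableP; split; first by apply/measurable_EFinP; exact: measurable_indic.
  under eq_integral do rewrite /= ger0_norm//.
  by rewrite integral_indic// setIT.
have := HC (\1_E : R -> R) a b c d D _ L1E _ _ cd bcda D0 HD (HK _ _ mE m0 Em).
rewrite /Rintegral integral_indic// setIT mulrA; apply.
- by [].
- by move=> y; rewrite indicE pnatr_eq0 eqb0 negbK => /set_mem/EI; rewrite /= in_itv.
Qed.

End weight.
End weights.

(** * Excluded exponents *)

Section power_comparison.
Context {R : realType}.

Lemma powR_le_inv (x K al : R) : (0 <= x)%R -> (0 < al)%R ->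
  (x `^ al <= K)%R -> (x <= K `^ al^-1)%R.
Proof.
move=> x0 al0 xK; rewrite -[leLHS]powRr1// -(mulfV (lt0r_neq0 al0)) powRrM.
by rewrite ge0_ler_powR// ?invr_ge0 ?nnegrE ?(le_trans _ xK) ?powR_ge0 ?ltW.
Qed.

Lemma natr_unbounded (c K : R) : (0 < c)%R -> exists n : nat, (K < n%:R * c)%R.
Proof.
move=> c0; exists (Num.truncn (K / c)).+1.
by rewrite -ltr_pdivrMr// Num.Theory.truncnS_gt.
Qed.

End power_comparison.

Section doubling_weights.
Context {R : realType}.
Context {u : R -> R} (wu : weight u).
Local Notation mass := (itv_mass wu).
Local Notation mu := (@lebesgue_measure R).

(** Two successive doublings of []x, x + h[] reach beyond [x - h]. *)
Lemma doubling_mass : doubling u -> exists2 C : R, (0 < C)%R &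
  forall x h : R, (0 < h)%R -> (mass (x - h) x <= C * mass x (x + h))%R.
Proof.
move=> [C C0 HC]; exists (C * C)%R; first exact: mulr_gt0.
have dil (a b c d : R) : (a < b)%R -> (c = (a + b) / 2 - (b - a))%R ->
    (d = (a + b) / 2 + (b - a))%R -> (mass c d <= C * mass a b)%R.
  move=> ab -> ->; have := HC true true a b ab.
  rewrite /dilate2 !(wmeasE (weight_measurable wu) wu.2); [|exact: measurable_itv..].
  by rewrite !itv_mass_bitv -EFinM lee_fin.
move=> x h h0; apply: (@le_trans _ _ (mass (x - 3 / 2 * h) (x + 5 / 2 * h))).
  by apply: itv_mass_sub; lra.
apply: (@le_trans _ _ (C * mass (x - h / 2) (x + 3 / 2 * h))%R).
  by apply: dil; [lra|field|field].
by rewrite -(mulrA C) (ler_pM2l C0); apply: dil; [lra|field|field].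
Qed.

(** Bisect []0, 1[] repeatedly, keeping the half of smaller mass. *)
Lemma small_mass (n : nat) : exists a b : R,
  (a < b)%R /\ (n%:R * mass a b <= mass 0 1)%R.
Proof.
suff [a [b [ab H]]] : exists a b : R, (a < b)%R /\ (2 ^+ n * mass a b <= mass 0 1)%R.
  exists a, b; split => //; apply: le_trans H.
  rewrite ler_wpM2r ?itv_mass_ge0// -natrX ler_nat.
  exact/ltnW/ltn_expl.
elim: n => [|n [a [b [ab H]]]]; first by exists 0%R, 1%R; rewrite ltr01 mul1r.
pose c := ((a + b) / 2)%R.
have ac : (a < c)%R by rewrite /c; lra.
have cb : (c < b)%R by rewrite /c; lra.
have E := itv_massD wu (ltW ac) (ltW cb).
have P : (0 <= 2 ^+ n :> R)%R by exact: exprn_ge0.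
have [le|le] := leP (mass a c) (mass c b).
  exists a, c; split => //; apply: le_trans H.
  by rewrite exprS mulrAC mulrC ler_wpM2l// E; lra.
exists c, b; split => //; apply: le_trans H.
by rewrite exprS mulrAC mulrC ler_wpM2l// E; lra.
Qed.

(** Each []2 ^ n, 2 ^ n.+1[] is comparable with its left neighbour []0, 2 ^ n[], which contains []0,
    1[], so it adds at least [mass 0 1 / C]. *)
Lemma large_mass : doubling u -> forall K : R, exists a b : R,
  (a < b)%R /\ (K < mass a b)%R.
Proof.
move=> /doubling_mass[C C0 HC] K.
have m0 : (0 < mass 0 1)%R by exact: itv_mass_gt0.
have P n : (0 < 2 ^+ n :> R)%R by exact: exprn_gt0.
have H n : ((1 + n%:R / C) * mass 0 1 <= mass 0 (2 ^+ n))%R.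
  elim: n => [|n IH]; first by rewrite mul0r addr0 mul1r expr0.
  have := HC (2 ^+ n)%R _ (P n); rewrite subrr => h.
  have -> : (2 ^+ n.+1 = 2 ^+ n + 2 ^+ n :> R)%R by rewrite exprS; ring.
  have PP : (2 ^+ n <= 2 ^+ n + 2 ^+ n :> R)%R by rewrite lerDl ltW.
  rewrite (itv_massD wu (ltW (P n)) PP).
  have lo : (mass 0 1 / C <= mass (2 ^+ n) (2 ^+ n + 2 ^+ n))%R.
    rewrite ler_pdivrMr// mulrC; apply: le_trans h.
    by apply: itv_mass_sub => //; rewrite exprn_ege1// ler1n.
  by rewrite -natr1; apply: le_trans (lerD IH lo); rewrite le_eqVlt; apply/orP; left; apply/eqP; field; rewrite gt_eqF.
have [n Kn] := natr_unbounded K (divr_gt0 m0 C0).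
exists 0%R, (2 ^+ n)%R; split => //; apply: lt_le_trans (H n).
by apply: (lt_le_trans Kn); rewrite mulrDl mul1r mulrCA mulrC -mulrA [(_^-1 * _)%R]mulrC lerDr ltW.
Qed.

(** Testing the left neighbour of []a, b[] and doubling bound the power [1/r] of every mass by [K]
    times its power [1/p]. Large masses refute [1/p < 1/r], small ones [1/r < 1/p]. *)
Lemma no_off_diagonal (p r : R) (q s : \bar R) : (0 < p)%R -> (0 < r)%R ->
  0 < q -> 0 < s -> p <> r -> doubling u -> ~ hilbert_bounded u p q r s.
Proof.
move=> p0 r0 q0 s0 pr dbl /(interval_test wu p0 r0 q0 s0)[C C0 HC].
have [C' C'0 HC'] := doubling_mass dbl.
have pi0 : (0 < p^-1)%R by rewrite invr_gt0.
have [K K0 HK] : exists2 K, (0 < K)%R &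
    forall a b, (a < b)%R -> (mass a b `^ r^-1 <= K * mass a b `^ p^-1)%R.
  exists (2 * C * C' `^ p^-1)%R; first by rewrite !mulr_gt0// powR_gt0.
  move=> a b ab; pose h := (b - a)%R.
  have h0 : (0 < h)%R by rewrite subr_gt0.
  have mab : measurable (`](a - h)%R, a[%classic : set R) by exact: measurable_itv.
  have mp : (0 < mass (a - h) a)%R by apply: itv_mass_gt0; rewrite ltrBlDr ltrDl.
  have h20 : (0 < 2 * h)%R by exact: mulr_gt0.
  have := HC _ (a - h)%R a a b (2 * h)%R _ mab (@subset_refl _ _) ab (or_introl (lexx a)) h20 _ mp.
  rewrite itv_massE lexx [mu _]lebesgue_measure_itv/= lte_fin ltrBlDr ltrDl h0 -EFinD/=.
  have -> : ((2 * h)^-1 * (a - (a - h)) = 2^-1)%R by field; rewrite gt_eqF.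
  move=> /(_ _ isT) H.
  have {H} : (2^-1 * mass a b `^ r^-1 <= C * mass (a - h) a `^ p^-1)%R.
    apply: H => x y /andP[ax xb] /andP[ay ya].
    by rewrite ger0_norm; rewrite /h in ay *; lra.
  rewrite ler_pdivrMl// => /le_trans; apply.
  rewrite -!mulrA ler_pM2l// ler_pM2l// -powRM ?itv_mass_ge0 ?(ltW C'0)//.
  rewrite ge0_ler_powR ?(ltW pi0) ?nnegrE ?itv_mass_ge0//.
    by rewrite mulr_ge0 ?itv_mass_ge0// ltW.
  have ahb : (a + h = b)%R by rewrite /h; ring.
  by have := HC' a h h0; rewrite ahb.
have [rp|rp|rp] := ltgtP p^-1%R r^-1%R.
- pose al := (r^-1 - p^-1)%R; have al0 : (0 < al)%R by rewrite subr_gt0.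
  have [a [b [ab]]] := large_mass dbl (K `^ al^-1).
  apply/negP; rewrite -leNgt; apply: powR_le_inv; rewrite ?itv_mass_ge0//.
  have m0 : (0 < mass a b)%R by exact: itv_mass_gt0.
  rewrite -(ler_pM2r (powR_gt0 p^-1 m0)) -powRD; first by rewrite subrK HK.
  by apply/implyP => _; rewrite gt_eqF.
- pose al := (p^-1 - r^-1)%R; have al0 : (0 < al)%R by rewrite subr_gt0.
  have M0 : (0 < (mass 0 1)^-1)%R by rewrite invr_gt0 itv_mass_gt0.
  have [n Kn] := natr_unbounded (K `^ al^-1) M0.
  have [a [b [ab H]]] := small_mass n.
  have m0 : (0 < mass a b)%R by exact: itv_mass_gt0.
  have : ((mass a b)^-1 <= K `^ al^-1)%R.
    apply: powR_le_inv; rewrite ?invr_ge0 ?(ltW m0)//.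
    rewrite -powR_inv1 ?(ltW m0)// -powRrM mulN1r.
    rewrite -(ler_pM2r (powR_gt0 p^-1 m0)) -powRD; first by rewrite opprB subrK HK.
    by apply/implyP => _; rewrite gt_eqF.
  apply/negP; rewrite -ltNge; apply: (lt_le_trans Kn).
  by rewrite ler_pdivrMr ?itv_mass_gt0// mulrC ler_pdivlMr.
- by apply: pr; apply: invr_inj.
Qed.

(** Among [N] equal pieces of []0, 1[] take one of mass [m] at most the average. Tested against the
    rest on its left and on its right it yields masses at most [(C N) ^ p m], so
    [N m <= (2 (C N) ^ p + 1) m]; with [p < 1] this fails for large [N]. *)
Lemma no_diagonal (p : R) (q s : \bar R) : (0 < p)%R -> (p < 1)%R ->
  0 < q -> 0 < s -> ~ hilbert_bounded u p q p s.
Proof.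
move=> p0 p1 q0 s0 /(interval_test wu p0 p0 q0 s0)[C C0 HC].
have H (n : nat) : (n.+1%:R <= 2 * (C * n.+1%:R) `^ p + 1)%R.
  pose N : R := n.+1%:R; have N0 : (0 < N)%R by [].
  pose t (k : nat) : R := (k%:R / N)%R.
  have t0 k : (0 <= t k)%R by rewrite divr_ge0.
  have tS k : (t k < t k.+1)%R by rewrite ltr_pM2r ?invr_gt0// ltr_nat.
  have tD k : (t k.+1 - t k = N^-1)%R by rewrite -mulrBl -natr1 addrC addKr mul1r.
  have tN : (t n.+1 = 1)%R by rewrite /t divff// gt_eqF.
  have sumE k : mass 0 (t k) = (\sum_(i < k) mass (t i) (t i.+1))%R.
    elim: k => [|k IH]; last by rewrite big_ord_recr/= -IH (itv_massD wu (t0 k) (ltW (tS k))).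
    rewrite big_ord0 /t mul0r; have := itv_massD wu (lexx 0%R) (lexx 0%R).
    by move/eqP; rewrite addrC -subr_eq subrr eq_sym => /eqP.
  have M0 : (0 < mass 0 1)%R by exact: itv_mass_gt0.
  have [k kn Hk] : exists2 k, (k <= n)%N & (N * mass (t k) (t k.+1) <= mass 0 1)%R.
    apply: contrapT => no.
    suff : (mass 0 1 < mass 0 1)%R by rewrite ltxx.
    rewrite -[X in (_ < mass _ X)%R]tN sumE.
    apply: (@le_lt_trans _ _ (\sum_(i < n.+1) mass 0 1 / N)%R).
      by rewrite sumr_const card_ord -mulr_natr divfK ?gt_eqF.
    apply: ltr_sum => [|i _]; first by apply/hasP; exists ord0 => //; rewrite mem_index_enum.
    rewrite ltr_pdivrMr// mulrC ltNge; apply/negP => h; apply: no.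
    by exists i => //; rewrite -ltnS.
  have k1 : (t k.+1 <= 1)%R by rewrite -tN ler_pM2r ?invr_gt0// ler_nat.
  pose m := mass (t k) (t k.+1).
  have m0 : (0 < m)%R by exact: itv_mass_gt0.
  have mI : measurable (`](t k)%R, (t k.+1)[%classic : set R) by exact: measurable_itv.
  have side c d : (c <= d)%R -> (0 <= c)%R -> (d <= 1)%R ->
      (t k.+1 <= c)%R \/ (d <= t k)%R -> (mass c d <= (C * N) `^ p * m)%R.
    rewrite le_eqVlt => /orP[/eqP->|cd] c0 d1 cdt.
      have := itv_massD wu (lexx d) (lexx d).
      move/eqP; rewrite addrC -subr_eq subrr eq_sym => /eqP->.
      by rewrite mulr_ge0 ?powR_ge0// ltW.
    have := HC _ (t k) (t k.+1) c d 1%R _ mI (@subset_refl _ _) cd cdt ltr01 _ m0.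
    rewrite itv_massE lexx [mu _]lebesgue_measure_itv/= lte_fin tS -EFinD/= tD.
    move=> /(_ _ isT) h.
    have {h} : (1^-1 / N * mass c d `^ p^-1 <= C * m `^ p^-1)%R.
      apply: h => x y /andP[cx xd] /andP[ty yt]; rewrite ler_norml.
      by have tk := t0 k; apply/andP; split; lra.
    rewrite invr1 mul1r ler_pdivrMl// mulrA [(N * C)%R]mulrC => h.
    have pi0 : (0 < p^-1)%R by rewrite invr_gt0.
    have := powR_le_inv (itv_mass_ge0 wu c d) pi0 h.
    rewrite invrK (powRM _ (mulr_ge0 (ltW C0) (ltW N0)) (powR_ge0 _ _)).
    by rewrite -powRrM mulVf ?gt_eqF// powRr1// ltW.
  have L := side _ _ (t0 k) (lexx _) (le_trans (ltW (tS k)) k1) (or_intror (lexx _)).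
  have Rt := side _ _ k1 (t0 _) (lexx _) (or_introl (lexx _)).
  rewrite -(ler_pM2r m0); apply: (le_trans Hk).
  rewrite (itv_massD wu (t0 k) (le_trans (ltW (tS k)) k1)) (itv_massD wu (ltW (tS k)) k1).
  by rewrite -/m -/N; lra.
pose K := (2 * C `^ p + 1)%R.
have al0 : (0 < 1 - p)%R by rewrite subr_gt0.
have [n Kn] := natr_unbounded (K `^ (1 - p)^-1) ltr01.
have N0 : (0 < n.+1%:R :> R)%R by [].
have : (n.+1%:R <= K `^ (1 - p)^-1)%R.
  apply: powR_le_inv => //.
  rewrite -(ler_pM2r (powR_gt0 p N0)) -powRD; last by rewrite pnatr_eq0 implybT.
  rewrite subrK powRr1//; apply: (le_trans (H n)).
  rewrite powRM ?(ltW C0)// /K [leRHS]mulrDl mul1r mulrA lerD2l.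
  have : (1 `^ p <= n.+1%:R `^ p :> R)%R.
    by rewrite ge0_ler_powR ?(ltW p0) ?nnegrE// ler1n.
  by rewrite powR1.
apply/negP; rewrite -ltNge; apply: (lt_trans Kn).
by rewrite mulr1 ltr_nat.
Qed.

End doubling_weights.

(** * Necessity of A1 *)

Section A1_necessity.
Context {R : realType}.
Context {u : R -> R} (wu : weight u).
Local Notation mass := (itv_mass wu).
Local Notation mu := (@lebesgue_measure R).
Local Notation nu := (density (weight_measurable wu)).

Definition A1_mass (C : R) := {ae mu, forall x, forall a b : R,
  (a < x)%R -> (x < b)%R -> (mass a b <= C * (b - a) * u x)%R}.

Lemma lebesgue_itv_fine (a b : R) : (a < b)%R ->
  mu `](a)%R, b[%classic = (b - a)%:E.
Proof. by move=> ab; rewrite [LHS]lebesgue_measure_itv/= lte_fin ab. Qed.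

(** Test twice through the right neighbour [J] of [I = ]a, b[]: up to constants, [E] against [J]
    gives [|E| u(J) <= |I| u(E)], and [J] against [I] gives [u(I) <= u(J)]. *)
Lemma hilbert_bounded_subset (q : \bar R) : 0 < q ->
  hilbert_bounded u 1 q 1 +oo -> exists2 K : R, (0 < K)%R &
    forall (E : set R) (a b m : R), (a < b)%R -> measurable E ->
      E `<=` `](a)%R, b[%classic -> (0 < m)%R -> nu E <= m%:E ->
      (fine (mu E) * mass a b <= K * (b - a) * m)%R.
Proof.
move=> q0 /(interval_test wu ltr01 ltr01 q0 (ltry 0%R))[C C0 HC].
exists (4 * C * C)%R; first by rewrite !mulr_gt0.
move=> E a b m ab mE EI m0 Em; pose h := (b - a)%R.
have h0 : (0 < h)%R by rewrite subr_gt0.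
have h20 : (0 < 2 * h)%R by rewrite mulr_gt0.
pose c := (b + h)%R; have bc : (b < c)%R by rewrite /c ltrDl.
have mJ : (0 < mass b c)%R by exact: itv_mass_gt0.
have IJ : ((2 * h)^-1 * (c - b) * mass a b <= C * mass b c)%R.
  have mbc : measurable (`](b)%R, c[%classic : set R) by exact: measurable_itv.
  have := HC _ b c a b (2 * h)%R _ mbc (@subset_refl _ _) ab (or_intror (lexx b)) h20 _ mJ.
  rewrite itv_massE lexx lebesgue_itv_fine//= invr1 !powRr1 ?itv_mass_ge0// => H.
  apply: H => // x y /andP[ax xb] /andP[yb yc]; rewrite ler_norml.
  by rewrite /c /h in yc *; apply/andP; split; lra.
have EJ : ((2 * h)^-1 * fine (mu E) * mass b c <= C * m)%R.
  have := HC E a b b c (2 * h)%R m mE EI bc (or_introl (lexx b)) h20 _ m0 Em.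
  rewrite invr1 !powRr1 ?itv_mass_ge0 ?(ltW m0)// => H.
  apply: H => x y /andP[bx xc] /andP[ay yb]; rewrite ler_norml.
  by rewrite /c /h in xc *; apply/andP; split; lra.
have {}IJ : (mass a b <= 2 * C * mass b c)%R.
  move: IJ; rewrite /c addrAC subrr add0r.
  rewrite (_ : (2 * h)^-1 * h = 2^-1)%R; last by field; rewrite gt_eqF.
  by rewrite ler_pdivrMl// mulrA.
have {}EJ : (fine (mu E) * mass b c <= 2 * C * h * m)%R.
  by move: EJ; rewrite -mulrA ler_pdivrMl// => /le_trans; apply; rewrite le_eqVlt; apply/orP; left; apply/eqP; ring.
apply: (@le_trans _ _ (fine (mu E) * (2 * C * mass b c))%R).
  by rewrite ler_wpM2l// fine_ge0.
apply: (@le_trans _ _ (2 * C * (2 * C * h * m))%R); last first.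
  by rewrite le_eqVlt; apply/orP; left; apply/eqP; rewrite /h; ring.
by rewrite mulrCA ler_wpM2l// mulr_ge0// ltW.
Qed.

(* Were [u] below half its mean on a set of positive measure, that set would
   carry too little mass. *)
Lemma hilbert_bounded_A1_mass (q : \bar R) : 0 < q ->
  hilbert_bounded u 1 q 1 +oo -> exists2 C : R, (0 < C)%R & A1_mass C.
Proof.
move=> q0 /(hilbert_bounded_subset q0)[K K0 HK].
have loc (a b : R) : {ae mu, forall x, (a < x)%R -> (x < b)%R ->
    (mass a b <= 2 * K * (b - a) * `|u x|)%R}.
  have [ba|ab] := leP b a.
    by apply: aeW => x ax xb; have := lt_trans ax xb; rewrite ltNge ba.
  have m0 : (0 < mass a b)%R by exact: itv_mass_gt0.
  have Kh : (0 < 2 * K * (b - a))%R by rewrite !mulr_gt0// subr_gt0.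
  (* At this threshold a set [E] of positive measure would give [mass a b <= mass a b / 2]. *)
  pose la := (mass a b / (2 * K * (b - a)))%R.
  have la0 : (0 < la)%R by exact: divr_gt0.
  pose E := `](a)%R, b[%classic `&` [set x | (`|u x| < la)%R].
  have mu_ := weight_measurable wu.
  have mE : measurable E.
    apply: measurableI => //.
    rewrite (_ : [set x | _] = (Num.norm \o u) @^-1` `]-oo, la[%classic).
      rewrite -[X in measurable X]setTI.
      have mnu : measurable_fun [set: R] (Num.norm \o u) by exact: measurableT_comp.
      exact: (mnu measurableT _ (measurable_itv _)).
    by apply/seteqP; split => x /=; rewrite in_itv/=.
  have Efin : mu E \is a fin_num.
    rewrite ge0_fin_numE//; apply: (@le_lt_trans _ _ (mu `](a)%R, b[%classic)).
      by apply: le_measure; rewrite ?inE//; exact: subIsetl.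
    by rewrite lebesgue_itv_fine// ltry.
  have E0 : mu E = 0.
    apply/eqP; rewrite eq_le measure_ge0 andbT leNgt; apply/negP => Epos.
    have e0 : (0 < fine (mu E))%R by rewrite fine_gt0// Epos ltey_eq Efin.
    have Em : nu E <= (la * fine (mu E))%:E.
      rewrite EFinM fineK//; apply: (@le_trans _ _ (\int[mu]_(x in E) la%:E)).
        apply: (@ge0_le_integral_sup _ _ R mu) => // x.
          by move=> _; rewrite lee_fin ltW.
        by move=> [_ /=] h; rewrite lee_fin ltW.
      by rewrite integral_cst.
    have := HK E a b _ ab mE (@subIsetl _ _ _) (mulr_gt0 la0 e0) Em.
    rewrite mulrC mulrA ler_pM2r// leNgt; apply/negP; rewrite negbK.
    have -> : (K * (b - a) * la = mass a b / 2)%R.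
      by rewrite /la; field; rewrite !gt_eqF// subr_gt0.
    by lra.
  exists E; split => // x /= /not_implyP[ax /not_implyP[xb /negP]].
  rewrite -ltNge => h; split; first by rewrite /= in_itv/= ax xb.
  by rewrite /= ltr_pdivlMr// mulrC.
(* Rational ends give one null set for all intervals; any interval lies in a rational one less than
   three times as long, which triples the constant. *)
have {loc} : {ae mu, forall x, forall n : nat,
    if (unpickle n : option (rat * rat)) is Some ab then
      (ratr ab.1 < x)%R -> (x < ratr ab.2)%R ->
      (mass (ratr ab.1) (ratr ab.2) <=
        2 * K * (ratr ab.2 - ratr ab.1) * `|u x|)%R
    else True}.
  apply: ae_foralln => n; case: (unpickle n) => [[a b]|]; first exact: loc.
  exact: aeW.
move=> h; exists (2 * K * 3)%R; first by rewrite !mulr_gt0.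
apply: lebesgue_aeS (lebesgue_aeI h wu.2) => x [{}h u0] a b ax xb.
have ab := lt_trans ax xb.
have al : (a - (b - a) < a)%R by rewrite ltrBlDr ltrDl subr_gt0.
have [a'] := rat_in_itvoo al.
rewrite in_itv/= => /andP[a'1 a'2].
have bl : (b < b + (b - a))%R by rewrite ltrDl subr_gt0.
have [b'] := rat_in_itvoo bl.
rewrite in_itv/= => /andP[b'1 b'2].
have := h (pickle (a', b')); rewrite pickleK/= => /(_ (lt_trans a'2 ax) (lt_trans xb b'1)).
rewrite gtr0_norm// => H.
apply: (le_trans (itv_mass_sub wu (ltW a'2) (ltW b'1))).
have K20 : (0 < 2 * K)%R by rewrite mulr_gt0.
by apply: (le_trans H); rewrite ler_pM2r// -[leRHS]mulrA (ler_pM2l K20); lra.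
Qed.

Lemma iavg_bitv (l r : bool) (a b : R) : (a < b)%R ->
  iavg u (bitv l r a b) = ((b - a)^-1 * mass a b)%:E.
Proof.
move=> ab; rewrite /iavg EFinM; congr (_ * _).
  rewrite /bitv lebesgue_measure_itv/= lte_fin ab -EFinD inver.
  by rewrite gt_eqF// subr_gt0.
by rewrite -(itv_mass_bitv wu l r).
Qed.

(** In [maximal] the point [x] may be an end of the interval, in [A1_mass] it is inside. Enlarging
    by [d] on both sides costs [2 C d u x = e]. *)
Lemma A1_mass_A1 (C : R) : A1_mass C -> (0 < C)%R -> A1 u.
Proof.
move=> HC C0; exists C; apply: lebesgue_aeS (lebesgue_aeI HC wu.2) => x [{}HC u0].
apply: ge_ereal_sup => _ [l [r [a [b [ab xI ->]]]]].
rewrite iavg_bitv// -EFinM lee_fin.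
rewrite ler_pdivrMl ?subr_gt0//.
have {xI}[ax xb] : (a <= x)%R /\ (x <= b)%R.
  by move: xI; rewrite /bitv/=; case: l; case: r; rewrite in_itv/= => /andP[? ?]; split=> //; exact: ltW.
apply/ler_addgt0Pr => e e0.
have Cu : (0 < 2 * C * u x)%R by rewrite !mulr_gt0.
pose d := (e / (2 * C * u x))%R; have d0 : (0 < d)%R by exact: divr_gt0.
have := HC (a - d)%R (b + d)%R.
rewrite ltrBlDr ltr_pwDr// (le_lt_trans xb) ?ltrDl// => /(_ isT isT).
have /le_trans h : (mass a b <= mass (a - d) (b + d))%R.
  by apply: itv_mass_sub; rewrite ?gerBl ?lerDl ltW.
move=> /h /le_trans; apply; rewrite le_eqVlt; apply/orP; left; apply/eqP.
by rewrite /d; field; rewrite !gt_eqF.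
Qed.

(** The constant is raised to at least 1, as the good-lambda argument asks. *)
Lemma A1_A1_bound : A1 u -> exists2 C : R, (1 <= C)%R &
  A1_bound (weight_measurable wu) C.
Proof.
move=> [C HC]; exists (Num.max 1 C)%R; first by rewrite le_max lexx.
apply: lebesgue_aeS (lebesgue_aeI HC wu.2) => x [{}HC u0] a b ax xb.
have ab := lt_trans ax xb.
rewrite itv_massE lee_fin gtr0_norm//.
apply: (@le_trans _ _ (C * (b - a) * u x)%R); last first.
  rewrite -!mulrA; apply: ler_wpM2r; last by rewrite le_max lexx orbT.
  by apply: mulr_ge0; [rewrite subr_ge0 ltW|exact: ltW].
have : iavg u (bitv false true a b) <= maximal u x.
  apply: ereal_sup_ubound; exists false, true, a, b; split => //.
  by rewrite /bitv/= in_itv/= ax xb.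
move=> /le_trans /(_ HC); rewrite iavg_bitv// -EFinM lee_fin ler_pdivrMl ?subr_gt0//.
by rewrite mulrA [(_ * C)%R]mulrC.
Qed.

End A1_necessity.

(** * Unboundedness for q greater than 1 *)

Section no_weight.
Context {R : realType}.
Context {u : R -> R} (wu : weight u).
Local Notation mass := (itv_mass wu).
Local Notation mu := (@lebesgue_measure R).
Local Notation nu := (density (weight_measurable wu)).
Local Notation L1 f := (mu.-integrable [set: R] (EFin \o f)).

Variables (x0 M : R) (M0 : (0 < M)%R).
Hypothesis HM : forall h, (0 < h)%R -> (mass (x0 - h) (x0 + h) <= M * h)%R.

Let B (k : nat) : set R := `](x0 - 2^-1 ^+ k)%R, (x0 + 2^-1 ^+ k)%R[%classic.

(* Truncations of the function of size [|x - x0|^-1] near [x0]. *)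
Definition dyadic_peak (n : nat) (x : R) : R := (\sum_(k < n) 2 ^+ k * \1_(B k) x)%R.

Let half0 k : (0 < 2^-1 ^+ k :> R)%R. Proof. by rewrite exprn_gt0. Qed.

Let mB k : measurable (B k). Proof. exact: measurable_itv. Qed.

Let BE k : B k = `](x0 - 2^-1 ^+ k)%R, (x0 + 2^-1 ^+ k)%R[%classic. Proof. by []. Qed.

Let B_nested j k x : (j <= k)%N -> B k x -> B j x.
Proof.
move=> jk; have h : (2^-1 ^+ k <= 2^-1 ^+ j :> R)%R by rewrite ler_wiXn2l// invf_le1// ler1n.
rewrite /B/= !in_itv/=; move: (_ ^+ j)%R (_ ^+ k)%R h => v w h /andP[? ?].
by apply/andP; split; lra.
Qed.

Let geo m : (\sum_(i < m) 2 ^+ i = 2 ^+ m - 1 :> R)%R.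
Proof.
elim: m => [|m IH]; first by rewrite big_ord0 expr0 subrr.
by rewrite big_ord_recr/= IH (exprS _ m); ring.
Qed.

(** The sets [B k] are nested, so outside [B k] only terms of index below [k] survive. *)
Let peak_level n k x : (k <= n)%N -> ~ B k x -> (dyadic_peak n x <= 2 ^+ k - 1)%R.
Proof.
move=> kn Bk; rewrite /dyadic_peak.
rewrite -geo (big_ord_widen _ (fun i => 2 ^+ i)%R kn) [leRHS]big_mkcond/=.
apply: ler_sum => i _; case: ifPn => [_|].
  by rewrite indicE ler_piMr ?exprn_ge0// lern1 leq_b1.
rewrite -leqNgt => ki; rewrite indicE memNset ?mulr0//.
by move=> /(B_nested ki).
Qed.

Let peak_ge0 n x : (0 <= dyadic_peak n x)%R.
Proof. by apply: sumr_ge0 => k _; rewrite mulr_ge0// exprn_ge0. Qed.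

Let nuB k : nu (B k) <= (M * 2^-1 ^+ k)%:E.
Proof. by rewrite itv_massE lee_fin HM. Qed.

(** Values above [2 ^ k - 1] occur only in [B k], of mass at most [M / 2 ^ k]. Going down from [n],
    stop at the first [k] with [t < M / 2 ^ k]; if there is none, the rearrangement vanishes at
    [t]. *)
Let peak_rearrangement n t : (0 < t)%R ->
  rearrangement u (dyadic_peak n) t <= 0 \/
  exists2 k, (k < n)%N & (t < M * 2^-1 ^+ k)%R /\
    rearrangement u (dyadic_peak n) t <= (2 ^+ k.+1)%:E.
Proof.
move=> t0.
have base k : (k <= n)%N -> (M * 2^-1 ^+ k <= t)%R ->
    rearrangement u (dyadic_peak n) t <= (2 ^+ k - 1)%:E.
  move=> kn kt; apply: rearrangement_le; first by rewrite subr_ge0 exprn_ege1// ler1n.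
  apply: (@le_trans _ _ (nu (B k))); last by rewrite (le_trans (nuB k))// lee_fin.
  apply: wmeas_le => // x /=; rewrite ger0_norm// => h; apply: contrapT => nB.
  by have := peak_level kn nB; rewrite leNgt h.
suff: forall m, (m <= n)%N -> rearrangement u (dyadic_peak n) t <= (2 ^+ m - 1)%:E ->
    rearrangement u (dyadic_peak n) t <= 0 \/
    exists2 k, (k < m)%N & (t < M * 2^-1 ^+ k)%R /\
      rearrangement u (dyadic_peak n) t <= (2 ^+ k.+1)%:E.
  apply => //; apply: rearrangement_le; first by rewrite subr_ge0 exprn_ege1// ler1n.
  rewrite (_ : [set x | _] = set0); first by rewrite /wmeas integral_set0 lee_fin ltW.
  apply/seteqP; split => // x /=; rewrite ger0_norm// ltNge => /negP; apply.
  rewrite -geo; apply: ler_sum => k _.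
  by rewrite indicE ler_piMr ?exprn_ge0// lern1 leq_b1.
elim=> [_ h|m IH mn h]; first by left; rewrite expr0 subrr in h.
have [tm|mt] := ltP t (M * 2^-1 ^+ m)%R.
  right; exists m => //; split => //; apply: (le_trans h).
  by rewrite lee_fin gerBl.
have [|[k km hk]] := IH (ltnW mn) (base m (ltnW mn) mt); first by left.
by right; exists k => //; exact: ltnW.
Qed.

(** Every dyadic level contributes equally, so for finite [q] the [q]-th power of the norm grows at
    most like [n]. *)
Let level_mass k : (2 ^+ k.+1 * (M * 2^-1 ^+ k) = 2 * M :> R)%R.
Proof. by rewrite (exprS _ k) mulrACA -mulrA [(_ * _ ^+ k)%R]mulrC -exprMn mulVf// expr1n mulr1. Qed.

Lemma dyadic_peak_norm (q : \bar R) : 1 < q -> exists K th : R,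
  [/\ (0 < K)%R, (th < 1)%R & forall n : nat,
    lorentz_norm u 1 q (dyadic_peak n) <= (K * n%:R `^ th)%:E].
Proof.
have M20 : (0 < 2 * M)%R by rewrite mulr_gt0.
case: q => [q| |]// q1; last first.
  exists (2 * M)%R, 0%R; split => // n; rewrite powRr0 mulr1 /lorentz_norm.
  apply: ge_ereal_sup => _ /= [t + <-]; rewrite in_itv/= andbT invr1 => t0.
  rewrite powRr1 ?(ltW t0)//.
  have [h|[k kn [tk h]]] := peak_rearrangement n t0.
    apply: (@le_trans _ _ (t%:E * 0)); first by rewrite lee_wpmul2l ?lee_fin ?(ltW t0).
    by rewrite mule0 lee_fin ltW.
  apply: (@le_trans _ _ (t%:E * (2 ^+ k.+1)%:E)).
    by rewrite lee_wpmul2l ?lee_fin ?(ltW t0).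
  by rewrite -EFinM lee_fin -(level_mass k) mulrC ler_pM2l ?exprn_gt0// ltW.
rewrite lte_fin in q1.
have q0 : (0 < q)%R by exact: lt_trans q1.
exists (((2 * M) `^ q / q) `^ q^-1)%R, q^-1%R; split.
- by rewrite powR_gt0// divr_gt0// powR_gt0.
- by rewrite invf_lt1.
move=> n.
pose b (k : nat) : R := ((2 ^+ k.+1) `^ q)%R.
pose a (k : nat) : R := (M * 2^-1 ^+ k)%R.
have b0 k : (0 <= b k)%R by exact: powR_ge0.
have a0 k : (0 < a k)%R by rewrite mulr_gt0.
have h := @lorentz_upper _ u 1 q (dyadic_peak n) n b a ltr01 q0 b0 a0.
apply: (le_trans (h _)) => [t t0|].
  have sum0 : 0 <= \sum_(i < n) (b i * (t < a i)%R%:R)%:E.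
    by apply: sume_ge0 => i _; rewrite lee_fin mulr_ge0.
  have [h0|[k kn [tk hk]]] := peak_rearrangement n t0.
    have -> : rearrangement u (dyadic_peak n) t = 0.
      by apply/le_anti; rewrite rearrangement_ge0 h0.
    by rewrite poweR_EFin powR0 ?gt_eqF.
  rewrite (bigD1 (Ordinal kn))//= tk mulr1 -[leLHS]adde0; apply: leeD.
    by rewrite /b -poweR_EFin; apply: lee_poweR; rewrite ?(ltW q0)// rearrangement_ge0.
  by apply: sume_ge0 => i _; rewrite lee_fin mulr_ge0.
rewrite lee_fin.
under eq_bigr => i _ do
  rewrite divr1 mulrA /b /a -powRM ?exprn_ge0 ?(ltW (a0 i))// level_mass.
have X : (0 <= (2 * M) `^ q / q)%R by rewrite divr_ge0 ?powR_ge0// ltW.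
by rewrite sumr_const card_ord -[(_ *+ n)%R]mulr_natr (powRM _ X (ler0n _ _)).
Qed.

Lemma dyadic_peak_integral n : L1 (dyadic_peak n) /\
  (\int[mu]_y dyadic_peak n y = n%:R * 2)%R.
Proof.
have L1B k : L1 (\1_(B k) : R -> R) by exact: integrable_indic_itv.
have [ig sg] := @Rintegral_sum_ord _ n (fun k y => 2 ^+ k * \1_(B k) y)%R
  (fun k => L1Z _ (L1B k)).
split => //; rewrite /dyadic_peak sg (eq_bigr (fun=> 2%R)) => [|k _].
  by rewrite sumr_const card_ord mulr_natl.
have e (E : set R) : measurable E -> \int[mu]_y (\1_E y)%:E = mu E.
  by move=> mE; rewrite integral_indic// setIT.
have Bk : (x0 - 2^-1 ^+ k < x0 + 2^-1 ^+ k)%R by rewrite ltrBlDr -addrA ltrDl addr_gt0.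
rewrite RintegralZl// /Rintegral e// (lebesgue_itv_fine Bk)/=.
have -> : (x0 + 2^-1 ^+ k - (x0 - 2^-1 ^+ k) = 2 * 2^-1 ^+ k :> R)%R by ring.
by rewrite mulrCA -exprMn mulfV// expr1n mulr1.
Qed.

(** Tested on the fixed interval []x0 + 1, x0 + 2[], the peaks have integral [2 n] and norm at most
    [K n ^ th] with [th < 1], so [n] would be at most a constant times [n ^ th]. *)
Lemma no_hilbert_bounded_gt1 (q : \bar R) : 1 < q ->
  ~ hilbert_bounded u 1 q 1 +oo.
Proof.
move=> q1 /(bump_test wu ltr01 (ltry 0%R))[C C0 HC].
have [K [th [K0 th1 HK]]] := dyadic_peak_norm q1.
have J1 : (x0 + 1 < x0 + 2)%R by rewrite ltrD2l ltr1n.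
have m0 : (0 < mass (x0 + 1) (x0 + 2))%R by exact: itv_mass_gt0.
set m := mass _ _ in m0.
have [n Kn] := natr_unbounded ((2 * (C * K) / m) `^ (1 - th)^-1) ltr01.
have th0 : (0 < 1 - th)%R by rewrite subr_gt0.
have [L1f intf] := dyadic_peak_integral n.+1.
have n0 : (0 < n.+1%:R :> R)%R by [].
have : (4^-1 * (\int[mu]_y dyadic_peak n.+1 y) * m `^ 1^-1 <= C * (K * n.+1%:R `^ th))%R.
  apply: (HC _ (x0 - 1) (x0 + 1) (x0 + 1) (x0 + 2))%R => //.
  - move=> y; apply: contraNT => yI; apply/eqP/big1 => k _.
    rewrite indicE memNset ?mulr0// => /(B_nested (leq0n k)).
    by rewrite /B/= in_itv/= expr0; exact/negP.
  - by left.
  - move=> x y /andP[x1 x2] /andP[y1 y2]; rewrite ler_norml.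
    by apply/andP; split; lra.
rewrite intf invr1 powRr1 ?(ltW m0)// => h.
have : (n.+1%:R `^ (1 - th) <= 2 * (C * K) / m)%R.
  rewrite -(ler_pM2r (powR_gt0 th n0)) -powRD; last by rewrite pnatr_eq0 implybT.
  rewrite subrK powRr1// mulrAC ler_pdivlMr//.
  by lra.
move=> /(powR_le_inv (ltW n0) th0); apply/negP; rewrite -ltNge.
by apply: (lt_trans Kn); rewrite mulr1 ltr_nat.
Qed.

End no_weight.

(** * Sufficiency of A1 *)

Section A1_sufficiency.
Context {R : realType}.
Context {u : R -> R} (wu : weight u).
Local Notation mu := (@lebesgue_measure R).
Local Notation nu := (density (weight_measurable wu)).

(** Some truncation already exceeds what its limit exceeds. Where the limit does not exist [hilbert]
    is 0, so the hypothesis fails there. *)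
Lemma hilbert_gt_htrunc f (x t : R) : (0 <= t)%R -> (t < `|hilbert f x|)%R ->
  exists2 e, (0 < e)%R & (pi * t < `|htrunc e f x|)%R.
Proof.
move=> t0; rewrite /hilbert; case: asboolP => [[_ cf]|_]; last first.
  by rewrite normr0 ltNge t0.
rewrite normrM ger0_norm ?invr_ge0 ?pi_ge0// ltr_pdivlMl ?pi_gt0// => lt.
have cn : `|hilbert_trunc f x e|%R @[e --> (0 : R)^'+] -->
    `|lim (hilbert_trunc f x e @[e --> (0 : R)^'+])|%R.
  exact: cvg_norm.
have : \forall e \near (0 : R)^'+, (0 < e)%R /\ (pi * t < `|hilbert_trunc f x e|)%R.
  near=> e; split; near: e; first exact: nbhs_right_gt.
  exact: (cvgr_gt _ cn).
move=> /filter_ex[e [e0 h]]; exists e => //.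
by rewrite -hilbert_truncE.
Unshelve. all: by end_near. Qed.

(** [lorentz_L1] puts [f] into [L^1(u)], and [weighted_weak] covers the level sets of the maximal
    truncation, which contain those of [hilbert f]; this bounds the rearrangement of [hilbert f]. *)
Lemma A1_hilbert_bounded (q : \bar R) : 0 < q -> q <= 1 -> A1 u ->
  hilbert_bounded u 1 q 1 +oo.
Proof.
case: q => [q| |]// q0 q1 /(A1_A1_bound wu)[C C1 HC].
rewrite lte_fin in q0; rewrite lee_fin in q1.
pose c := lorentz_const (1%R : R) q%:E; have c0 : (0 < c)%R by exact: lorentz_const_gt0.
have C0 : (0 < C)%R by exact: lt_le_trans C1.
have w0 := weight_norm_gt0 wu.
have bound f (mfu : measurable_fun [set: R] (f \* u)%R) (B : R) :
    measurable_fun [set: R] f -> (0 < B)%R ->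
    lorentz_norm u 1 q%:E f <= (c * B)%:E ->
    density mfu [set: R] <= (2 * c `^ q * B)%:E.
  by move=> mf B0 fB; exact: (@lorentz_L1 _ u (weight_measurable wu) wu.2 f mf q B q0 q1 B0 fB mfu).
have p0 := pi_gt0 R.
have cq0 : (0 < c `^ q)%R by exact: powR_gt0.
have K2 : (0 < 2 * c `^ q)%R by rewrite mulr_gt0// powR_gt0.
have data f : lorentz u 1 q%:E f -> [/\ measurable_fun [set: R] f,
    measurable_fun [set: R] (f \* u)%R & lorentz_norm u 1 q%:E f \is a fin_num].
  move=> [mf fN]; split => //; first by apply: measurable_funM => //; exact: weight_measurable.
  by rewrite ge0_fin_numE// poweR_ge0.
have norm_lt f : lorentz u 1 q%:E f -> forall e, (0 < e)%R -> (0 < (fine (lorentz_norm u 1 q%:E f) + e) / c)%R /\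
    lorentz_norm u 1 q%:E f <= (c * ((fine (lorentz_norm u 1 q%:E f) + e) / c))%:E.
  move=> /data[_ _ fN] e e0; split.
    by rewrite divr_gt0// ltr_wpDl// fine_ge0// poweR_ge0.
  by rewrite mulrC divfK ?gt_eqF// EFinD fineK// leeDl// lee_fin ltW.
have fin f (mfu : measurable_fun [set: R] (f \* u)%R) : lorentz u 1 q%:E f ->
    density mfu [set: R] < +oo.
  move=> lf; have [mf _ _] := data f lf; have [B0 fB] := norm_lt f lf 1%R ltr01.
  by apply: le_lt_trans (bound f mfu _ mf B0 fB) _; rewrite ltry.
split.
  move=> f lf; have [mf mfu _] := data f lf.
  have := hilbert_exists_ae C1 HC w0 mf (fin f mfu lf).
  by [].
have [K K0 HK] : exists2 K, (0 < K)%R & forall (f : R -> R) (mf : measurable_fun [set: R] f)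
    (mfu : measurable_fun [set: R] (f \* u)%R), density mfu [set: R] < +oo ->
    forall t, (0 < t)%R ->
    covered nu [set x | exists2 e, (0 < e)%R & (t < `|htrunc e f x|)%R]
      ((K / t)%:E * density mfu [set: R]).
  pose de := (2 * C)^-1%R; have de0 : (0 < de)%R by rewrite invr_gt0 mulr_gt0.
  pose ga := (de / (24 * hstar_const + 40))%R.
  have ga0 : (0 < ga)%R.
    rewrite divr_gt0//; have := @hstar_const_gt0 R.
    by move: (hstar_const) => k k0; lra.
  exists ((1 + de) * (12 * C ^+ 2 / ga) / de ^+ 2)%R.
    rewrite divr_gt0 ?exprn_gt0// mulr_gt0 ?addr_gt0// divr_gt0// mulr_gt0 ?exprn_gt0//.
  move=> f mf mfu ffin t t0.
  exact: (weighted_weak C1 HC w0 mf ffin t0).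
exists (K * (2 * c `^ q) / (pi * c))%R; first by apply: divr_gt0; apply: mulr_gt0.
move=> f lf; have [mf mfu fN] := data f lf.
rewrite -(fineK fN); set N := fine _ in fN *.
apply: ge_ereal_sup => _ /= [t + <-]; rewrite in_itv/= andbT invr1 => t0.
rewrite powRr1 ?(ltW t0)//.
(* The slack [e] keeps [B] positive even when the norm [N] is 0. *)
apply/lee_addgt0Pr => e e0.
pose A := (K * (2 * c `^ q) / (pi * c))%R.
have A0 : (0 < A)%R by apply: divr_gt0; apply: mulr_gt0.
have e'0 : (0 < e / A)%R by exact: divr_gt0.
have [B0 fB] := norm_lt f lf _ e'0.
set B := ((_ + _) / c)%R in B0 fB.
(* The level at which the weak type bound equals [t]. *)
pose s := (K * (2 * c `^ q * B) / (pi * t))%R.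
have s0 : (0 < s)%R by apply: divr_gt0; apply: mulr_gt0 => //; exact: mulr_gt0.
apply: (@le_trans _ _ (t%:E * s%:E)).
  rewrite lee_wpmul2l ?lee_fin ?(ltW t0)//.
  apply: rearrangement_le; first exact: ltW.
  have ps : (0 < pi * s)%R by exact: mulr_gt0.
  have [E [mE sE Et]] := HK f mf mfu (fin f mfu lf) _ ps.
  apply: (@le_trans _ _ (nu E)).
    by apply: wmeas_le => // x /= /(hilbert_gt_htrunc (ltW s0)) h; exact: sE.
  apply: (le_trans Et).
  have Kp : (0 <= K / (pi * s))%R by rewrite divr_ge0 ?ltW.
  apply: (le_trans (lee_wpmul2l _ (bound f mfu _ mf B0 fB))); first by rewrite lee_fin.
  rewrite -EFinM lee_fin le_eqVlt; apply/orP; left; apply/eqP.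
  by rewrite /s; move: (pi : R) p0 => P P0; field; rewrite !gt_eqF.
rewrite -EFinM -EFinM -EFinD lee_fin le_eqVlt; apply/orP; left; apply/eqP.
by rewrite /s /B /A -/N; move: (pi : R) p0 => P P0; field; rewrite !gt_eqF.
Qed.

End A1_sufficiency.

Unset Implicit Arguments.

Theorem theorem3p9 (R : realType) (p r : R) (q s : \bar R)
    (hp : (0 < p)%R) (hr : (0 < r)%R) (hq : 0 < q) (hs : 0 < s) :
  [/\ (p < 1)%R \/ p <> r ->
        ~ exists u : R -> R,
            [/\ weight u, doubling u & hilbert_bounded u p q r s],
      q <= 1 ->
        forall u : R -> R, weight u ->
          (hilbert_bounded u 1%R q 1%R +oo <-> A1 u)
    & 1 < q ->
        forall u : R -> R, weight u ->
          ~ hilbert_bounded u 1%R q 1%R +oo ].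
Proof.
split.
- move=> pr [u [wu dbl hb]].
  have [pr'|/eqP pr'] := eqVneq p r.
    subst r; case: pr => // p1.
    exact: (no_diagonal wu hp p1 hq hs hb).
  exact: (no_off_diagonal wu hp hr hq hs pr' dbl hb).
- move=> q1 u wu; split; last exact: A1_hilbert_bounded.
  by move=> /(hilbert_bounded_A1_mass wu hq)[C C0 HC]; exact: A1_mass_A1 HC C0.
move=> q1 u wu hb.
have [C C0 HC] := hilbert_bounded_A1_mass wu hq hb.
(* Boundedness forces the A1 bound; at one point [x] where it holds, the mass of []x - h, x + h[] is
   at most linear in [h], as the peaks require. *)
have [x [_ _ [Cx ux]]] := ae_itv_exists (lebesgue_aeI HC wu.2) (@ltr01 R).
have M0 : (0 < 2 * C * u x)%R by rewrite !mulr_gt0.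
have HM h : (0 < h)%R -> (itv_mass wu (x - h) (x + h) <= 2 * C * u x * h)%R.
  move=> h0; apply: (le_trans (Cx _ _ _ _)); rewrite ?ltrBlDr ?ltrDl//.
  by rewrite le_eqVlt; apply/orP; left; apply/eqP; ring.
exact: (no_hilbert_bounded_gt1 M0 HM q1 hb).
Qed.
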